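(* Let $k$ be a field and let $A$ and $B$ be split self-injective finite-dimensional $k$-algebras with no projective simple module. Let $X$ be an $(A,B)$-bimodule inducing a stable equivalence and having no non-zero projective direct summand. Let $\mathcal{S}=\{X\otimes_B L\}$, where $L$ runs over a complete set of representatives of isomorphism classes of simple $B$-modules, and let $\mathcal{G}$ be the category of $A$-modules equipped with a fixed $\mathcal{S}$-radical filtration (defined in the context). Then there is an equivalence of categories $\operatorname{gr}(B\text{-mod})\xrightarrow{\sim}\mathcal{G}$. If $B$ is basic, there is an isomorphism between the graded algebra $\bigoplus_{i\ge 0}\operatorname{rad}^i(B)/\operatorname{rad}^{i+1}(B)$ associated with the radical filtration of $B$ and $\operatorname{End}_{\mathcal{G}}(M)$, where $M=\bigoplus_{S\in\mathcal{S}}(P_S\oplus Q_S)$ is the object of $\mathcal{G}$ described in the context.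
   Context: Modules are finitely generated left modules. An algebra is split if the endomorphism ring of every simple module is $k$. For a self-injective algebra $A$, $A\text{-stab}$ is the stable category ($A\text{-mod}$ modulo maps factoring through projectives) and $\Omega M$ is the kernel of a projective cover of $M$. ''$X$ induces a stable equivalence'' means that $X$ is finitely generated, that $X\otimes_B-:B\text{-mod}\to A\text{-mod}$ is exact, sends projectives to projectives, and induces an equivalence of triangulated categories $B\text{-stab}\to A\text{-stab}$. $\operatorname{gr}(B\text{-mod})$: the category whose objects are the $B$-modules and where $\operatorname{Hom}(M,N)$ is the graded vector space associated to the filtration of $\operatorname{Hom}_B(M,N)$ with $i$-th term $\{f\mid \operatorname{im} f\subseteq \operatorname{rad}^iN\}$, with composition induced by that of $B\text{-mod}$. $\operatorname{add}\mathcal{S}$: modules isomorphic to finite direct sums of objects of $\mathcal{S}$. An $A$-module $M$ is filtrable if it has an $\mathcal{S}$-filtration, i.e. a filtration $0=M_r\subseteq\cdots\subseteq M_0=M$ by submodules with all $M_i/M_{i+1}\in\operatorname{add}\mathcal{S}$. An $\mathcal{S}$-radical filtration of a filtrable module $M$ is a filtration $0=M_r\subseteq\cdots\subseteq M_0=M$ such that, for each $i\geq 1$, $M_i$ is a minimal (for inclusion) element among the filtrable submodules of $M_{i-1}$ whose quotient in $M_{i-1}$ lies in $\operatorname{add}\mathcal{S}$. Category $\mathcal{G}$: objects are $A$-modules $M$ together with a fixed $\mathcal{S}$-radical filtration $(M_i)$; put $\bar M_i=M_i/M_{i+1}$. For filtered modules $M,N$, $\operatorname{Hom}^f_A(M,N)$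 is the space of $A$-linear $g$ with $g(M_i)\subseteq N_i$ for all $i$, and $\phi_i:\operatorname{Hom}^f_A(M,N)\to\operatorname{Hom}_{A\text{-stab}}(\bar M_i,\bar N_i)$ is the canonical map. The submodule $N_i$ is a filtered module with filtration $(N_i)_j=N_{i+j}$. Define $\operatorname{Hom}_{\mathcal{G}}(M,N)_i$ as the image of $\operatorname{Hom}_A^f(M,N_i)$ in $\operatorname{Hom}_{A\text{-stab}}(\bar M_0,\bar N_i)$ (via $\phi_0$) and $\operatorname{Hom}_{\mathcal{G}}(M,N)=\bigoplus_{i\ge0}\operatorname{Hom}_{\mathcal{G}}(M,N)_i$. For $f\in\operatorname{Hom}_{\mathcal{G}}(M,N)_i$ and $g\in\operatorname{Hom}_{\mathcal{G}}(L,M)_j$, choose a filtered map $\tilde f:M\to N_i$ lifting $f$; it induces $\phi_j(\tilde f)\in\operatorname{Hom}_{A\text{-stab}}(\bar M_j,\bar N_{i+j})$, which does not depend on the choice of $\tilde f$, and the product is $fg=\phi_j(\tilde f)\circ g\in\operatorname{Hom}_{A\text{-stab}}(\bar L_0,\bar N_{i+j})$. In particular $\operatorname{End}_{\mathcal{G}}(M)$ is a $\mathbf{Z}_{\ge 0}$-graded $k$-algebra. The object $M$: for $S\in\mathcal{S}$, let $P_S\to S$ be a projective cover with kernel $\Omega S$, let $Q_S$ be a minimal projective $A$-module such that $\Omega S\oplus Q_S$ is filtrable, and fix an $\mathcal{S}$-radical filtration of $P_S\oplus Q_S$ whose first proper term (index $1$) is $\Omega S\oplus Q_S$. $M=\bigoplus_{S\in\mathcal{S}}(P_S\oplus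 Q_S)$ is given the direct sum filtration.
   Formalization: The graded algebra of B is shown isomorphic to the opposite of End_G(M): with left modules and the product fg = phi_j(f~) o g, End_G(M) is the opposite of gr B, so the isomorphism as stated fails in general (e.g. for generic quantum exterior algebras in three variables). *)

(* Defs.v *)
From HB Require Import structures.
From mathcomp Require Import all_boot all_algebra all_field.
From mathcomp Require Import boolp.
From mathcomp.multinomials Require Import freeg.

Set Implicit Arguments.
Unset Strict Implicit.
Unset Printing Implicit Defensive.
Import GRing.Theory.
Local Open Scope ring_scope.
Local Open Scope quotient_scope.

Section Submodules.
Context {R : pzRingType}.
Implicit Types V W : lmodType R.

Section MkSub.
Context (V : lmodType R) (P : V -> Prop).
Hypotheses (P0 : P 0) (PL : forall a x y, P x -> P y -> P (a *: x + y)).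

Let Pb : V -> bool := fun x => `[< P x >].

Let Pb_closed : GRing.subsemimod_closed Pb.
Proof.
split; last first.
  move=> a x /asboolP Px; apply/asboolP.
  by rewrite -[a *: x]addr0; apply: PL.
split; first exact/asboolP.
move=> x y /asboolP Px /asboolP Py; apply/asboolP.
by rewrite -[x]scale1r; apply: PL.
Qed.

Definition mksub : submodClosed V :=
  HB.pack Pb (GRing.isSubmodClosed.Build R V Pb Pb_closed).

Lemma mksubP x : x \in mksub <-> P x.
Proof. by split=> [/asboolP|/asboolP]. Qed.
End MkSub.
#[global] Arguments mksub : simpl never.

Lemma sub_rpredB V (U : submodClosed V) x y : x \in U -> y \in U -> x - y \in U.
Proof. by move=> Ux Uy; rewrite rpredD // -scaleN1r rpredZ. Qed.

Definition subm V (U : submodClosed V) := {x : V | x \in U}.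
HB.instance Definition _ V (U : submodClosed V) := SubChoice.on (subm U).
HB.instance Definition _ V (U : submodClosed V) :=
  [SubChoice_isSubLmodule of subm U by <:].

Definition fullsub V : submodClosed V := @mksub V (fun _ => True) I (fun _ _ _ _ _ => I).

Lemma zerosub_closed V (a : R) (x y : V) : x = 0 -> y = 0 -> a *: x + y = 0.
Proof. by move=> -> ->; rewrite scaler0 addr0. Qed.
Definition zerosub V : submodClosed V := mksub erefl (@zerosub_closed V).
 

Section Maps.
Context (V W : lmodType R) (f : {linear V -> W}).

Lemma presub_closed (U : submodClosed W) (a : R) x y :
  f x \in U -> f y \in U -> f (a *: x + y) \in U.
Proof. by move=> Ux Uy; rewrite linearP rpredD // rpredZ. Qed.
Lemma presub0 (U : submodClosed W) : f 0 \in U.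
Proof. by rewrite linear0 rpred0. Qed.
Definition presub (U : submodClosed W) : submodClosed V :=
  mksub (presub0 U) (@presub_closed U).

Definition kersub : submodClosed V := presub (zerosub W).

Lemma imsub0 (U : submodClosed V) : exists2 z, z \in U & 0 = f z.
Proof. by exists 0; rewrite ?rpred0 ?linear0. Qed.
Lemma imsub_closed (U : submodClosed V) (a : R) x y :
  (exists2 z, z \in U & x = f z) -> (exists2 z, z \in U & y = f z) ->
  exists2 z, z \in U & a *: x + y = f z.
Proof.
move=> [z Uz ->] [t Ut ->]; exists (a *: z + t); last by rewrite linearP.
by rewrite rpredD // rpredZ.
Qed.
Definition imsub (U : submodClosed V) : submodClosed W :=
  mksub (imsub0 U) (@imsub_closed U).
End Maps.

Section Sum.
Context (V : lmodType R) (U W : submodClosed V).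
Lemma addsub0 : exists u, exists2 w, u \in U /\ w \in W & 0 = u + w.
Proof. by exists 0, 0; rewrite ?rpred0 ?addr0. Qed.
Lemma addsub_closed (a : R) x y :
  (exists u, exists2 w, u \in U /\ w \in W & x = u + w) ->
  (exists u, exists2 w, u \in U /\ w \in W & y = u + w) ->
  exists u, exists2 w, u \in U /\ w \in W & a *: x + y = u + w.
Proof.
move=> [u [w [Uu Ww] ->]] [u' [w' [Uu' Ww'] ->]].
exists (a *: u + u'), (a *: w + w'); first by split; rewrite rpredD // rpredZ.
by rewrite scalerDr addrACA.
Qed.
Definition addsub : submodClosed V := mksub addsub0 addsub_closed.
End Sum.

Section Cap.
Context (V : lmodType R) (U W : submodClosed V).
Lemma capsub0 : 0 \in U /\ 0 \in W.
Proof. by rewrite !rpred0. Qed.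
Lemma capsub_closed (a : R) x y :
  x \in U /\ x \in W -> y \in U /\ y \in W ->
  a *: x + y \in U /\ a *: x + y \in W.
Proof. by move=> [Ux Wx] [Uy Wy]; rewrite !rpredD ?rpredZ. Qed.
Definition capsub : submodClosed V := mksub capsub0 capsub_closed.
End Cap.

Section Span.
Context (V : lmodType R) (E : V -> Prop).
Let inspan x := forall U : submodClosed V, (forall e, E e -> e \in U) -> x \in U.
Lemma spansub0 : inspan 0.
Proof. by move=> U _; rewrite rpred0. Qed.
Lemma spansub_closed (a : R) x y : inspan x -> inspan y -> inspan (a *: x + y).
Proof. by move=> Ux Uy U EU; rewrite rpredD ?rpredZ ?Ux ?Uy. Qed.
Definition spansub : submodClosed V := mksub spansub0 spansub_closed.
End Span.

Section Quotient.
Context (V : lmodType R) (U : submodClosed V).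

Definition quo_rel : rel V := fun x y => x - y \in U.
Lemma quo_rel_equiv : equiv_class_of quo_rel.
Proof.
rewrite /quo_rel; split=> [x|x y|y x z Uxy Uyz]; first by rewrite subrr rpred0.
  have H a b : a - b \in U -> b - a \in U.
    by move=> Uab; rewrite -opprB -scaleN1r rpredZ.
  by apply/idP/idP; apply: H.
by rewrite -(subrK y x) -addrA rpredD.
Qed.
Canonical quo_equiv := EquivRelPack quo_rel_equiv.
Canonical quo_encModRel := defaultEncModRel quo_rel.

Definition quom := {eq_quot quo_rel}.
HB.instance Definition _ := Choice.on quom.
HB.instance Definition _ := EqQuotient.on quom.

Definition cls (x : V) : quom := \pi x.

Lemma clsP x y : cls x = cls y <-> x - y \in U.
Proof. by split=> [/eqP|]; rewrite /cls ?piE // => h; apply/eqP; rewrite piE. Qed.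

Lemma clsK (q : quom) : cls (repr q) = q.
Proof. exact: reprK. Qed.

Lemma repr_cls x : repr (cls x) - x \in U.
Proof. by apply/clsP; rewrite clsK. Qed.

Let q0 : quom := cls 0.
Let qopp (q : quom) : quom := cls (- repr q).
Let qadd (q r : quom) : quom := cls (repr q + repr r).
Let qscale (a : R) (q : quom) : quom := cls (a *: repr q).

Let qoppE x : qopp (cls x) = cls (- x).
Proof. by apply/clsP; rewrite -opprD -[- (_ - _)]scaleN1r rpredZ // repr_cls. Qed.
Let qaddE x y : qadd (cls x) (cls y) = cls (x + y).
Proof. by apply/clsP; rewrite opprD addrACA rpredD // repr_cls. Qed.
Let qscaleE a x : qscale a (cls x) = cls (a *: x).
Proof. by apply/clsP; rewrite -scalerBr rpredZ // repr_cls. Qed.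

Let qaddA : associative qadd.
Proof.
move=> x y z; rewrite -[x]clsK -[y]clsK -[z]clsK.
by rewrite ?(qaddE, qoppE) addrA.
Qed.
Let qaddC : commutative qadd.
Proof. by move=> x y; rewrite -[x]clsK -[y]clsK !qaddE addrC. Qed.
Let qadd0 : left_id q0 qadd.
Proof. by move=> x; rewrite -[x]clsK !qaddE add0r. Qed.
Let qaddN : left_inverse q0 qopp qadd.
Proof. by move=> x; rewrite -[x]clsK qoppE qaddE addNr. Qed.
HB.instance Definition _ := GRing.isZmodule.Build quom qaddA qaddC qadd0 qaddN.

Let qscaleA a b q : qscale a (qscale b q) = qscale (a * b) q.
Proof. by rewrite -[q]clsK !qscaleE scalerA. Qed.
Let qscale1 : left_id 1 qscale.
Proof. by move=> q; rewrite -[q]clsK !qscaleE scale1r. Qed.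
Let qscaleDr : right_distributive qscale +%R.
Proof.
move=> a x y; rewrite -[x]clsK -[y]clsK.
by rewrite [X in qscale _ X]qaddE !qscaleE [RHS]qaddE scalerDr.
Qed.
Let qscaleDl q : {morph qscale^~ q : a b / a + b}.
Proof.
by move=> a b; rewrite -[q]clsK !qscaleE [RHS]qaddE scalerDl.
Qed.
HB.instance Definition _ := GRing.Zmodule_isLmodule.Build R quom
  qscaleA qscale1 qscaleDr qscaleDl.

Lemma cls_is_linear : linear cls.
Proof.
by move=> a x y; rewrite -[a *: cls x]/(qscale _ _) qscaleE
  -[cls (a *: x) + _]/(qadd _ _) qaddE.
Qed.
HB.instance Definition _ := GRing.isLinear.Build R V quom _ cls cls_is_linear.

Section Lift.
Context (W : lmodType R) (f : {linear V -> W}).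
Hypothesis f0 : forall x, x \in U -> f x = 0.

Let lift (q : quom) : W := f (repr q).
Let lift_cls x : lift (cls x) = f x.
Proof. by apply/eqP; rewrite -subr_eq0 -linearB f0 // repr_cls. Qed.
Let lift_linear : linear lift.
Proof.
by move=> a x y; rewrite -[x]clsK -[y]clsK -linearP !lift_cls linearP.
Qed.

Definition quolift : {linear quom -> W} :=
  HB.pack lift (GRing.isLinear.Build R quom W _ lift lift_linear).

Lemma quoliftE x : quolift (cls x) = f x.
Proof. exact: lift_cls. Qed.
End Lift.
End Quotient.

Section Subquotient.

(* U / (U :&: U'); only used for U' contained in U. *)
Definition subquo (V : lmodType R) (U U' : submodClosed V) : lmodType R :=
  quom (presub (\val : {linear subm U -> V}) U').

Section Induced.
Context (V W : lmodType R) (f : {linear V -> W}).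
Context (U U' : submodClosed V) (T T' : submodClosed W).
Hypothesis fU : forall x, x \in U -> f x \in T.
Hypothesis fU' : forall x, x \in U' -> f x \in T'.

Let g (x : subm U) : subm T := exist _ (f (val x)) (fU (valP x)).
Let g_linear : linear g.
Proof. by move=> a x y; apply: val_inj; rewrite /= linearP. Qed.

Definition subm_map : {linear subm U -> subm T} :=
  HB.pack g (GRing.isLinear.Build R _ _ _ g g_linear).

Let h : {linear subm U -> subquo T T'} := @cls _ _ \o subm_map.
Let h0 x : x \in presub (\val : {linear subm U -> V}) U' -> h x = 0.
Proof.
move=> /mksubP U'x; rewrite /h /= -[RHS](linear0 (@cls _ _)); apply/clsP.
by rewrite subr0; apply/mksubP; apply: fU'.
Qed.

Definition subquo_map : {linear subquo U U' -> subquo T T'} := quolift h0.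
End Induced.
End Subquotient.
End Submodules.

Section Radical.
Context {R : pzRingType}.

Definition subsub (V : lmodType R) (U W : submodClosed V) :=
  forall x, x \in U -> x \in W.

Definition maximal_in (V : lmodType R) (U W : submodClosed V) :=
  [/\ subsub W U, ~ subsub U W &
   forall T : submodClosed V, subsub W T -> subsub T U ->
     subsub T W \/ subsub U T].

Section Rad.
Context (V : lmodType R) (U : submodClosed V).
Let inrad x := x \in U /\ forall W, maximal_in U W -> x \in W.
Lemma radsub0 : inrad 0.
Proof. by split=> [|W _]; rewrite rpred0. Qed.
Lemma radsub_closed (a : R) x y : inrad x -> inrad y -> inrad (a *: x + y).
Proof.
move=> [Ux Wx] [Uy Wy]; split=> [|W maxW]; first by rewrite rpredD ?rpredZ.
by rewrite rpredD ?rpredZ ?Wx ?Wy.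
Qed.
Definition radsub : submodClosed V := mksub radsub0 radsub_closed.
End Rad.

Lemma radsub_hom (V W : lmodType R) (f : {linear V -> W})
    (U : submodClosed V) (T : submodClosed W) :
  (forall x, x \in U -> f x \in T) ->
  forall x, x \in radsub U -> f x \in radsub T.
Proof.
move=> fU x /mksubP[Ux radx]; apply/mksubP; split=> [|M [MT nTM maxM]].
  exact: fU.
apply: contrapT => nMfx.
have capP z : z \in capsub U (presub f M) <-> z \in U /\ f z \in M.
  by split=> [/mksubP[? /mksubP]|[? ?]] //; apply/mksubP; split=> //; apply/mksubP.
have /capP[] // : x \in capsub U (presub f M).
apply: radx; split=> [z /capP[]//|UM|N MN NU].
  have /capP[_ Mfx] := UM _ Ux. by apply: nMfx.
have MfN z : z \in M -> z \in addsub M (imsub f N).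
  move=> Mz; apply/mksubP; exists z, 0; last by rewrite addr0.
  by rewrite Mz rpred0.
have fNM z : z \in N -> f z \in addsub M (imsub f N).
  move=> Nz; apply/mksubP; exists 0, (f z); last by rewrite add0r.
  by rewrite rpred0; split=> //; apply/mksubP; exists z.
case: (maxM (addsub M (imsub f N))) => //.
- move=> z /mksubP[m [_ [Mm /mksubP[n Nn ->]] ->]].
  by rewrite rpredD //; [apply: MT | apply/fU/NU].
- by move=> fNsub; left=> z Nz; apply/capP; split; [apply: NU|apply/fNsub/fNM].
- move=> TfN; right=> u Uu.
  have /mksubP[m [_ [Mm /mksubP[n Nn ->]] fuE]] := TfN _ (fU _ Uu).
  rewrite -(subrK n u) rpredD // MN //; apply/capP; split.
    by rewrite sub_rpredB // NU.
  by rewrite linearB fuE addrK.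
Qed.

Definition radn (V : lmodType R) (i : nat) : submodClosed V :=
  iter i (@radsub V) (fullsub V).

Lemma radn_hom (V W : lmodType R) (f : {linear V -> W}) i j :
  (forall x, f x \in radn W i) ->
  forall x, x \in radn V j -> f x \in radn W (j + i).
Proof.
move=> fi; rewrite /radn iterD; elim: j => [|j IHj] x /=; first by [].
exact: radsub_hom.
Qed.

End Radical.

Section Modules.
Context {k : fieldType} {A : falgType k}.
Implicit Types V W : lmodType A.

Definition fingen V := exists s : seq V, forall x : V,
  exists2 r : seq (A * V), {subset [seq t.2 | t <- r] <= s} &
    x = \sum_(t <- r) t.1 *: t.2.

Definition simple V :=
  (exists x : V, x != 0) /\
  forall U : submodClosed V, subsub U (zerosub V) \/ subsub (fullsub V) U.

Definition isomodule V W := exists f : {linear V -> W}, bijective f.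

(* V is the direct sum of the W i, along the injections inj i. *)
Definition is_dsum (J : finType) V (W : J -> lmodType A)
    (inj : forall j, {linear W j -> V}) :=
  exists pr : forall j, {linear V -> W j},
    [/\ forall j x, pr j (inj j x) = x,
        forall i j x, i != j -> pr j (inj i x) = 0 &
        forall x, x = \sum_j inj j (pr j x)].

Definition ses (L M N : lmodType A) (u : {linear L -> M}) (v : {linear M -> N}) :=
  [/\ injective u, (forall z, exists y, v y = z) &
      forall y, v y = 0 <-> exists x, y = u x].
End Modules.

Record fgmod (k : fieldType) (A : falgType k) := FgMod {
  fgmod_sort :> lmodType A;
  fgmodP : fingen fgmod_sort
}.

Section FgModules.
Context {k : fieldType} {A : falgType k}.

Definition projective (P : lmodType A) :=
  forall (M N : fgmod A) (p : {linear M -> N}) (f : {linear P -> N}),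
    (forall y, exists x, p x = y) ->
    exists g : {linear P -> M}, forall x, p (g x) = f x.

Definition injmodule (Q : lmodType A) :=
  forall (M N : fgmod A) (u : {linear M -> N}) (f : {linear M -> Q}),
    injective u ->
    exists g : {linear N -> Q}, forall x, g (u x) = f x.

Lemma fingen_prod (M N : fgmod A) : fingen (M * N : lmodType A)%type.
Proof.
case: (fgmodP M) (fgmodP N) => [s genM] [t genN].
exists ([seq (x, 0) | x <- s] ++ [seq (0, y) | y <- t]) => -[x y].
have [r rs ->] := genM x; have [r' rt ->] := genN y.
exists ([seq (a.1, (a.2, 0)) | a <- r] ++ [seq (a.1, (0, a.2)) | a <- r']).
  move=> z; rewrite map_cat !mem_cat -!map_comp /comp /=.
  case/orP=> /mapP[a ar ->]; apply/orP; [left|right]; apply: map_f.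
    by apply: rs; apply: map_f.
  by apply: rt; apply: map_f.
rewrite big_cat !big_map /=.
rewrite [X in (X, _)](_ : _ = \sum_(i <- r) i.1 *: i.2) //.
have suml (q : seq (A * M)) :
    \sum_(i <- q) i.1 *: ((i.2, 0) : M * N) = (\sum_(i <- q) i.1 *: i.2, 0).
  elim: q => [|a q IHq]; rewrite ?big_nil // !big_cons IHq.
  by apply/pair_equal_spec; rewrite /= scaler0 addr0.
have sumr (q : seq (A * N)) :
    \sum_(i <- q) i.1 *: ((0, i.2) : M * N) = (0, \sum_(i <- q) i.1 *: i.2).
  elim: q => [|a q IHq]; rewrite ?big_nil // !big_cons IHq.
  by apply/pair_equal_spec; rewrite /= scaler0 addr0.
by rewrite suml sumr; apply/pair_equal_spec; rewrite /= addr0 add0r.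
Qed.

Definition prodfg (M N : fgmod A) : fgmod A := FgMod (@fingen_prod M N).

Lemma projective_prod (M N : fgmod A) :
  projective M -> projective N -> projective (prodfg M N).
Proof.
move=> projM projN X Y p f surjp.
pose i1 (x : M) : prodfg M N := (x, 0).
pose i2 (x : N) : prodfg M N := (0, x).
have i1L : linear i1.
  by move=> a x y; apply/pair_equal_spec; rewrite /= scaler0 addr0.
have i2L : linear i2.
  by move=> a x y; apply/pair_equal_spec; rewrite /= scaler0 addr0.
pose j1 : {linear M -> prodfg M N} := HB.pack i1 (GRing.isLinear.Build A _ _ _ i1 i1L).
pose j2 : {linear N -> prodfg M N} := HB.pack i2 (GRing.isLinear.Build A _ _ _ i2 i2L).
have [g gP] := projM _ _ p (f \o j1) surjp.
have [h hP] := projN _ _ p (f \o j2) surjp.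
exists ((g \o fst) \+ (h \o snd)) => -[x y] /=.
rewrite linearD gP hP /= -linearD; congr (f _).
by apply/pair_equal_spec; rewrite /= addr0 add0r.
Qed.


End FgModules.

Definition resc (k : fieldType) (A : falgType k) (N : lmodType A) : Type := N.

Section RestrictScalars.
Context {k : fieldType} {A : falgType k} (N : lmodType A).
HB.instance Definition _ := GRing.Zmodule.on (resc N).
Definition kscale (c : k) (x : resc N) : resc N := (c%:A : A) *: (x : N).
Lemma kscaleA a b x : kscale a (kscale b x) = kscale (a * b) x.
Proof. by rewrite /kscale scalerA -scalerAl mul1r scalerA. Qed.
Lemma kscale1 : left_id 1 kscale.
Proof. by move=> x; rewrite /kscale !scale1r. Qed.
Lemma kscaleDr : right_distributive kscale +%R.
Proof. by move=> a x y; rewrite /kscale scalerDr. Qed.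
Lemma kscaleDl x : {morph kscale^~ x : a b / a + b}.
Proof. by move=> a b; rewrite /kscale !scalerDl. Qed.
HB.instance Definition _ := GRing.Zmodule_isLmodule.Build k (resc N)
  kscaleA kscale1 kscaleDr kscaleDl.
End RestrictScalars.

Definition hom (k : fieldType) (A : falgType k) (M N : lmodType A) : Type :=
  {linear M -> N}.

Section Hom.
Context {k : fieldType} {A : falgType k} (M N : lmodType A).
HB.instance Definition _ := gen_eqMixin (hom M N).
HB.instance Definition _ := gen_choiceMixin (hom M N).

Lemma homP (f g : hom M N) : (f : M -> N) =1 g <-> f = g.
Proof.
split=> [|->//] /funext fg.
case: f g fg => [f cf] [g cg] /= fg; move: fg cf cg => -> cf cg.
congr GRing.Linear.Pack.
case: cf cg => [[a] [b]] [[c] [d]].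
by rewrite (Prop_irrelevance a c) (Prop_irrelevance b d).
Qed.

Definition hom0 : hom M N := \0.
Definition homN (f : hom M N) : hom M N := \- f.
Definition homD (f g : hom M N) : hom M N := f \+ g.
Definition homZ_fun (c : k) (f : hom M N) (x : M) : N := (c%:A : A) *: f x.
Lemma homZ_linear c f : linear (homZ_fun c f).
Proof.
move=> a x y; rewrite /homZ_fun linearP scalerDr !scalerA.
by rewrite -scalerAl mul1r -scalerAr mulr1.
Qed.
Definition homZ c f : hom M N :=
  HB.pack (homZ_fun c f) (GRing.isLinear.Build A M N _ _ (homZ_linear c f)).
Lemma homDA : associative homD.
Proof. by move=> f g h; apply/homP=> x /=; rewrite addrA. Qed.
Lemma homDC : commutative homD.
Proof. by move=> f g; apply/homP=> x /=; rewrite addrC. Qed.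
Lemma hom0D : left_id hom0 homD.
Proof. by move=> f; apply/homP=> x /=; rewrite add0r. Qed.
Lemma homND : left_inverse hom0 homN homD.
Proof. by move=> f; apply/homP=> x /=; rewrite addNr. Qed.
HB.instance Definition _ := GRing.isZmodule.Build (hom M N) homDA homDC hom0D homND.
Lemma homZA a b f : homZ a (homZ b f) = homZ (a * b) f.
Proof. by apply/homP=> x /=; rewrite /homZ_fun scalerA -scalerAl mul1r scalerA. Qed.
Lemma hom1Z : left_id 1 homZ.
Proof. by move=> f; apply/homP=> x /=; rewrite /homZ_fun !scale1r. Qed.
Lemma homZDr : right_distributive homZ +%R.
Proof. by move=> a f g; apply/homP=> x /=; rewrite /homZ_fun scalerDr. Qed.
Lemma homZDl f : {morph homZ^~ f : a b / a + b}.
Proof. by move=> a b; apply/homP=> x /=; rewrite /homZ_fun !scalerDl. Qed.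
HB.instance Definition _ := GRing.Zmodule_isLmodule.Build k (hom M N)
  homZA hom1Z homZDr homZDl.
End Hom.

Record cat := Cat {
  ob :> Type;
  mor : ob -> ob -> Type;
  idm : forall M, mor M M;
  compm : forall L M N, mor M N -> mor L M -> mor L N;
  comp1m : forall M N (f : mor M N), compm (idm N) f = f;
  compm1 : forall M N (f : mor M N), compm f (idm M) = f;
  compmA : forall K L M N (f : mor M N) (g : mor L M) (h : mor K L),
    compm f (compm g h) = compm (compm f g) h
}.
Arguments mor {c} _ _.
Arguments idm {c} _.
Arguments compm {c L M N} _ _.

Record functor (C D : cat) := Functor {
  fob :> C -> D;
  fmor : forall M N, mor M N -> mor (fob M) (fob N);
  fmor1 : forall M, fmor (idm M) = idm (fob M);
  fmorM : forall L M N (f : mor M N) (g : mor L M),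
    fmor (compm f g) = compm (fmor f) (fmor g)
}.
Arguments fmor {C D} _ {M N} _.

Definition inverse_mor (C : cat) (M N : C) (f : mor M N) (g : mor N M) :=
  compm f g = idm N /\ compm g f = idm M.

Definition is_iso (C : cat) (M N : C) (f : mor M N) :=
  exists g, inverse_mor f g.

Definition idfunctor (C : cat) : functor C C :=
  @Functor C C id (fun _ _ f => f) (fun _ => erefl) (fun _ _ _ _ _ => erefl).

Section CompFunctor.
Context (C D E : cat) (G : functor D E) (F : functor C D).
Lemma compF1 M : fmor G (fmor F (idm M)) = idm (G (F M)).
Proof. by rewrite !fmor1. Qed.
Lemma compFM L M N (f : mor M N) (g : mor L M) :
  fmor G (fmor F (compm f g)) = compm (fmor G (fmor F f)) (fmor G (fmor F g)).
Proof. by rewrite !fmorM. Qed.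
Definition compfunctor : functor C E := Functor compF1 compFM.
End CompFunctor.

Definition natural_iso (C D : cat) (F G : functor C D)
    (eta : forall M, mor (F M) (G M)) :=
  (forall M, is_iso (eta M)) /\
  forall M N (f : mor M N), compm (eta N) (fmor F f) = compm (fmor G f) (eta M).

Definition isofunctors (C D : cat) (F G : functor C D) :=
  exists eta, @natural_iso C D F G eta.

Definition is_equivalence (C D : cat) (F : functor C D) :=
  exists G : functor D C,
    isofunctors (compfunctor G F) (idfunctor C) /\
    isofunctors (compfunctor F G) (idfunctor D).

Section StableHom.
Context {k : fieldType} {A : falgType k}.
Implicit Types L M N : lmodType A.

Definition idhom M : hom M M := idfun.
Definition comphom L M N (f : hom M N) (g : hom L M) : hom L N := f \o g.

Definition factors_proj M N (f : hom M N) :=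
  exists P : fgmod A, projective P /\
  exists (u : hom M P) (v : hom P N), f = comphom v u.

Lemma zero_projective M : exists P : fgmod A, projective P /\ forall x : P, x = 0.
Proof.
have zfg : fingen (subm (zerosub (A^o : lmodType A))).
  exists [::] => x; exists [::] => //; rewrite big_nil; apply: val_inj => /=.
  by have /mksubP := valP x.
exists (FgMod zfg); split=> [X Y p f surjp|x].
  exists \0 => x; rewrite (_ : x = 0) ?linear0 //; apply: val_inj.
  by have /mksubP := valP x.
by apply: val_inj; have /mksubP := valP x.
Qed.

Lemma factors_proj0 M N : factors_proj (0 : hom M N).
Proof.
have [P [projP _]] := zero_projective M.
exists P; split=> //; exists 0, 0; exact/homP.
Qed.

Lemma factors_proj_closed M N (c : k) (f g : hom M N) :
  factors_proj f -> factors_proj g -> factors_proj (c *: f + g).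
Proof.
move=> [P [projP [u [v ->]]]] [Q [projQ [s [t ->]]]].
exists (prodfg P Q); split; first exact: projective_prod.
pose h x := ((u x, s x) : prodfg P Q).
have hL : linear h.
  by move=> a x y; rewrite /h !linearP.
pose hl : hom M (prodfg P Q) := HB.pack h (GRing.isLinear.Build A _ _ _ h hL).
pose l : hom (prodfg P Q) N := ((c *: v : hom _ _) \o fst) \+ (t \o snd).
by exists hl, l; apply/homP.
Qed.

Definition projmaps M N : submodClosed (hom M N) :=
  mksub (@factors_proj0 M N) (@factors_proj_closed M N).

Lemma factors_proj_compl L M N (f : hom M N) (g : hom L M) :
  factors_proj f -> factors_proj (comphom f g).
Proof.
by move=> [P [projP [u [v ->]]]]; exists P; split=> //; exists (comphom u g), v; apply/homP.
Qed.
Lemma factors_proj_compr L M N (f : hom M N) (g : hom L M) :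
  factors_proj g -> factors_proj (comphom f g).
Proof.
by move=> [P [projP [u [v ->]]]]; exists P; split=> //; exists u, (comphom f v); apply/homP.
Qed.

Definition shom M N : lmodType k := quom (projmaps M N).
Definition scls M N (f : hom M N) : shom M N := cls (projmaps M N) f.

Definition scomp L M N (f : shom M N) (g : shom L M) : shom L N :=
  scls (comphom (repr f) (repr g)).

Lemma comphomBl L M N (f f' : hom M N) (g : hom L M) :
  comphom (f - f') g = comphom f g - comphom f' g.
Proof. exact/homP. Qed.
Lemma comphomBr L M N (f : hom M N) (g g' : hom L M) :
  comphom f (g - g') = comphom f g - comphom f g'.
Proof. by apply/homP=> x /=; rewrite linearB. Qed.

Lemma scompE L M N (f : hom M N) (g : hom L M) :
  scomp (scls f) (scls g) = scls (comphom f g).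
Proof.
apply/clsP; set f' := repr _; set g' := repr _.
rewrite -(subrK (comphom f' g) (comphom f' g')) -addrA rpredD //.
  rewrite -comphomBr; apply/mksubP; apply: factors_proj_compr.
  exact: (proj1 (mksubP _ _ _) (repr_cls (projmaps L M) g)).
rewrite -comphomBl; apply/mksubP; apply: factors_proj_compl.
exact: (proj1 (mksubP _ _ _) (repr_cls (projmaps M N) f)).
Qed.

Lemma sclsK M N (f : shom M N) : scls (repr f) = f.
Proof. exact: clsK. Qed.
End StableHom.

Section StableCategory.
Context {k : fieldType} (A : falgType k).
Lemma scomp1m (M N : fgmod A) (f : shom M N) : scomp (scls (idhom N)) f = f.
Proof. by rewrite -[f]sclsK scompE; congr scls; apply/homP. Qed.
Lemma scompm1 (M N : fgmod A) (f : shom M N) : scomp f (scls (idhom M)) = f.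
Proof. by rewrite -[f]sclsK scompE; congr scls; apply/homP. Qed.
Lemma scompA (K L M N : fgmod A) (f : shom M N) (g : shom L M) (h : shom K L) :
  scomp f (scomp g h) = scomp (scomp f g) h.
Proof. by rewrite -[f]sclsK -[g]sclsK -[h]sclsK !scompE; congr scls; apply/homP. Qed.

Definition stab : cat :=
  @Cat (fgmod A) (fun M N => shom M N) (fun M => scls (idhom M))
    (fun L M N f g => scomp f g) scomp1m scompm1 scompA.

(* A choice of suspensions: short exact sequences 0 -> M -> I -> Sigma M -> 0
   with I injective. The triangulated structure does not depend on it. *)
Record suspension := Suspension {
  susI : fgmod A -> fgmod A;
  susp : fgmod A -> fgmod A;
  susi : forall M : fgmod A, {linear M -> susI M};
  susq : forall M : fgmod A, {linear susI M -> susp M};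
  susI_inj : forall M : fgmod A, injmodule (susI M);
  sus_ses : forall M : fgmod A, ses (susi M) (susq M)
}.

Context (c : suspension).

(* sigma is the image of phi under the suspension functor. *)
Definition suspension_mor (M N : stab) (phi : mor M N)
    (sigma : mor (susp c M : stab) (susp c N)) :=
  exists (f : hom M N) (e : hom (susI c M) (susI c N))
         (s : hom (susp c M) (susp c N)),
    [/\ phi = scls f, sigma = scls s,
        forall x, e (susi c M x) = susi c N (f x) &
        forall x, s (susq c M x) = susq c N (e x)].

(* The triangles isomorphic to the triangle L -> M -> N -> Sigma L of some
   short exact sequence. *)
Definition distinguished (X Y Z : stab) (u : mor X Y) (v : mor Y Z)
    (w : mor Z (susp c X)) :=
  exists (L M N : fgmod A) (f : {linear L -> M}) (g : {linear M -> N})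
         (e : {linear M -> susI c L}) (h : {linear N -> susp c L}),
    [/\ ses f g, forall x, e (f x) = susi c L x, forall y, h (g y) = susq c L (e y) &
    exists (alpha : mor (L : stab) X) (beta : mor (M : stab) Y)
      (gamma : mor (N : stab) Z) (sigma : mor (susp c L : stab) (susp c X)),
      [/\ [/\ is_iso alpha, is_iso beta, is_iso gamma & suspension_mor alpha sigma],
          compm u alpha = compm beta (scls f : mor (L : stab) M),
          compm v beta = compm gamma (scls g : mor (M : stab) N) &
          compm w gamma = compm sigma (scls h : mor (N : stab) (susp c L))]].
End StableCategory.

Definition is_triangulated (k : fieldType) (A B : falgType k)
    (cB : suspension B) (cA : suspension A) (F : functor (stab B) (stab A))
    (eta : forall M : stab B, mor (F (susp cB M)) (susp cA (F M) : stab A)) :=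
  [/\ forall M, is_iso (eta M),
      forall (M N : stab B) (phi : mor M N) sigma sigma',
        suspension_mor (c := cB) phi sigma ->
        suspension_mor (c := cA) (fmor F phi) sigma' ->
        compm (eta N) (fmor F sigma) = compm sigma' (eta M) &
      forall (X Y Z : stab B) (u : mor X Y) (v : mor Y Z) (w : mor Z (susp cB X)),
        distinguished u v w ->
        distinguished (fmor F u) (fmor F v) (compm (eta X) (fmor F w))].

Definition is_triangulated_equivalence (k : fieldType) (A B : falgType k)
    (F : functor (stab B) (stab A)) :=
  is_equivalence F /\
  exists (cB : suspension B) (cA : suspension A) eta, is_triangulated (cB := cB) (cA := cA) (F := F) eta.

(* The field k is required to act in the same way on both sides. *)
Record bimod (k : fieldType) (A B : falgType k) := Bimod {
  bimod_sort :> lmodType A;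
  ract : bimod_sort -> B -> bimod_sort;
  ractDl : forall x y b, ract (x + y) b = ract x b + ract y b;
  ractDr : forall x b c, ract x (b + c) = ract x b + ract x c;
  ractA : forall x b c, ract (ract x b) c = ract x (b * c);
  ract1 : forall x, ract x 1 = x;
  ractZ : forall (a : A) x b, ract (a *: x) b = a *: ract x b;
  ract_central : forall (c : k) x, ract x c%:A = (c%:A : A) *: x;
  bimod_fingen : exists s : seq bimod_sort, forall x,
    exists2 r : seq (A * B * bimod_sort), {subset [seq t.2 | t <- r] <= s} &
      x = \sum_(t <- r) t.1.1 *: ract t.2 t.1.2
}.
Arguments ract {k A B _} _ _.

Section Bimodules.
Context {k : fieldType} {A B : falgType k}.
Implicit Types X Y Z : bimod A B.

Definition bimodule_map X Y (f : {linear X -> Y}) :=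
  forall x b, f (ract x b) = ract (f x) b.

Definition biprojective X := forall (Y Z : bimod A B) (p : {linear Y -> Z}) (f : {linear X -> Z}),
  bimodule_map p -> bimodule_map f -> (forall z, exists y, p y = z) ->
  exists2 g : {linear X -> Y}, bimodule_map g & forall x, p (g x) = f x.

(* Direct summands are given by split monomorphisms. *)
Definition no_projective_summand X :=
  forall (Y : bimod A B) (u : {linear Y -> X}) (p : {linear X -> Y}),
    bimodule_map u -> bimodule_map p -> (forall y, p (u y) = y) ->
    biprojective Y -> forall y : Y, y = 0.
End Bimodules.

Section FreeLift.
Context {R : nzRingType} (K : choiceType) (V : lmodType R) (f : K -> V).
Definition fgen (x : K) : {freeg K / R} := << x >>.

Lemma fglift_zmod : zmod_morphism (fglift f).
Proof. exact: lift_is_additive. Qed.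
HB.instance Definition _ :=
  GRing.isZmodMorphism.Build {freeg K / R} V (fglift f) fglift_zmod.
Lemma fglift_scalable : scalable (fglift f).
Proof.
move=> a D; rewrite -[a *: D]/(fgscale a D) /fgscale.
rewrite -[in RHS](freeg_sumE D) !raddf_sum.
by apply: eq_bigr => x _ /=; rewrite !liftU scalerA.
Qed.
HB.instance Definition _ :=
  GRing.isScalable.Build R {freeg K / R} V _ (fglift f) fglift_scalable.
Definition freelift : {linear {freeg K / R} -> V} := fglift f.
Lemma freeliftE x : freelift (fgen x) = f x.
Proof. by rewrite /= liftU scale1r. Qed.

Lemma free_ext (g h : {linear {freeg K / R} -> V}) :
  (forall x, g (fgen x) = h (fgen x)) -> g =1 h.
Proof.
move=> gh D; rewrite -(freeg_sumE D) !linear_sum; apply: eq_bigr => x _.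
suff -> : << coeff x D *g x >> = coeff x D *: fgen x by rewrite !linearZ /= gh.
apply/eqP/freeg_eqP => y; rewrite coeffZ !coeffU mul1r; by [].
Qed.
End FreeLift.

(* X (x)_B M: the A-module presented by generators x (x) m, for (x, m) in
   X * M, and the relations below. *)
Section Tensor.
Context {k : fieldType} {A B : falgType k} (X : bimod A B) (M : lmodType B).

Definition tensor_free : lmodType A := {freeg (X * M)%type / A}.
Let gen (x : X) (m : M) : tensor_free := fgen (x, m).

Definition tensor_rel (t : tensor_free) :=
  [\/ exists x x' m, t = gen (x + x') m - (gen x m + gen x' m),
      exists x m m', t = gen x (m + m') - (gen x m + gen x m'),
      exists x b m, t = gen (ract x b) m - gen x (b *: m) |
      exists a x m, t = gen (a *: x) m - a *: gen x m].

Definition tensor : lmodType A := quom (spansub tensor_rel).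
Definition tens (x : X) (m : M) : tensor := cls _ (gen x m).

Let cls_rel s t : tensor_rel (s - t) ->
  cls (spansub tensor_rel) s = cls (spansub tensor_rel) t.
Proof. by move=> rst; apply/clsP/mksubP => U; apply. Qed.

Lemma tensDl x x' m : tens (x + x') m = tens x m + tens x' m.
Proof.
by rewrite -[RHS](linearD (cls _)); apply: cls_rel; apply: Or41; exists x, x', m.
Qed.
Lemma tensDr x m m' : tens x (m + m') = tens x m + tens x m'.
Proof.
by rewrite -[RHS](linearD (cls _)); apply: cls_rel; apply: Or42; exists x, m, m'.
Qed.
Lemma tensA x b m : tens (ract x b) m = tens x (b *: m).
Proof. by apply: cls_rel; apply: Or43; exists x, b, m. Qed.
Lemma tensZ a x m : tens (a *: x) m = a *: tens x m.
Proof.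
by rewrite -[RHS](linearZ_LR (cls _)); apply: cls_rel; apply: Or44; exists a, x, m.
Qed.

Lemma tensor_ext (V : lmodType A) (f g : {linear tensor -> V}) :
  (forall x m, f (tens x m) = g (tens x m)) -> f =1 g.
Proof.
move=> fg t; rewrite -[t]clsK.
apply: (@free_ext A (X * M)%type V (f \o cls _) (g \o cls _)) => -[x m].
exact: fg.
Qed.

Section Universal.
Context (V : lmodType A) (phi : X -> M -> V).
Hypotheses (phiDl : forall x x' m, phi (x + x') m = phi x m + phi x' m)
  (phiDr : forall x m m', phi x (m + m') = phi x m + phi x m')
  (phiA : forall x b m, phi (ract x b) m = phi x (b *: m))
  (phiZ : forall a x m, phi (a *: x) m = a *: phi x m).

Let F : {linear tensor_free -> V} := freelift (fun xm => phi xm.1 xm.2).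
Let F0 t : t \in spansub tensor_rel -> F t = 0.
Proof.
have kerP x : x \in kersub F <-> F x = 0.
  by split=> [/mksubP/mksubP|Fx0] //; apply/mksubP; rewrite Fx0 rpred0.
move=> /mksubP tF; apply/kerP/tF => e re; apply/kerP; case: re.
- by move=> [x [x' [m ->]]]; rewrite linearB linearD !freeliftE phiDl subrr.
- by move=> [x [m [m' ->]]]; rewrite linearB linearD !freeliftE phiDr subrr.
- by move=> [x [b [m ->]]]; rewrite linearB !freeliftE phiA subrr.
- by move=> [a [x [m ->]]]; rewrite linearB linearZ /= !freeliftE phiZ subrr.
Qed.

Definition tensor_lift : {linear tensor -> V} := quolift F0.
Lemma tensor_liftE x m : tensor_lift (tens x m) = phi x m.
Proof. by rewrite /tensor_lift /tens quoliftE freeliftE. Qed.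
End Universal.
End Tensor.

Section Combinations.
Context {R : pzRingType} (V : lmodType R) (s : seq V).
Let comb x := exists2 r : seq (R * V), {subset [seq t.2 | t <- r] <= s} &
  x = \sum_(t <- r) t.1 *: t.2.
Lemma combsub0 : comb 0.
Proof. by exists [::]; rewrite ?big_nil. Qed.
Lemma combsub_closed a x y : comb x -> comb y -> comb (a *: x + y).
Proof.
move=> [r rs ->] [r' rs' ->]; exists ([seq (a * t.1, t.2) | t <- r] ++ r').
  move=> z; rewrite map_cat mem_cat -map_comp => /orP[/mapP[t tr ->]|]; last exact: rs'.
  by apply: rs; apply: map_f.
rewrite big_cat big_map scaler_sumr; congr (_ + _).
by apply: eq_bigr => t _; rewrite scalerA.
Qed.
Definition combsub : submodClosed V := mksub combsub0 combsub_closed.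
End Combinations.

Section TensorFunctor.
Context {k : fieldType} {A B : falgType k} (X : bimod A B).

Section Map.
Context (M N : lmodType B) (f : {linear M -> N}).
Let phi (x : X) (m : M) := tens x (f m).
Lemma tensor_mapDl x x' m : phi (x + x') m = phi x m + phi x' m.
Proof. exact: tensDl. Qed.
Lemma tensor_mapDr x m m' : phi x (m + m') = phi x m + phi x m'.
Proof. by rewrite /phi linearD tensDr. Qed.
Lemma tensor_mapA x b m : phi (ract x b) m = phi x (b *: m).
Proof. by rewrite /phi linearZ tensA. Qed.
Lemma tensor_mapZ a x m : phi (a *: x) m = a *: phi x m.
Proof. exact: tensZ. Qed.

Definition tensor_map : {linear tensor X M -> tensor X N} :=
  tensor_lift tensor_mapDl tensor_mapDr tensor_mapA tensor_mapZ.

Lemma tensor_mapE x m : tensor_map (tens x m) = tens x (f m).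
Proof. exact: tensor_liftE. Qed.
End Map.

Lemma tensor_map_id (M : lmodType B) : tensor_map (idfun : {linear M -> M}) =1 id.
Proof.
apply: (tensor_ext (g := idfun)) => x m; exact: tensor_mapE.
Qed.
Lemma tensor_map_comp (L M N : lmodType B) (f : {linear M -> N}) (g : {linear L -> M}) :
  tensor_map (f \o g) =1 tensor_map f \o tensor_map g.
Proof.
apply: (tensor_ext (g := tensor_map f \o tensor_map g)) => x m.
by rewrite tensor_mapE -[RHS]/(tensor_map f (tensor_map g _)) !tensor_mapE.
Qed.
Lemma tensor_mapB (M N : lmodType B) (f g : hom M N) :
  tensor_map (f - g : hom M N) =1 (tensor_map f \- tensor_map g).
Proof.
apply: (tensor_ext (g := tensor_map f \- tensor_map g)) => x m.
rewrite tensor_mapE -[RHS]/(tensor_map f _ - tensor_map g _) !tensor_mapE; apply/eqP; rewrite eq_sym subr_eq; apply/eqP.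
by rewrite -tensDr /= subrK.
Qed.

Lemma tens_sumr (M : lmodType B) (I : Type) (r : seq I) (x : X) (F : I -> M) :
  tens x (\sum_(i <- r) F i) = \sum_(i <- r) tens x (F i).
Proof.
apply: big_morph; first exact: tensDr.
by apply: (addrI (tens x 0)); rewrite -tensDr !addr0.
Qed.
Lemma tens_suml (M : lmodType B) (I : Type) (r : seq I) (F : I -> X) (m : M) :
  tens (\sum_(i <- r) F i) m = \sum_(i <- r) tens (F i) m.
Proof.
apply: (big_morph (fun x => tens x m)); first by move=> x y; rewrite tensDl.
by apply: (addrI (tens 0 m)); rewrite -tensDl !addr0.
Qed.
Lemma ract_sumr (I : Type) (r : seq I) (x : X) (F : I -> B) :
  ract x (\sum_(i <- r) F i) = \sum_(i <- r) ract x (F i).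
Proof.
apply: big_morph; first exact: ractDr.
by apply: (addrI (ract x 0)); rewrite -ractDr !addr0.
Qed.

Lemma tensor_fingen (M : fgmod B) : fingen (tensor X M).
Proof.
have [s genX] := bimod_fingen X; have [t genM] := fgmodP M.
pose g := [seq tens xe m | xe <- [seq ract x e | x <- s, e <- vbasis {:B}], m <- t].
exists g => z; suff: z \in combsub g by move/mksubP.
have Ug u : u \in g -> u \in combsub g.
  move=> gu; apply/mksubP; exists [:: (1, u)]; last by rewrite big_seq1 scale1r.
  by move=> v; rewrite inE => /eqP ->.
suff: cls (combsub g) z = cls (combsub g) 0 by move/clsP; rewrite subr0.
rewrite linear0.
apply: (tensor_ext (f := cls (combsub g)) (g := \0)) => x m.
rewrite -[RHS](linear0 (cls _)); apply/clsP; rewrite subr0.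
have [r rs ->] := genX x; have [r' rt ->] := genM m.
rewrite tens_sumr [\sum_(j <- r') _]big_seq rpred_sum // => -[b y] ry.
have ty : y \in t by apply/rt/(map_f snd ry).
rewrite -[(b, y).1]/b -[(b, y).2]/y tens_suml [\sum_(j <- r) _]big_seq rpred_sum // => -[[a c] w] rw.
have sw : w \in s by apply/rs/(map_f snd rw).
rewrite -[(_, _).1.1]/a -[(_, _).2]/w -[(_, _).1.2]/c.
rewrite tensZ rpredZ // -tensA ractA (coord_vbasis (memvf (c * b))).
rewrite ract_sumr tens_suml rpred_sum // => j _.
rewrite -[X in ract w X]mulr1 -scalerAl scalerAr -ractA ract_central tensZ rpredZ //.
apply: Ug; apply: allpairs_f => //; apply: allpairs_f => //.
by rewrite mem_nth // size_tuple.
Qed.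

Definition tensfg (M : fgmod B) : fgmod A := FgMod (tensor_fingen M).
Definition tenshom (M N : lmodType B) (f : hom M N) :
  hom (tensor X M) (tensor X N) := tensor_map f.

Definition preserves_projectives :=
  forall P : fgmod B, projective P -> projective (tensfg P).

Definition tensor_exact :=
  forall (L M N : fgmod B) (u : {linear L -> M}) (v : {linear M -> N}),
    ses u v -> ses (tensor_map u) (tensor_map v).

Section StableFunctor.
Hypothesis pp : preserves_projectives.

Definition tensor_shom (M N : stab B) (f : mor M N) :
    mor (tensfg M : stab A) (tensfg N) :=
  scls (tenshom (repr (f : shom M N))).

Lemma tensor_shomE (M N : fgmod B) (f : hom M N) :
  tensor_shom (scls f : mor (M : stab B) N) = scls (tenshom f).
Proof.
apply/clsP; set f' := repr _.
have -> : tenshom f' - tenshom f = tenshom (f' - f).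
  by apply/homP => x; rewrite [RHS]tensor_mapB.
have /mksubP[P [projP [u [v ->]]]] : f' - f \in projmaps M N by exact: repr_cls.
apply/mksubP; exists (tensfg P); split; first exact: pp.
by exists (tenshom u), (tenshom v); apply/homP; apply: tensor_map_comp.
Qed.

Lemma tensor_shom1 (M : stab B) : tensor_shom (idm M) = idm (tensfg M : stab A).
Proof.
rewrite tensor_shomE; congr scls; apply/homP; exact: tensor_map_id.
Qed.

Lemma tensor_shomM (L M N : stab B) (f : mor M N) (g : mor L M) :
  tensor_shom (compm f g) = compm (tensor_shom f) (tensor_shom g).
Proof.
rewrite -[f]sclsK -[g]sclsK [compm _ _]scompE !tensor_shomE [RHS]scompE.
by congr scls; apply/homP; apply: tensor_map_comp.
Qed.

Definition tensor_stab : functor (stab B) (stab A) :=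
  Functor tensor_shom1 tensor_shomM.
End StableFunctor.

Definition induces_stable_equivalence :=
  tensor_exact /\ exists pp : preserves_projectives,
    is_triangulated_equivalence (tensor_stab pp).
End TensorFunctor.

Section AlgebraConditions.
Context {k : fieldType} (A : falgType k).

Definition self_injective := injmodule (A^o : lmodType A).

Definition split_algebra :=
  forall S : lmodType A, simple S ->
  forall f : {linear S -> S}, exists c : k, forall x, f x = (c%:A : A) *: x.

Definition no_projective_simple :=
  forall S : lmodType A, simple S -> ~ projective S.

Definition simple_representatives (I : Type) (L : I -> fgmod A) :=
  [/\ forall i, simple (L i),
      forall i j, isomodule (L i) (L j) -> i = j &
      forall S : lmodType A, simple S -> exists i, isomodule S (L i)].

Definition indecomposable (V : lmodType A) :=
  (exists x : V, x != 0) /\ forall (W : bool -> lmodType A) (inj : forall b, {linear W b -> V}),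
    is_dsum inj -> exists b, forall x : W b, x = 0.

(* The indecomposable summands of the regular module are pairwise
   non-isomorphic. *)
Definition basic :=
  forall (n : nat) (P : 'I_n -> lmodType A)
    (inj : forall i, {linear P i -> (A^o : lmodType A)}),
    (forall i, indecomposable (P i)) -> is_dsum inj ->
    forall i j, isomodule (P i) (P j) -> i = j.
End AlgebraConditions.

(* Categories whose Hom are nonnegatively graded k-vector spaces, given by
   their homogeneous components: ghom i M N is Hom(M, N)_i. *)
Record gcat (k : fieldType) := GCat {
  gob :> Type;
  ghom : nat -> gob -> gob -> lmodType k;
  gid : forall M, ghom 0 M M;
  gcomp : forall L M N i j, ghom i M N -> ghom j L M -> ghom (j + i) L N
}.
Arguments ghom {k g} _ _ _.
Arguments gid {k g} _.
Arguments gcomp {k g L M N i j} _ _.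

(* For homogeneous maps whose degrees are equal but maybe not convertible. *)
Definition gsame (k : fieldType) (C : gcat k) (M N : C) i j
    (f : ghom i M N) (g : ghom j M N) :=
  existT (fun n => ghom n M N) i f = existT (fun n => ghom n M N) j g.

Definition gcat_axioms (k : fieldType) (C : gcat k) :=
  [/\ forall (L M N : C) i j (f : ghom i M N),
        linear (fun g : ghom j L M => gcomp f g),
      forall (L M N : C) i j (g : ghom j L M),
        linear (fun f : ghom i M N => gcomp f g),
      forall (M N : C) i (f : ghom i M N),
        gsame (gcomp (gid N) f) f /\ gsame (gcomp f (gid M)) f &
      forall (K L M N : C) h i j
        (f : ghom i M N) (g : ghom j L M) (e : ghom h K L),
        gsame (gcomp f (gcomp g e)) (gcomp (gcomp f g) e)].

Record gfunctor (k : fieldType) (C D : gcat k) := GFunctor {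
  gfob :> C -> D;
  gfmor : forall i M N, {linear ghom i M N -> ghom i (gfob M) (gfob N)};
  gfmor1 : forall M, gfmor 0 M M (gid M) = gid (gfob M);
  gfmorM : forall L M N i j (f : ghom i M N) (g : ghom j L M),
    gfmor (j + i) L N (gcomp f g) = gcomp (gfmor i M N f) (gfmor j L M g)
}.
Arguments gfmor {k C D} _ {i M N}.

Section GradedFunctors.
Context {k : fieldType}.

Definition idgfunctor (C : gcat k) : gfunctor C C :=
  @GFunctor k C C id (fun i M N => idfun) (fun _ => erefl)
    (fun _ _ _ _ _ _ _ => erefl).

Section Comp.
Context (C D E : gcat k) (G : gfunctor D E) (F : gfunctor C D).
Let GF i M N : {linear ghom i M N -> ghom i (G (F M)) (G (F N))} :=
  gfmor G \o gfmor F.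
Lemma compgF1 M : GF 0 M M (gid M) = gid (G (F M)).
Proof. by rewrite /GF /= !gfmor1. Qed.
Lemma compgFM L M N i j (f : ghom i M N) (g : ghom j L M) :
  GF (j + i) L N (gcomp f g) = gcomp (GF i M N f) (GF j L M g).
Proof. by rewrite /GF /= !gfmorM. Qed.
Definition compgfunctor : gfunctor C E := GFunctor compgF1 compgFM.
End Comp.

Definition isogfunctors (C D : gcat k) (F G : gfunctor C D) :=
  exists eta : forall M, ghom 0 (F M) (G M),
    (forall M, exists theta : ghom 0 (G M) (F M),
       gcomp (eta M) theta = gid (G M) /\ gcomp theta (eta M) = gid (F M)) /\
    forall M N i (f : ghom i M N),
      gsame (gcomp (eta N) (gfmor F f)) (gcomp (gfmor G f) (eta M)).

(* The axioms are not part of gcat; gequivalent requires them. *)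
Definition gequivalent (C D : gcat k) :=
  [/\ gcat_axioms C, gcat_axioms D &
    exists (F : gfunctor C D) (G : gfunctor D C),
      isogfunctors (compgfunctor G F) (idgfunctor C) /\
      isogfunctors (compgfunctor F G) (idgfunctor D)].
End GradedFunctors.

Section SubquoElements.
Context {R : pzRingType} (V : lmodType R) (U U' : submodClosed V).
Definition sqcls (x : V) (Ux : x \in U) : subquo U U' :=
  cls _ (exist _ x Ux : subm U).
Definition sqrepr (q : subquo U U') : V := val (repr q).
Lemma sqreprP q : sqrepr q \in U.
Proof. exact: valP. Qed.
End SubquoElements.

Section GrMod.
Context {k : fieldType} (B : falgType k).

Section RadHom.
Context (M N : lmodType B) (i : nat).
Lemma radhom0 x : (0 : hom M N) x \in radn N i.
Proof. exact: rpred0. Qed.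
Lemma radhom_closed (c : k) (f g : hom M N) :
  (forall x, f x \in radn N i) -> (forall x, g x \in radn N i) ->
  forall x, (c *: f + g) x \in radn N i.
Proof. by move=> fi gi x; rewrite rpredD // rpredZ. Qed.
Definition radhom : submodClosed (hom M N) := mksub radhom0 radhom_closed.
End RadHom.

Definition grhom i (M N : lmodType B) : lmodType k :=
  subquo (radhom M N i) (radhom M N i.+1).

Lemma radhom_id (M : lmodType B) : idhom M \in radhom M M 0.
Proof.
apply/mksubP => x; exact: (proj2 (mksubP _ _ (x : M)) I).
Qed.

Lemma radhom_comp (L M N : lmodType B) i j (f : hom M N) (g : hom L M) :
  f \in radhom M N i -> g \in radhom L M j -> comphom f g \in radhom L N (j + i).
Proof.
move=> /mksubP fi /mksubP gj; apply/mksubP => x.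
exact: (radn_hom (f := f) fi (gj x)).
Qed.

Definition grcomp (L M N : lmodType B) i j (f : grhom i M N) (g : grhom j L M) :
    grhom (j + i) L N :=
  sqcls _ (radhom_comp (sqreprP f) (sqreprP g)).

Definition grmod : gcat k :=
  @GCat k (fgmod B) (fun i M N => grhom i M N)
    (fun M => sqcls _ (radhom_id M)) (fun L M N i j f g => grcomp f g).
End GrMod.

Record filmod (k : fieldType) (A : falgType k) := FilMod {
  filmod_mod :> fgmod A;
  fil : nat -> submodClosed filmod_mod
}.

Section Filtrations.
Context {k : fieldType} {A : falgType k} (I : Type) (S : I -> fgmod A).

Definition addS (V : lmodType A) :=
  exists (n : nat) (c : 'I_n -> I) (inj : forall j, {linear S (c j) -> V}),
    is_dsum inj.

Definition filtration (V : lmodType A) (F : nat -> submodClosed V) :=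
  [/\ subsub (fullsub V) (F 0), forall i, subsub (F i.+1) (F i),
      exists r, subsub (F r) (zerosub V) &
      forall i, addS (subquo (F i) (F i.+1))].

Definition filtrable (V : lmodType A) := exists F, @filtration V F.

(* F i.+1 is itself filtrable and F i / F i.+1 is in add S, since F is a
   filtration; only minimality has to be required. *)
Definition radical_filtration (V : lmodType A) (F : nat -> submodClosed V) :=
  filtration F /\
  forall i (U : submodClosed V), subsub U (F i) -> filtrable (subm U) ->
    addS (subquo (F i) U) -> subsub U (F i.+1) -> subsub (F i.+1) U.
End Filtrations.

Section FilteredHom.
Context {k : fieldType} {A : falgType k}.
Implicit Types L M N : filmod A.

Definition layer M i : lmodType A := subquo (fil M i) (fil M i.+1).

Section FilHom.
Context (M N : filmod A) (i : nat).

Lemma filhom0 j x : x \in fil M j -> (0 : hom M N) x \in fil N (j + i).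
Proof. by move=> _; apply: rpred0. Qed.
Lemma filhom_closed (c : k) (f g : hom M N) :
  (forall j x, x \in fil M j -> f x \in fil N (j + i)) ->
  (forall j x, x \in fil M j -> g x \in fil N (j + i)) ->
  forall j x, x \in fil M j -> (c *: f + g) x \in fil N (j + i).
Proof. by move=> fP gP j x Mx; rewrite rpredD ?rpredZ ?fP ?gP. Qed.
(* Hom^f(M, N_i), with maps to the submodule N_i seen as maps to N: the term of
   index j of the filtration of N_i is N_(i+j). *)
Definition filhom : submodClosed (hom M N) := mksub filhom0 filhom_closed.

Lemma filhomP (f : subm filhom) j x :
  x \in fil M j -> (val f : hom M N) x \in fil N (j + i).
Proof. by have /mksubP := valP f; apply. Qed.

Definition layer_map j (f : subm filhom) : hom (layer M j) (layer N (j + i)) :=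
  subquo_map (@filhomP f j) (@filhomP f j.+1).

Lemma layer_mapE j f (x : subm (fil M j)) :
  layer_map j f (cls _ x) = cls _ (subm_map (@filhomP f j) x).
Proof. exact: quoliftE. Qed.

(* phi_j : Hom^f(M, N_i) -> Hom_stab(M_j / M_(j+1), N_(i+j) / N_(i+j+1)) *)
Definition phi_fun j (f : subm filhom) : shom (layer M j) (layer N (j + i)) :=
  scls (layer_map j f).

Lemma layer_map_linear j : linear (layer_map j).
Proof.
move=> c f g; apply/homP => q; rewrite -[q]clsK.
rewrite -[RHS]/((c%:A : A) *: layer_map j f _ + layer_map j g _).
rewrite !layer_mapE -[RHS](linearP (cls _)); congr (cls _ _); exact: val_inj.
Qed.

Lemma phi_linear j : linear (phi_fun j).
Proof.
by move=> c f g; rewrite /phi_fun layer_map_linear [LHS](linearP (cls _)).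
Qed.
Definition phi j : {linear subm filhom -> shom (layer M j) (layer N (j + i))} :=
  HB.pack (phi_fun j) (GRing.isLinear.Build k _ _ _ _ (phi_linear j)).

(* Hom_G(M, N)_i *)
Definition homG : lmodType k := subm (imsub (phi 0) (fullsub _)).

Lemma liftG_ex (f : homG) : exists g, val f = phi 0 g.
Proof. by have /mksubP[g _ fg] := valP f; exists g. Qed.
Definition liftG (f : homG) : subm filhom := sval (cid (liftG_ex f)).
Lemma liftGP f : val f = phi 0 (liftG f).
Proof. exact: svalP (cid (liftG_ex f)). Qed.
End FilHom.

Section Composition.
Context (L M N : filmod A) (i j : nat).

Lemma filcomp_subproof (f : subm (filhom M N i)) (g : subm (filhom L M j)) :
  comphom (val f) (val g) \in filhom L N (j + i).
Proof.
apply/mksubP => h x Lx; rewrite addnA.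
exact: (filhomP f (filhomP g Lx)).
Qed.
Definition filcomp (f : subm (filhom M N i)) (g : subm (filhom L M j)) :
  subm (filhom L N (j + i)) :=
  exist (fun h => h \in _) _ (filcomp_subproof f g).

Lemma phi_comp (f : subm (filhom M N i)) (g : subm (filhom L M j)) :
  phi L N (j + i) 0 (filcomp f g) = scomp (phi M N i j f) (phi L M j 0 g).
Proof.
rewrite [RHS]scompE; congr scls; apply/homP => q; rewrite -[q]clsK.
rewrite -[RHS]/(layer_map j f (layer_map 0 g _)) !layer_mapE.
by congr (cls _ _); apply: val_inj.
Qed.

Lemma compG_subproof (f : homG M N i) (g : homG L M j) :
  scomp (phi M N i j (liftG f)) (val g) \in imsub (phi L N (j + i) 0) (fullsub _).
Proof.
apply/mksubP; exists (filcomp (liftG f) (liftG g)); first exact: (proj2 (mksubP _ _ _) I).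
by rewrite phi_comp -liftGP.
Qed.

(* The lift of f is a chosen one. Degrees add up as j + i so that 0 + i, for
   phi_0, is convertible to i. *)
Definition compG (f : homG M N i) (g : homG L M j) : homG L N (j + i) :=
  exist (fun h => h \in _) _ (compG_subproof f g).
End Composition.

Section Identity.
Context (M : filmod A).
Lemma filid_subproof : idhom M \in filhom M M 0.
Proof. by apply/mksubP => j x; rewrite addn0. Qed.
Lemma idG_subproof : scls (idhom (layer M 0)) \in imsub (phi M M 0 0) (fullsub _).
Proof.
apply/mksubP; exists (exist (fun h => h \in _) _ filid_subproof); first exact: (proj2 (mksubP _ _ _) I).
congr scls; apply/homP => q; rewrite -[q]clsK layer_mapE.
by congr (cls _ _); apply: val_inj.
Qed.
Definition idG : homG M M 0 := exist (fun h => h \in _) _ idG_subproof.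
End Identity.
End FilteredHom.

Section CategoryG.
Context {k : fieldType} {A : falgType k} {I : Type} (S : I -> fgmod A).

Record gobj := GObj {
  gobj_fil :> filmod A;
  gobjP : radical_filtration S (fil gobj_fil)
}.

Definition catG : gcat k :=
  @GCat k gobj (fun i M N => homG M N i) (fun M => idG M)
    (fun L M N i j f g => compG f g).
End CategoryG.

Section ObjectM.
Context {k : fieldType} {A : falgType k} {I : finType} (S : I -> fgmod A).

Definition projective_cover (P M : fgmod A) (p : {linear P -> M}) :=
  [/\ projective P, forall y, exists x, p x = y &
      forall U : submodClosed P,
        (forall y, exists2 x, x \in U & p x = y) -> subsub (fullsub P) U].

(* Minimality is with respect to direct summands. *)
Definition minimal_projective (W : lmodType A) (Q : fgmod A) :=
  [/\ projective Q, filtrable S (W * Q : lmodType A)%type &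
    forall Q' Q'' : fgmod A, isomodule Q (Q' * Q'' : lmodType A)%type ->
      filtrable S (W * Q' : lmodType A)%type -> forall x : Q'', x = 0].

(* Omega S = kersub p; the first proper term of the filtration of P * Q is
   Omega S * Q. *)
Definition summandM (M P Q : fgmod A) (p : {linear P -> M})
    (F : nat -> submodClosed (prodfg P Q)) :=
  [/\ projective_cover p, minimal_projective (subm (kersub p)) Q,
      radical_filtration S F &
      forall x : prodfg P Q, x \in F 1 <-> p x.1 = 0].

Definition objectM (N : gobj S) :=
  exists (P Q : I -> fgmod A) (p : forall i, {linear P i -> S i})
    (F : forall i, nat -> submodClosed (prodfg (P i) (Q i)))
    (inj : forall i, {linear prodfg (P i) (Q i) -> N}),
    [/\ forall i, summandM (p i) (F i), is_dsum inj &
      forall j x, x \in fil N j <->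
        exists2 y : forall i, prodfg (P i) (Q i),
          forall i, y i \in F i j & x = \sum_i inj i (y i)].
End ObjectM.

(* Nonnegatively graded k-algebras, given by their homogeneous components. *)
Record galg (k : fieldType) := GAlg {
  gcomponent :> nat -> lmodType k;
  gone : gcomponent 0;
  gmul : forall i j, gcomponent i -> gcomponent j -> gcomponent (i + j)
}.
Arguments gone {k} _.
Arguments gmul {k} _ {i j} _ _.

Definition galg_isomorphic (k : fieldType) (R T : galg k) :=
  exists f : forall i, {linear R i -> T i},
    [/\ forall i, bijective (f i), f 0 (gone R) = gone T &
      forall i j (x : R i) (y : R j), f (i + j) (gmul R x y) = gmul T (f i x) (f j y)].

(* For left modules, b |-> (x |-> x * b) identifies B with the opposite of
   End_B(B): the algebra B is to be compared with the endomorphism algebra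
   whose product is the opposite of composition. *)
Definition gend_op (k : fieldType) (C : gcat k) (M : C) : galg k :=
  @GAlg k (fun i => ghom i M M) (gid M) (fun i j x y => gcomp y x).

Section GrAlg.
Context {k : fieldType} (B : falgType k).
Local Notation regB := (B^o : lmodType B).

Definition gralg_component i : lmodType k :=
  resc (subquo (radn regB i) (radn regB i.+1)).

Lemma gralg_one_subproof : (1 : regB) \in radn regB 0.
Proof. exact: (proj2 (mksubP _ _ _) I). Qed.

Lemma gralg_mul_subproof i j (x y : regB) :
  x \in radn regB i -> y \in radn regB j -> (x : B) * y \in radn regB (i + j).
Proof.
pose r (z : regB) : regB := (z : B) * y.
have rL : linear r by move=> a u v; rewrite /r mulrDl; congr (_ + _); exact: esym (mulrA _ _ _).
pose rl : {linear regB -> regB} := HB.pack r (GRing.isLinear.Build B _ _ _ r rL).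
move=> xi yj; apply: (radn_hom (f := rl)) xi => z /=.
exact: (rpredZ (z : B) yj).
Qed.

Definition gralg : galg k :=
  @GAlg k gralg_component (sqcls _ gralg_one_subproof)
    (fun i j x y => sqcls _ (gralg_mul_subproof (sqreprP x) (sqreprP y))).
End GrAlg.

(* Main.v *)
(* The functor X (x) - is exact and stably fully faithful, and A is self-injective, so an extension
   of X (x) V by X (x) K comes from an extension of V by K. Hence a module filtered by add S is, with
   its filtration, of the form X (x) E, with E filtered by semisimple B-modules.

   Since X has no projective bimodule summand, the modules X (x) L, with L simple, have no projective
   summand: any endomorphism of X (x) L factoring through a projective lifts to an endomorphism of X
   factoring through a free bimodule, and Fitting's lemma turns a projective summand of X (x) L into
   one of X. It follows that the S-radical filtrations are exactly the images X (x) rad^i E of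
   radical filtrations.

   Maps between semisimple B-modules are stably trivial only when they are zero. So a stable map
   X (x) (E / rad E) -> X (x) (rad^i E' / rad^(i+1) E') is a map of B-modules, and it is induced by a
   filtered map exactly when it lifts to E -> rad^i E', because the obstruction is stably trivial.
   This identifies Hom_G with the graded homomorphisms of gr(B-mod).

   Finally P_S (+) Q_S with its filtration corresponds to the projective cover of L, and B is
   the direct sum of these covers when it is basic. *)

From HB Require Import structures.
From mathcomp Require Import all_boot all_algebra all_field.
From mathcomp Require Import boolp.
Require Import Defs.

Set Implicit Arguments.
Unset Strict Implicit.
Unset Printing Implicit Defensive.
Import GRing.Theory.
Local Open Scope ring_scope.

(** * Rank, chain conditions and the Fitting decomposition *)

(** The lift of a stably trivial endomorphism of [X (x) L] to [X] uses that [B] is split. The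
    coefficient functions of the simple module [L] embed the power [L^n], with [n = dim L], in the
    dual [DB]. As [A] is injective, a map [X (x) L -> A] placed on one copy of [L] extends to
    [X (x) DB -> A], and such maps are the bimodule maps from [X] to the free bimodule [A (x)_k B].
    Stable information becomes honest through one consequence of Fitting's lemma: on a module
    without projective summand, the identity plus a stably trivial endomorphism is bijective. It is
    used where Krull-Schmidt might be expected. Composition in [G] is defined through chosen lifts,
    so that even its associativity needs proof. Independence of the choice is shown for modules
    presented as [X (x) E]; hence every object is presented before [G] is known to be a category.
    Presentations are not canonical, so the equivalence is built from the relation [E] presents [M],
    with a chosen presentation for each object of [G]. *)

Section LinearMaps.
Context {R : pzRingType}.
Implicit Types U V W Z : lmodType R.

Definition mklin V W (f : V -> W) (fL : linear f) : {linear V -> W} :=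
  HB.pack f (GRing.isLinear.Build R V W _ f fL).

Lemma lin_inverse V W (f : {linear V -> W}) :
  bijective f -> exists g : {linear W -> V}, cancel f g /\ cancel g f.
Proof.
move=> [g fg gf].
have gL : linear g by move=> a x y; apply: (can_inj fg); rewrite gf linearP !gf.
by exists (mklin gL).
Qed.

Lemma surj_inj_bij V W (f : {linear V -> W}) :
  (forall y, exists x, f x = y) -> (forall x, f x = 0 -> x = 0) -> bijective f.
Proof.
move=> fs fi; have [g gK] := choice fs; exists g => // x.
by apply/eqP; rewrite -subr_eq0; apply/eqP/fi; rewrite linearB /= gK subrr.
Qed.

Lemma lin_inj V W (f : {linear V -> W}) :
  (forall x, f x = 0 -> x = 0) -> injective f.
Proof. by move=> fi x y fxy; apply/eqP; rewrite -subr_eq0; apply/eqP/fi; rewrite linearB fxy subrr. Qed.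

Lemma inj_lin0 V W (f : {linear V -> W}) x : injective f -> f x = 0 -> x = 0.
Proof. by move=> fi fx; apply: fi; rewrite fx linear0. Qed.

Lemma bij_surj V W (f : V -> W) : bijective f -> forall y, exists x, f x = y.
Proof. by move=> [g fg gf] y; exists (g y). Qed.

Lemma factor_surj V W Z (p : {linear V -> Z}) (q : {linear V -> W}) :
  (forall z, exists x, p x = z) -> (forall x, p x = 0 -> q x = 0) ->
  exists r : {linear Z -> W}, forall x, r (p x) = q x.
Proof.
move=> ps pq; have [s sK] := choice ps.
have qE x y : p x = p y -> q x = q y.
  by move=> pxy; apply/eqP; rewrite -subr_eq0 -linearB pq // linearB pxy subrr.
have rL : linear (q \o s).
  by move=> a x y; rewrite /= -linearP; apply: qE; rewrite linearP /= !sK.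
by exists (mklin rL) => x; apply: qE; rewrite sK.
Qed.

Lemma factor_inj U V W (i : {linear U -> V}) (f : {linear W -> V}) :
  injective i -> (forall w, exists u, i u = f w) ->
  exists g : {linear W -> U}, forall w, i (g w) = f w.
Proof.
move=> ii fi; have [g gK] := choice fi.
have gL : linear g by move=> a x y; apply: ii; rewrite linearP !gK linearP.
by exists (mklin gL).
Qed.

Lemma fullsubP V (x : V) : x \in fullsub V.
Proof. exact: (proj2 (mksubP _ _ _) I). Qed.

Lemma zerosubP V (x : V) : x \in zerosub V <-> x = 0.
Proof. exact: mksubP. Qed.

Lemma kersubP V W (f : {linear V -> W}) x : x \in kersub f <-> f x = 0.
Proof. by split=> [/mksubP/zerosubP|fx]; [|apply/mksubP/zerosubP]. Qed.

Lemma presubP V W (f : {linear V -> W}) (T : submodClosed W) x : x \in presub f T <-> f x \in T.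
Proof. exact: mksubP. Qed.

Lemma imsubP V W (f : {linear V -> W}) (T : submodClosed V) y :
  y \in imsub f T <-> exists2 x, x \in T & y = f x.
Proof. exact: mksubP. Qed.

Lemma imsub_full V W (f : {linear V -> W}) x : f x \in imsub f (fullsub V).
Proof. by apply/imsubP; exists x => //; apply: fullsubP. Qed.

Lemma cls0 V (U : submodClosed V) x : cls U x = 0 <-> x \in U.
Proof. by rewrite -(linear0 (cls U)) clsP subr0. Qed.

Lemma cls_surj V (U : submodClosed V) q : exists x, cls U x = q.
Proof. by exists (repr q); rewrite clsK. Qed.

Lemma subm_val0 V (U : submodClosed V) (x : subm U) : val x = 0 -> x = 0.
Proof. by move=> x0; apply: val_inj. Qed.

Lemma corestrict V W (f : {linear V -> W}) (T : submodClosed W) :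
  (forall x, f x \in T) -> exists g : {linear V -> subm T}, forall x, val (g x) = f x.
Proof.
move=> fT; apply: (factor_inj (i := \val : {linear subm T -> W})); first exact: val_inj.
by move=> w; exists (exist _ (f w) (fT w)).
Qed.

Lemma iter_linear V (f : {linear V -> V}) n : linear (iter n f).
Proof. by elim: n => [|n IHn] a x y //=; rewrite IHn linearP. Qed.
Definition iterlin V (f : {linear V -> V}) n := mklin (iter_linear f n).

End LinearMaps.

Section Generation.
Context {k : fieldType} {A : falgType k}.
Implicit Types V W : lmodType A.

Lemma combsub_mem V (s : seq V) x : x \in s -> x \in combsub s.
Proof.
move=> sx; apply/mksubP; exists [:: (1, x)]; last by rewrite big_seq1 scale1r.
by move=> y; rewrite inE => /eqP ->.
Qed.

Lemma combsub_least V (s : seq V) (U : submodClosed V) :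
  (forall x, x \in s -> x \in U) -> subsub (combsub s) U.
Proof.
move=> sU x /mksubP[r rs ->]; rewrite big_seq rpred_sum // => t rt.
by rewrite rpredZ // sU // rs // map_f.
Qed.

Lemma fingenP V : fingen V <-> exists s : seq V, forall x, x \in combsub s.
Proof.
split=> -[s sV]; exists s => x; first by apply/mksubP; apply: sV.
by have /mksubP := sV x.
Qed.

Lemma fingen_surj V W (f : {linear V -> W}) :
  fingen V -> (forall y, exists x, f x = y) -> fingen W.
Proof.
move=> /fingenP[s sV] fs; apply/fingenP; exists (map f s) => y.
have [x <-] := fs y; apply/presubP; move: x (sV x); apply: combsub_least => x sx.
by apply/presubP/combsub_mem/map_f.
Qed.

Definition kindep V n (v : 'I_n -> V) :=
  forall c : 'I_n -> k, \sum_i ((c i)%:A : A) *: v i = 0 -> forall i, c i = 0.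

Definition kspan V n (v : 'I_n -> V) :=
  forall x, exists c : 'I_n -> k, x = \sum_i ((c i)%:A : A) *: v i.

Lemma scal_scale V (a b : k) (x : V) : (a%:A : A) *: ((b%:A : A) *: x) = ((a * b)%:A : A) *: x.
Proof. by rewrite scalerA -scalerAl mul1r scalerA. Qed.

Lemma one_scale V (x : V) : ((1%:A : A) *: x) = x.
Proof. by rewrite !scale1r. Qed.

(** If [m < n], the matrix of the [v i] in terms of the [e j] has a nonzero row in its left kernel,
    and this row is a relation between the [v i]. *)
Lemma kindep_bound V m n (e : 'I_m -> V) (v : 'I_n -> V) :
  kspan e -> kindep v -> (n <= m)%N.
Proof.
move=> eV vI; have [c cE] := choice (fun i => eV (v i)).
rewrite leqNgt; apply/negP => mn.
pose C := \matrix_(i < n, j < m) c i j.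
have : kermx C != 0.
  rewrite kermx_eq0; apply/negP => /eqP rC.
  by have := rank_leq_col C; rewrite rC leqNgt mn.
move=> /matrix0Pn[i0 [j0 K0]]; move/eqP: K0; apply.
apply: (vI (fun j => kermx C i0 j)).
under eq_bigr do rewrite cE scaler_sumr.
rewrite exchange_big big1 // => j _ /=.
have : (kermx C *m C) i0 j = 0 by rewrite mulmx_ker mxE.
rewrite mxE => S0.
under eq_bigr do rewrite scal_scale.
rewrite -scaler_suml -scaler_suml (_ : \sum_i _ = 0) ?scale0r //.
by rewrite -[RHS]S0; apply: eq_bigr => i _; rewrite [C _ _]mxE.
Qed.

Lemma kspan_sum V n (v : 'I_n -> V) (x y : V) a :
  (exists c : 'I_n -> k, x = \sum_i ((c i)%:A : A) *: v i) ->
  (exists c : 'I_n -> k, y = \sum_i ((c i)%:A : A) *: v i) ->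
  exists c : 'I_n -> k, (a%:A : A) *: x + y = \sum_i ((c i)%:A : A) *: v i.
Proof.
move=> [c ->] [d ->]; exists (fun i => a * c i + d i).
rewrite scaler_sumr -big_split; apply: eq_bigr => i _ /=.
by rewrite scalerDl scalerDl -scal_scale.
Qed.

Lemma fingen_kspan V : fingen V -> exists n (e : 'I_n -> V), kspan e.
Proof.
move=> [s sV].
pose g := [seq (b : A) *: v | b <- vbasis {:A}, v <- s].
exists (size g), (fun i => g`_i) => x.
pose sp x := exists c : 'I_(size g) -> k, x = \sum_i ((c i)%:A : A) *: g`_i.
have sp0 : sp 0 by exists (fun=> 0); rewrite big1 // => i _; rewrite !scale0r.
have [r rs ->] := sV x; elim: r rs => [|[a v] r IHr] rs; first by rewrite big_nil.
rewrite big_cons -[(a, v).1]/a -[(a, v).2]/v -[a *: v]one_scale.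
apply: kspan_sum; last by apply: IHr => y ry; apply: rs; rewrite inE ry orbT.
have sv : v \in s by apply: rs; rewrite inE eqxx.
rewrite (coord_vbasis (memvf a)) scaler_suml.
elim/big_ind: _ => // [y z ys zs|i _].
  by rewrite -[y]one_scale; apply: kspan_sum.
have /nthP : (vbasis {:A})`_i *: v \in g by apply: allpairs_f => //; rewrite mem_nth // size_tuple.
move=> /(_ 0)[j jg jE]; exists (fun j' => if j' == Ordinal jg then coord (vbasis {:A}) i a else 0).
rewrite (bigD1 (Ordinal jg)) //= eqxx big1 ?addr0 => [|j' /negPf ->]; last by rewrite !scale0r.
by rewrite jE scalerA -scalerAl mul1r.
Qed.
End Generation.

Section Rank.
Context {k : fieldType} {A : falgType k}.

Section RankDef.
Context (V : fgmod A).
Implicit Type U : submodClosed V.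

Definition indep_in U n := `[< exists v : 'I_n -> V, (forall i, v i \in U) /\ kindep v >].

Lemma indep_in0 U : exists n, indep_in U n.
Proof.
by exists 0; apply/asboolP; exists (fun=> 0); split=> [i|c _ []//]; apply: rpred0.
Qed.

Lemma indep_in_bound : exists m, forall U n, indep_in U n -> (n <= m)%N.
Proof.
have [m [e eV]] := fingen_kspan (fgmodP V).
by exists m => U n /asboolP[v [_ vI]]; apply: kindep_bound eV vI.
Qed.

(** This is the [k]-dimension of [U]; it serves as the measure for both chain conditions. *)
Definition rk U := ex_maxn (indep_in0 U) (svalP (cid indep_in_bound) U).

Lemma rkP U : indep_in U (rk U).
Proof. by rewrite /rk; case: ex_maxnP. Qed.

Lemma rk_max U n : indep_in U n -> (n <= rk U)%N.
Proof. by rewrite /rk; case: ex_maxnP => i _ H /H. Qed.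

Lemma rk_le U U' : subsub U U' -> (rk U <= rk U')%N.
Proof.
move=> UU'; apply: rk_max; have /asboolP[v [vU vI]] := rkP U.
by apply/asboolP; exists v; split=> // i; apply: UU'.
Qed.

Lemma kspan_rank U n (v : 'I_n -> V) : (forall i, v i \in U) -> kindep v -> n = rk U ->
  forall x, x \in U -> exists c : 'I_n -> k, x = \sum_i ((c i)%:A : A) *: v i.
Proof.
move=> vU vI nE x Ux; apply: contrapT => nx.
pose w (i : 'I_n.+1) := if unlift ord0 i is Some j then v j else x.
suff /rk_max : indep_in U n.+1 by rewrite -nE ltnn.
apply/asboolP; exists w; split=> [i|c]; first by rewrite /w; case: unliftP.
rewrite big_ord_recl /w unlift_none.
under eq_bigr do rewrite liftK.
have [c0 S0|c0 /eqP] := eqVneq (c ord0) 0.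
  move=> i; case: (unliftP ord0 i) => [j ->|-> //].
  by apply: (vI (fun j => c (lift ord0 j))); rewrite -[RHS]S0 c0 !scale0r add0r.
rewrite addr_eq0 => /eqP xE; case: nx.
exists (fun j => - ((c ord0)^-1 * c (lift ord0 j))).
rewrite -[x]one_scale -[X in X%:A *: x](mulVf c0) -scal_scale xE.
rewrite -sumrN scaler_sumr; apply: eq_bigr => j _.
by rewrite scalerN scal_scale !scaleNr.
Qed.

Lemma rk_eq U U' : subsub U U' -> (rk U' <= rk U)%N -> subsub U' U.
Proof.
move=> UU' r; have rE : rk U = rk U' by apply/eqP; rewrite eqn_leq r rk_le.
have /asboolP[v [vU vI]] := rkP U.
have vU' i : v i \in U' by apply: UU'.
move=> x /(kspan_rank vU' vI rE)[c ->]; apply: rpred_sum => i _.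
by rewrite rpredZ.
Qed.

Lemma max_submod (P : submodClosed V -> Prop) U0 : P U0 ->
  exists2 U, P U & forall U', P U' -> subsub U U' -> subsub U' U.
Proof.
move=> PU0.
have ex : exists n, `[< exists2 U, P U & rk U = n >] by exists (rk U0); apply/asboolP; exists U0.
have bd n : `[< exists2 U, P U & rk U = n >] -> (n <= rk (fullsub V))%N.
  by move=> /asboolP[U _ <-]; apply: rk_le => x _; apply: fullsubP.
case: (ex_maxnP ex bd) => n /asboolP[U PU rU] nmax; exists U => // U' PU' UU'.
by apply: rk_eq => //; rewrite rU; apply: nmax; apply/asboolP; exists U'.
Qed.

Lemma min_submod (P : submodClosed V -> Prop) U0 : P U0 ->
  exists2 U, P U & forall U', P U' -> subsub U' U -> subsub U U'.
Proof.
move=> PU0.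
have ex : exists n, `[< exists2 U, P U & rk U = n >] by exists (rk U0); apply/asboolP; exists U0.
case: (ex_minnP ex) => n /asboolP[U PU rU] nmin; exists U => // U' PU' UU'.
by apply: rk_eq => //; rewrite rU; apply: nmin; apply/asboolP; exists U'.
Qed.

(** A maximal member among the finitely generated submodules of [U] contains every [x] of [U], since
    adjoining [x] to its generators gives another member. *)
Lemma fingen_subm U : fingen (subm U).
Proof.
pose P (T : submodClosed V) := exists s : seq (subm U), forall x, x \in T <-> exists2 y, y \in combsub s & x = val y.
have P0 : P (zerosub V).
  exists [::] => x; split=> [/zerosubP ->|[y /mksubP[r rs ->] ->]].
    by exists 0 => //; apply: rpred0.
  case: r rs => [|t r] rs; first by rewrite big_nil; apply: rpred0.
  by have := rs t.2; rewrite inE eqxx => /(_ isT).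
have [T [s sT] Tmax] := max_submod P0.
apply/fingenP; exists s => x.
pose T' := imsub (\val : {linear subm U -> V}) (combsub (x :: s)).
have sub : subsub (combsub s) (combsub (x :: s)).
  by apply: combsub_least => y sy; apply: combsub_mem; rewrite inE sy orbT.
have PT' : P T' by exists (x :: s) => y; rewrite /T' imsubP.
have TT' : subsub T T' by move=> y /sT[z sz ->]; apply/imsubP; exists z => //; apply: sub.
have : val x \in T'.
  by apply/imsubP; exists x => //; apply: combsub_mem; rewrite inE eqxx.
by move=> /(Tmax _ PT' TT')/sT[y sy /val_inj ->].
Qed.

Lemma fingen_quom U : fingen (quom U).
Proof. exact: fingen_surj (fgmodP V) (@cls_surj _ _ U). Qed.

Lemma stable_up (U : nat -> submodClosed V) : (forall n, subsub (U n) (U n.+1)) ->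
  exists N, forall m, (N <= m)%N -> subsub (U m) (U N).
Proof.
move=> Uup; have leU m n : (m <= n)%N -> subsub (U m) (U n).
  elim: n => [|n IHn]; first by rewrite leqn0 => /eqP -> x.
  by rewrite leq_eqVlt => /orP[/eqP -> x //|/IHn mn x /mn/Uup].
have [T [N TN] Tmax] := @max_submod (fun T => exists n, subsub T (U n) /\ subsub (U n) T) (U 0)
  (ex_intro _ 0 (conj (fun _ => id) (fun _ => id))).
exists N => m Nm x Ux; apply: (proj1 TN); apply: (Tmax (U m)) => //; first by exists m; split=> z.
by move=> y /(proj1 TN)/(leU _ _ Nm).
Qed.

Lemma stable_down (U : nat -> submodClosed V) : (forall n, subsub (U n.+1) (U n)) ->
  exists N, forall m, (N <= m)%N -> subsub (U N) (U m).
Proof.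
move=> Udn; have leU m n : (m <= n)%N -> subsub (U n) (U m).
  elim: n => [|n IHn]; first by rewrite leqn0 => /eqP -> x.
  by rewrite leq_eqVlt => /orP[/eqP -> x //|/IHn mn x /Udn/mn].
have [T [N TN] Tmin] := @min_submod (fun T => exists n, subsub T (U n) /\ subsub (U n) T) (U 0)
  (ex_intro _ 0 (conj (fun _ => id) (fun _ => id))).
exists N => m Nm x /(proj2 TN) Tx; apply: (Tmin (U m)) => //; first by exists m; split=> z.
by move=> y /(leU _ _ Nm)/(proj2 TN).
Qed.

Lemma fitting (f : {linear V -> V}) : exists2 n, (0 < n)%N &
  (forall x, iter n f (iter n f x) = 0 -> iter n f x = 0) /\
  (forall x, exists y, iter n f x = iter n f (iter n f y)).
Proof.
have [N1 H1] := @stable_up (fun n => kersub (iterlin f n)) (fun n x =>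
  fun Kx => proj2 (kersubP (iterlin f n.+1) x) (etrans (congr1 f (proj1 (kersubP _ _) Kx)) (linear0 f))).
have dn n : subsub (imsub (iterlin f n.+1) (fullsub V)) (imsub (iterlin f n) (fullsub V)).
  by move=> y /imsubP[x _ ->]; apply/imsubP; exists (f x); [exact: fullsubP|exact: iterSr].
have [N2 H2] := stable_down dn.
(* [n] lies beyond the points where the kernels and the images of the powers of [f] become
   stationary; the successor makes it positive, so that one factor [f] can be split off later. *)
exists (maxn N1 N2).+1 => //; set n := (maxn _ _).+1.
have n1 : (N1 <= n)%N by rewrite (leq_trans (leq_maxl N1 N2)).
have n2 : (N2 <= n)%N by rewrite (leq_trans (leq_maxr N1 N2)).
split=> x.
  rewrite -iterD => fx.
  have /kersubP fN1 : x \in kersub (iterlin f N1).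
    by apply: (H1 (n + n)%N); [rewrite (leq_trans n1) // leq_addl|apply/kersubP].
  by rewrite -(subnK n1) iterD -[iter N1 f x]/(iterlin f N1 x) fN1 -[iter _ f 0]/(iterlin f _ 0) linear0.
have : iterlin f n x \in imsub (iterlin f N2) (fullsub V).
  have -> : iterlin f n x = iterlin f N2 (iter (n - N2) f x) by rewrite /= -iterD subnKC.
  exact: imsub_full.
move=> /(H2 (n + n)%N); rewrite (leq_trans n2 (leq_addl _ _)) => /(_ isT)/imsubP[y _ yE].
by exists y; rewrite -iterD; apply: yE.
Qed.

Lemma surj_endo_inj (f : {linear V -> V}) :
  (forall y, exists x, f x = y) -> forall x, f x = 0 -> x = 0.
Proof.
move=> fs; have [[|n] // _ [fi _]] := fitting f; move=> x fx0.
have itS m : forall y, exists z, iter m f z = y.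
  elim: m => [|m IHm] y; first by exists y.
  by have [z <-] := fs y; have [w <-] := IHm z; exists w.
have [y yx] := itS n.+1 x; rewrite -yx; apply: fi; rewrite yx iterSr fx0.
exact: (linear0 (iterlin f n)).
Qed.

Lemma inj_endo_bij (f : {linear V -> V}) : (forall x, f x = 0 -> x = 0) -> bijective f.
Proof.
move=> fi; apply: surj_inj_bij => // y.
have itI m x : iter m f x = 0 -> x = 0 by elim: m => //= m IHm /fi/IHm.
have [[|n] // _ [_ fs]] := fitting f.
have [x xE] := fs y; exists (iter n f x); apply/eqP; rewrite -subr_eq0; apply/eqP/(itI n.+1).
rewrite -[iter _ f _]/(iterlin f n.+1 (iter n.+1 f x - y)) linearB /=.
by move: xE; rewrite /= => <-; rewrite subrr.
Qed.

End RankDef.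
End Rank.

(** * Projective modules and stably trivial maps *)

Section Products.
Context {R : pzRingType}.
Implicit Types U V W : lmodType R.

Lemma lpair_linear U V W (f : {linear U -> V}) (g : {linear U -> W}) :
  linear (fun x => (f x, g x) : (V * W)%type).
Proof. by move=> a x y; rewrite !linearP. Qed.
Definition lpair U V W (f : {linear U -> V}) (g : {linear U -> W}) := mklin (lpair_linear f g).

Definition linl V W : {linear V -> (V * W)%type} := lpair idfun \0.
Definition linr V W : {linear W -> (V * W)%type} := lpair \0 idfun.

Lemma prod_split V W (x : V * W) : x = linl V W x.1 + linr V W x.2.
Proof. by case: x => x y; apply/pair_equal_spec; rewrite /= addr0 add0r. Qed.
End Products.

Section Projectives.
Context {k : fieldType} {A : falgType k}.
Implicit Types U V W : lmodType A.

Lemma projective_retract V W (i : {linear W -> V}) (p : {linear V -> W}) :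
  (forall x, p (i x) = x) -> projective V -> projective W.
Proof.
move=> pi projV M N q f qs; have [g gP] := projV M N q (f \o p) qs.
by exists (g \o i) => x; rewrite /= gP /= pi.
Qed.

Lemma injmodule_retract V W (i : {linear W -> V}) (p : {linear V -> W}) :
  (forall x, p (i x) = x) -> injmodule V -> injmodule W.
Proof.
move=> pi injV M N u f ui; have [g gP] := injV M N u (i \o f) ui.
by exists (p \o g) => x; rewrite /= gP /= pi.
Qed.

Lemma injmodule_prod V W : injmodule V -> injmodule W -> injmodule (V * W : lmodType A)%type.
Proof.
move=> iV iW M N u f ui; have [g gP] := iV M N u (fst \o f) ui.
have [h hP] := iW M N u (snd \o f) ui.
by exists (lpair g h) => x; rewrite /= gP hP /=; case: (f x).
Qed.

Lemma regular_fingen : fingen (A^o : lmodType A).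
Proof.
apply/fingenP; exists [:: 1] => x; rewrite -[x]mulr1.
by apply: (rpredZ (x : A)); apply: combsub_mem; rewrite inE.
Qed.
Definition regfg := FgMod regular_fingen.

Lemma orbit_linear V (v : V) : linear (fun a : A^o => (a : A) *: v).
Proof. by move=> a x y; rewrite scalerDl scalerA. Qed.
Definition orbit_lin V (v : V) : {linear A^o -> V} := mklin (orbit_linear v).

Lemma regular_projective : projective regfg.
Proof.
move=> M N p f ps; have [m mE] := ps (f (1 : A)).
exists (orbit_lin m) => x; rewrite /= linearZ /= mE -linearZ /=.
by congr (f _); exact: mulr1.
Qed.

(** One copy of the regular module is added for each generator. The dual basis and the injectivity
    of the free module are carried along the induction, because projective modules inherit both by
    retraction. *)
Lemma free_cover (V : fgmod A) : exists (P : fgmod A) (p : {linear P -> V}),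
  [/\ projective P, forall y, exists x, p x = y, self_injective A -> injmodule P &
      exists r : seq ({linear P -> A^o} * P), forall x, x = \sum_(t <- r) (t.1 x : A) *: t.2].
Proof.
have [s sV] := proj1 (fingenP _) (fgmodP V).
suff [P [p [projP ps injP dualP]]] : exists (P : fgmod A) (p : {linear P -> V}),
    [/\ projective P, forall y, y \in s -> exists x, p x = y, self_injective A -> injmodule P &
        exists r : seq ({linear P -> A^o} * P), forall x, x = \sum_(t <- r) (t.1 x : A) *: t.2].
  exists P, p; split=> // y.
  have /imsubP[x _ ->] : y \in imsub p (fullsub _); last by exists x.
  move: y (sV y); apply: combsub_least => y /ps[x <-]; exact: imsub_full.
elim: s {sV} => [|v s [P [p [projP ps injP [r rE]]]]].
  have [P [projP P0]] := zero_projective V.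
  exists P, \0; split=> // [_ M N u f ui|].
    by exists \0 => x; rewrite (P0 (f x)).
  by exists [::] => x; rewrite big_nil.
exists (prodfg regfg P), ((orbit_lin v \o fst) \+ (p \o snd)); split.
- exact: projective_prod regular_projective projP.
- move=> y; rewrite inE => /orP[/eqP ->|/ps[x <-]].
    by exists ((1 : A), 0); rewrite /= linear0 addr0 scale1r.
  by exists (0, x); rewrite /= scale0r add0r.
- by move=> sA; apply: injmodule_prod => //; apply: injP.
- pose q : {linear prodfg regfg P -> P} := snd.
  pose tr (t : {linear P -> A^o} * P) : {linear prodfg regfg P -> A^o} * prodfg regfg P :=
    (t.1 \o q : {linear prodfg regfg P -> A^o}, linr regfg P t.2).
  exists ((fst : {linear prodfg regfg P -> A^o}, linl regfg P (1 : A)) :: map tr r) => x.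
  rewrite [LHS]prod_split big_cons big_map /=; congr (_ + _).
    by apply/pair_equal_spec; rewrite /= scaler0; split=> //; rewrite -[LHS]mulr1.
  rewrite [in LHS](rE x.2) -[LHS]/(linr regfg P _) linear_sum.
  by apply: eq_bigr => t _; rewrite linearZ.
Qed.

Lemma projective_section (N P : fgmod A) (q : {linear N -> P}) :
  projective P -> (forall y, exists x, q x = y) ->
  exists s : {linear P -> N}, forall x, q (s x) = x.
Proof. by move=> projP qs; exact: (projP N P q idfun qs). Qed.

Lemma projective_injective (P : fgmod A) : self_injective A -> projective P -> injmodule P.
Proof.
move=> sA projP; have [F [p [_ ps injF _]]] := free_cover P.
have [s sE] := projective_section projP ps.
exact: injmodule_retract sE (injF sA).
Qed.

Lemma dual_basis (P : fgmod A) : projective P ->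
  exists r : seq ({linear P -> A^o} * P), forall x, x = \sum_(t <- r) (t.1 x : A) *: t.2.
Proof.
move=> projP; have [F [p [_ ps _ [r rE]]]] := free_cover P.
have [s sE] := projective_section projP ps.
pose tr (t : {linear F -> A^o} * F) : {linear P -> A^o} * P :=
  (t.1 \o s : {linear P -> A^o}, p t.2).
exists (map tr r) => x; rewrite big_map -[LHS]sE [s x in LHS]rE linear_sum.
by apply: eq_bigr => t _; rewrite linearZ.
Qed.

(** The pointwise form of [factors_proj], for bare linear maps, so that no equality in [hom] has to
    be maintained. *)
Definition stably_zero V W (f : {linear V -> W}) := exists P : fgmod A, projective P /\
  exists (u : {linear V -> P}) (v : {linear P -> W}), forall x, f x = v (u x).

Lemma factors_projE V W (f : hom V W) : factors_proj f <-> stably_zero f.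
Proof.
split=> -[P [projP [u [v uv]]]]; exists P; split=> //; exists u, v.
  by move=> x; rewrite uv.
exact/homP.
Qed.

Lemma stably_zero_ext V W (f g : {linear V -> W}) : f =1 g -> stably_zero f -> stably_zero g.
Proof.
by move=> fg [P [projP [u [v uv]]]]; exists P; split=> //; exists u, v => x; rewrite -fg.
Qed.

Lemma stably_zero_add V W (f g : {linear V -> W}) : stably_zero f -> stably_zero g -> stably_zero (f \+ g).
Proof.
move=> [P [projP [u [v uv]]]] [Q [projQ [s [t st]]]].
exists (prodfg P Q); split; first exact: projective_prod.
by exists (lpair u s), ((v \o fst) \+ (t \o snd)) => x; rewrite /= uv st.
Qed.

Lemma stably_zero_opp V W (f : {linear V -> W}) : stably_zero f -> stably_zero (\- f).
Proof.
by move=> [P [projP [u [v uv]]]]; exists P; split=> //; exists u, (\- v) => x; rewrite /= uv.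
Qed.

Lemma stably_zero_sub V W (f g : {linear V -> W}) : stably_zero f -> stably_zero g -> stably_zero (f \- g).
Proof.
move=> sf sg; apply: (stably_zero_ext (f := f \+ (\- g))) => //.
exact: stably_zero_add sf (stably_zero_opp sg).
Qed.

Lemma stably_zero_compl U V W (f : {linear V -> W}) (g : {linear U -> V}) : stably_zero f -> stably_zero (f \o g).
Proof.
by move=> [P [projP [u [v uv]]]]; exists P; split=> //; exists (u \o g), v => x; rewrite /= uv.
Qed.

Lemma stably_zero_compr U V W (f : {linear V -> W}) (g : {linear U -> V}) : stably_zero g -> stably_zero (f \o g).
Proof.
by move=> [P [projP [u [v uv]]]]; exists P; split=> //; exists u, (f \o v) => x; rewrite /= uv.
Qed.

Lemma stably_zero_from_projective (P : fgmod A) W (f : {linear P -> W}) : projective P -> stably_zero f.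
Proof. by move=> projP; exists P; split=> //; exists idfun, f. Qed.

Lemma stably_zero_to_projective (P : fgmod A) W (f : {linear W -> P}) : projective P -> stably_zero f.
Proof. by move=> projP; exists P; split=> //; exists f, idfun. Qed.

Lemma stably_zero0 V W : stably_zero (\0 : {linear V -> W}).
Proof.
have [P [projP P0]] := zero_projective V.
by exists P; split=> //; exists \0, \0.
Qed.

Lemma stably_zero_id_projective V : stably_zero (idfun : {linear V -> V}) -> projective V.
Proof.
move=> [P [projP [u [v uv]]]]; apply: (projective_retract (i := u) (p := v) _ projP) => x.
by rewrite -uv.
Qed.

Definition no_proj_retract V := forall (P : fgmod A) (i : {linear P -> V}) (p : {linear V -> P}),
  projective P -> (forall x, p (i x) = x) -> forall x : P, x = 0.

Lemma no_proj_retract_retract V W (i : {linear W -> V}) (p : {linear V -> W}) :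
  (forall x, p (i x) = x) -> no_proj_retract V -> no_proj_retract W.
Proof.
move=> pi nV P j q projP qj; apply: (nV P (i \o j) (q \o p)) => // x.
by rewrite /= pi qj.
Qed.

Lemma no_proj_retract_bij V W (f : {linear V -> W}) : bijective f -> no_proj_retract W -> no_proj_retract V.
Proof. by move=> /lin_inverse[g [fg gf]]; apply: no_proj_retract_retract fg. Qed.

Definition fsub (V : fgmod A) (U : submodClosed V) := FgMod (fingen_subm U).
Definition fquo (V : fgmod A) (U : submodClosed V) := FgMod (fingen_quom U).

Lemma nilpotent_add_bij (V : fgmod A) (f : {linear V -> V}) n :
  (forall x, iter n f x = 0) -> bijective (idfun \+ f : {linear V -> V}).
Proof.
move=> f0; apply: inj_endo_bij => x /= /eqP; rewrite addrC addr_eq0 => /eqP fx.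
elim: n f0 => [|n IHn] f0; first exact: (f0 x).
have := f0 x; rewrite iterSr fx -[iter _ _ _]/(iterlin f n (- x)) linearN /= => /eqP.
rewrite oppr_eq0 => /eqP.
elim: n {f0 IHn} => // n IHn; rewrite iterSr fx -[iter _ _ _]/(iterlin f n (- x)) linearN /=.
by move/eqP; rewrite oppr_eq0 => /eqP.
Qed.

(** The Fitting image of [f] as abstract data: [W] is the image of [f^n], [i] its inclusion, and [t]
    the inverse of [g \o i]. The maps are kept because they later carry a right action from [V] to
    [W], when [V] is a bimodule. *)
Lemma fitting_summand (V : fgmod A) (f : {linear V -> V}) :
  exists (n : nat) (W : fgmod A) (i : {linear W -> V}) (g : {linear V -> W}) (t : {linear W -> W}),
  [/\ (0 < n)%N, injective i, forall x, i (g x) = iter n f x, forall w, t (g (i w)) = w &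
      forall w, g (i (t w)) = w].
Proof.
have [n n0 [fi fs]] := fitting f.
pose T := imsub (iterlin f n) (fullsub V).
have [g gE] := @corestrict _ _ _ (iterlin f n) T (@imsub_full _ _ _ _).
pose i : {linear fsub T -> V} := \val.
have igE x : i (g x) = iter n f x by exact: gE.
have gis w : exists z, g (i z) = w.
  have /imsubP[x _ wE] := valP w; have [y yE] := fs x.
  exists (g y); apply: val_inj.
  by rewrite -[LHS]/(i (g (i (g y)))) !igE -yE; exact: esym wE.
have gii z : g (i z) = 0 -> z = 0.
  have /imsubP[x _ zE] := valP z => gz; apply: subm_val0; rewrite zE; apply: fi.
  by have := igE (i z); rewrite gz linear0 => ->; congr (iter n f _); exact: esym zE.
have [t [tg gt]] := lin_inverse (@surj_inj_bij _ _ _ (g \o i : {linear fsub T -> fsub T}) gis gii).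
by exists n, (fsub T), i, g, t; split=> //; apply: val_inj.
Qed.

(** On the Fitting image [W] of [f] a power of [f] is invertible and factors through [P]. So [W] is
    a projective summand, hence zero, and [f] is nilpotent. *)
Lemma no_proj_retract_stably_zero_bij (V : fgmod A) (f : {linear V -> V}) :
  no_proj_retract V -> stably_zero f -> bijective (idfun \+ f : {linear V -> V}).
Proof.
move=> nV [P [projP [u [v uv]]]].
have [[|n] [W [i [g [t [// _ ii gE tg gt]]]]]] := fitting_summand f.
suff W0 (w : W) : w = 0.
  by apply: (nilpotent_add_bij (n := n.+1)) => x; rewrite -gE (W0 (g x)) linear0.
have projW : projective W.
  (* [v \o u \o f^n \o i] is [f^(n+1) \o i = i \o g \o i], and [t \o t \o g] undoes it. *)
  apply: (projective_retract (i := u \o iterlin f n \o i) (p := t \o t \o g \o v) _ projP).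
  move=> w' /=; rewrite -uv -[f (iter _ _ _)]/(iter n.+1 f (i w')).
  by rewrite -gE -[t (g (i _))]/(t _) tg tg.
exact: (nV W i (t \o g) projW).
Qed.

(** An exchange argument. With [t] inverse to the sum, [a j \o t \o b j] factors through [P], so the
    identity minus it is bijective on [Y j]. It kills [a j x] whenever the remaining terms kill [x],
    so the term [j] may be dropped from the sum. *)
Lemma no_proj_retract_family (P : fgmod A) (J : eqType) (s : seq J) (Y : J -> fgmod A)
    (a : forall j, {linear P -> Y j}) (b : forall j, {linear Y j -> P}) :
  projective P -> (forall j, no_proj_retract (Y j)) ->
  bijective (fun x => \sum_(j <- s) b j (a j x)) -> forall x : P, x = 0.
Proof.
move=> projP nY.
have sL (r : seq J) : linear (fun x => \sum_(j <- r) b j (a j x)).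
  move=> c x y; rewrite scaler_sumr -big_split; apply: eq_bigr => j _.
  by rewrite !linearP.
elim: s => [|j s IHs] bij.
  by move=> x; apply: (bij_inj bij); rewrite !big_nil.
apply: IHs; have [t [t1 t2]] := lin_inverse (f := mklin (sL (j :: s))) bij.
rewrite -[X in bijective X]/(mklin (sL s) : _ -> _); apply: inj_endo_bij => x /= S0.
have xE : x = t (b j (a j x)) by rewrite -[LHS]t1 /= big_cons S0 addr0.
pose f : {linear Y j -> Y j} := a j \o t \o b j.
have sf : stably_zero (\- f).
  by apply: stably_zero_opp; apply: stably_zero_compr; apply: stably_zero_to_projective.
suff ax : a j x = 0 by rewrite xE ax !linear0.
apply: (bij_inj (no_proj_retract_stably_zero_bij (nY j) sf)).
rewrite linear0 /= -xE; exact: subrr.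
Qed.

Lemma no_proj_retract_dsum (J : finType) V (W : J -> fgmod A) (inj : forall j, {linear W j -> V}) :
  is_dsum inj -> (forall j, no_proj_retract (W j)) -> no_proj_retract V.
Proof.
move=> [pr [_ _ prS]] nW P i p projP pi.
apply: (@no_proj_retract_family P J (index_enum J) W (fun j => pr j \o i) (fun j => p \o inj j)) => //.
exists id => x /=; first by rewrite -linear_sum -prS pi.
by rewrite -linear_sum -prS pi.
Qed.

End Projectives.

(** * Radicals, semisimple modules and projective covers *)

Section Radicals.
Context {k : fieldType} {A : falgType k}.
Implicit Types U V W : lmodType A.

Lemma capsubP V (U T : submodClosed V) x : x \in capsub U T <-> x \in U /\ x \in T.
Proof. exact: mksubP. Qed.

Lemma addsubP V (U T : submodClosed V) x :
  x \in addsub U T <-> exists u, exists2 w, u \in U /\ w \in T & x = u + w.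
Proof. exact: mksubP. Qed.

Lemma radsubP V (U : submodClosed V) x :
  x \in radsub U <-> x \in U /\ forall M : submodClosed V, maximal_in U M -> x \in M.
Proof. exact: mksubP. Qed.

Lemma radsub_sub V (U : submodClosed V) : subsub (radsub U) U.
Proof. by move=> x /radsubP[]. Qed.

Lemma radsub_mono V (U T : submodClosed V) : subsub U T -> subsub (radsub U) (radsub T).
Proof. by move=> UT x; exact: (@radsub_hom A V V idfun U T UT x). Qed.

Lemma radn_lin V W (f : {linear V -> W}) j x : x \in radn V j -> f x \in radn W j.
Proof.
by move=> Vx; rewrite -[j]addn0; apply: radn_hom Vx => y; apply: fullsubP.
Qed.

Lemma maximal_above (V : fgmod A) (U T : submodClosed V) :
  subsub T U -> ~ subsub U T -> exists2 M, maximal_in U M & subsub T M.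
Proof.
move=> TU UT.
pose P (W : submodClosed V) := [/\ subsub W U, ~ subsub U W & subsub T W].
have [|W [WU UW TW] Wmax] := @max_submod _ _ V P T; first by split.
exists W => //; split=> // W' WW' W'U.
case: (pselect (subsub U W')) => [|UW']; [by right|left].
by apply: Wmax => //; split=> // x /TW/WW'.
Qed.

Lemma nakayama (V : fgmod A) (U T : submodClosed V) :
  subsub T U -> (forall x, x \in U -> exists2 t, t \in T & x - t \in radsub U) -> subsub U T.
Proof.
move=> TU UT; apply: contrapT => nUT.
have [W maxW TW] := maximal_above TU nUT; have [_ nUW _] := maxW.
apply: nUW => x /UT[t /TW Wt /radsubP[_ /(_ W maxW) Wx]].
by rewrite -(subrK t x) rpredD.
Qed.

Lemma radsub_full0 (V : fgmod A) (U : submodClosed V) :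
  subsub U (radsub U) -> subsub U (zerosub V).
Proof.
move=> UR; apply: nakayama => [x /zerosubP ->|x Ux]; first by rewrite rpred0.
by exists 0; [apply: rpred0|rewrite subr0; apply: UR].
Qed.

Lemma radn_nilpotent (V : fgmod A) : exists r, subsub (radn V r) (zerosub V).
Proof.
have [N NP] := @stable_down _ _ V (radn V) (fun n => @radsub_sub _ (radn V n)).
by exists N; apply: radsub_full0; apply: (NP N.+1).
Qed.

(** [radn] iterates the radical inside a fixed module; this allows statements about whole modules to
    be applied to its terms. *)
Lemma radsub_subm V (U : submodClosed V) (x : subm U) :
  x \in radsub (fullsub (subm U)) <-> val x \in radsub U.
Proof.
split=> [|/radsubP[_ xW]].
  by apply: (@radsub_hom A _ _ (\val : {linear subm U -> V})) => y _; apply: valP.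
apply/radsubP; split=> [|W [_ nW Wmax]]; first exact: fullsubP.
pose v : {linear subm U -> V} := \val.
have /imsubP[y Wy /val_inj ->] // : val x \in imsub v W.
apply: xW; split=> [y /imsubP[z _ ->]|UW|T WT TU].
- exact: valP.
- by apply: nW => z _; have /imsubP[t Wt /val_inj ->] := UW _ (valP z).
- case: (Wmax (presub v T)) => [z Wz|z _|TW|fT].
  + by apply/presubP/WT/imsubP; exists z.
  + exact: fullsubP.
  + left=> y Ty; apply/imsubP; exists (exist _ y (TU _ Ty) : subm U) => //.
    by apply: TW; apply/presubP.
  + by right=> y Uy; have /presubP := fT (exist _ y Uy : subm U) (fullsubP _).
Qed.

Lemma radsub_imsub V W (f : {linear V -> W}) (U : submodClosed V) x :
  x \in U -> injective f -> f x \in radsub (imsub f U) -> x \in radsub U.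
Proof.
move=> Ux fi /radsubP[_ xM]; apply/radsubP; split=> // M [MU nUM Mmax].
have /imsubP[y My /fi ->] // : f x \in imsub f M.
have im (T : submodClosed V) z : f z \in imsub f T -> z \in T by move=> /imsubP[y Ty /fi ->].
apply: xM; split=> [_ /imsubP[y My ->]|UM|T MT TU].
- by apply/imsubP; exists y => //; apply: MU.
- by apply: nUM => y Uy; apply: im; apply: UM; apply/imsubP; exists y.
- case: (Mmax (presub f T)) => [y My|y /presubP/TU/im //|TM|UT].
  + by apply/presubP/MT/imsubP; exists y.
  + left=> y Ty; have /imsubP[z Uz yE] := TU _ Ty.
    by apply/imsubP; exists z => //; apply: TM; apply/presubP; rewrite -yE.
  + by right=> _ /imsubP[z /UT/presubP Tz ->].
Qed.

Lemma simple_quom V (M : submodClosed V) : maximal_in (fullsub V) M -> simple (quom M).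
Proof.
move=> [_ nM Mmax]; split.
  apply: contrapT => n0; apply: nM => x _; apply/cls0; apply: contrapT => cx.
  by apply: n0; exists (cls M x); apply/eqP.
move=> U; case: (Mmax (presub (cls M) U)) => [x Mx|x _|UM|fU].
- by apply/presubP; rewrite /= (proj2 (cls0 M x) Mx) rpred0.
- exact: fullsubP.
- left=> q Uq; have [x xq] := cls_surj q; apply/zerosubP; rewrite -xq.
  by apply/cls0/UM/presubP; rewrite /= xq.
- by right=> q _; have [x <-] := cls_surj q; apply/presubP/fU/fullsubP.
Qed.

Lemma simple_maximal_ker V (L : lmodType A) (f : {linear V -> L}) :
  simple L -> (forall y, exists x, f x = y) -> maximal_in (fullsub V) (kersub f).
Proof.
move=> [[y0 y00] Lsub] fs; split=> [x _||T KT _]; first exact: fullsubP.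
  have [x xy] := fs y0 => fK; have /kersubP := fK x (fullsubP _); rewrite xy => y0E.
  by rewrite y0E eqxx in y00.
case: (Lsub (imsub f T)) => [T0|Tf].
  by left=> x Tx; apply/kersubP/zerosubP/T0/imsubP; exists x.
right=> x _; have /imsubP[t Tt xt] := Tf (f x) (fullsubP _).
by rewrite -(subrK t x) rpredD // KT //; apply/kersubP; rewrite linearB xt subrr.
Qed.

Lemma simple_surj V (L : lmodType A) (f : {linear V -> L}) :
  simple L -> (exists x, f x <> 0) -> forall y, exists x, f x = y.
Proof.
move=> [_ Lsub] [x fx] y; case: (Lsub (imsub f (fullsub V))) => [f0|ff].
  by case: fx; apply/zerosubP/f0; apply: imsub_full.
by have /imsubP[z _ ->] := ff y (fullsubP _); exists z.
Qed.

Lemma simple_inj (L V : lmodType A) (f : {linear L -> V}) :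
  simple L -> (exists x, f x <> 0) -> forall x, f x = 0 -> x = 0.
Proof.
move=> [_ Lsub] [x fx] y fy; case: (Lsub (kersub f)) => [K0|Kf].
  by apply/zerosubP/K0/kersubP.
by case: fx; apply/kersubP/Kf/fullsubP.
Qed.

Lemma schur (L L' : lmodType A) (f : {linear L -> L'}) :
  simple L -> simple L' -> (exists x, f x <> 0) -> bijective f.
Proof. by move=> sL sL' fx; apply: surj_inj_bij; [apply: simple_surj|apply: simple_inj]. Qed.

(** Vanishing radical, which is semisimplicity for finitely generated modules; in this form it
    passes at once to submodules and products. *)
Definition semisimple V := forall x : V, x \in radsub (fullsub V) -> x = 0.

Lemma semisimple_kill V W (f : {linear V -> W}) x :
  semisimple W -> x \in radsub (fullsub V) -> f x = 0.
Proof.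
move=> ssW Vx; apply: ssW; apply: (@radsub_hom A V W f) Vx => y _; exact: fullsubP.
Qed.

Lemma semisimple_inj V W (f : {linear V -> W}) :
  (forall x, f x = 0 -> x = 0) -> semisimple W -> semisimple V.
Proof. by move=> fi ssW x /(semisimple_kill f ssW)/fi. Qed.

Lemma semisimple_simple (L : lmodType A) : simple L -> semisimple L.
Proof.
move=> sL x /radsubP[_ /(_ (zerosub L)) H]; apply/zerosubP/H.
case: sL => -[y y0] Lsub; split=> [z _|fz|T _ _]; first exact: fullsubP.
  by have /zerosubP yE := fz y (fullsubP _); rewrite yE eqxx in y0.
exact: Lsub.
Qed.

Lemma semisimple_prod_family (J : Type) V (W : J -> lmodType A) (f : forall j, {linear V -> W j}) :
  (forall j, semisimple (W j)) -> (forall x, (forall j, f j x = 0) -> x = 0) -> semisimple V.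
Proof. by move=> ssW fi x rx; apply: fi => j; apply: semisimple_kill rx. Qed.

Lemma semisimple_quom V (R : submodClosed V) :
  (forall M, maximal_in (fullsub V) M -> subsub R M) ->
  (forall x, x \in radsub (fullsub V) -> x \in R) -> semisimple (quom R).
Proof.
move=> RM rR q; have [x <-] := cls_surj q => rx; apply/cls0/rR/radsubP.
split=> [|M Mmax]; first exact: fullsubP.
have [r rE] : exists r : {linear quom R -> quom M}, forall x, r (cls R x) = cls M x.
  apply: factor_surj => [z|z /cls0 Rz]; first exact: cls_surj.
  by apply/cls0; apply: RM.
by apply/cls0; rewrite -rE; apply: semisimple_kill rx; apply/semisimple_simple/simple_quom.
Qed.

Lemma semisimple_quo V : semisimple (quom (radsub (fullsub V))).
Proof. by apply: semisimple_quom => // M maxM x /radsubP[_]; apply. Qed.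

Lemma semisimple_subquo V (U : submodClosed V) : semisimple (subquo U (radsub U)).
Proof.
apply: semisimple_quom => [M maxM x /presubP/radsub_subm/radsubP[_]|x /radsub_subm Ux]; first exact.
by apply/presubP.
Qed.

Lemma semisimple_witness (V : fgmod A) (x : V) : semisimple V -> x <> 0 ->
  exists (L : fgmod A) (f : {linear V -> L}), [/\ simple L, forall y, exists z, f z = y & f x <> 0].
Proof.
move=> ssV x0.
have [M maxM Mx] : exists2 M, maximal_in (fullsub V) M & x \notin M.
  apply: contrapT => nM; apply/x0/ssV/radsubP; split=> [|M maxM]; first exact: fullsubP.
  by apply: contrapT => /negP Mx; apply: nM; exists M.
exists (fquo M), (cls M); split; first exact: simple_quom.
  exact: cls_surj.
by move=> /cls0; apply/negP.
Qed.

Lemma simple_quotient (V : fgmod A) : (exists x : V, x <> 0) ->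
  exists (L : fgmod A) (f : {linear V -> L}), simple L /\ forall y, exists z, f z = y.
Proof.
move=> [x x0]; have [|f0|M maxM _] := @maximal_above V (fullsub V) (zerosub V).
- by move=> y _; apply: fullsubP.
- by apply/x0/zerosubP/f0/fullsubP.
- by exists (fquo M), (cls M); split; [exact: simple_quom|exact: cls_surj].
Qed.

(* The complement of the kernel is a submodule minimal among those not contained in it. *)
Lemma semisimple_section (V : fgmod A) (L : lmodType A) (f : {linear V -> L}) :
  semisimple V -> simple L -> (forall y, exists x, f x = y) ->
  exists s : {linear L -> V}, forall x, f (s x) = x.
Proof.
move=> ssV sL fs; have [_ nK _] := simple_maximal_ker sL fs; set K := kersub f in nK.
have [T nTK Tmin] := @min_submod _ _ V (fun T => ~ subsub T K) (fullsub V) nK.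
pose v : {linear subm T -> V} := \val.
have TK0 y : y \in T -> y \in K -> y = 0.
  move=> Ty Ky; apply: ssV; apply/radsubP; split=> [|M [_ nM Mmax]]; first exact: fullsubP.
  have [TMK|nTM] := pselect (subsub (capsub T M) K); last first.
    have TM : subsub T (capsub T M) by apply: Tmin => // z /capsubP[].
    by have /capsubP[] := TM _ Ty.
  case: (Mmax (addsub M (capsub T K))) => [z Mz|z _|sM|fM].
  - by apply/addsubP; exists z, 0; rewrite ?addr0 // Mz rpred0.
  - exact: fullsubP.
  - by apply/sM/addsubP; exists 0, y; rewrite ?add0r //; split; [apply: rpred0|apply/capsubP].
  - case: nTK => t Tt; have /addsubP[m [s [Mm /capsubP[Ts Ks]] tE]] := fM t (fullsubP _).
    rewrite tE rpredD //; apply: TMK; apply/capsubP; split=> //.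
    by rewrite (_ : m = t - s) ?sub_rpredB // tE addrK.
have fi x : (f \o v) x = 0 -> x = 0.
  by move=> fx; apply/subm_val0/TK0; [apply: valP|apply/kersubP].
have fx : exists x, (f \o v) x <> 0.
  apply: contrapT => n; apply: nTK => x Tx; apply/kersubP; apply: contrapT => fx.
  by apply: n; exists (exist _ x Tx : subm T).
have [g [_ gK]] := lin_inverse (surj_inj_bij (simple_surj sL fx) fi).
by exists (v \o g) => x; apply: gK.
Qed.

(** A nonzero map reaches a simple quotient [L] of [W], where the surjection [V -> L] splits. The
    identity of [L] would then factor through a projective module, and [L] would be projective. *)
Lemma semisimple_stably_zero0 (V W : fgmod A) (f : {linear V -> W}) :
  no_projective_simple A -> semisimple V -> semisimple W -> stably_zero f -> forall x, f x = 0.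
Proof.
move=> npA ssV ssW sf x; apply: contrapT => fx.
have [L [g [sL gs gfx]]] := semisimple_witness ssW fx.
have hs : forall y, exists z, (g \o f) z = y by apply: simple_surj => //; exists x.
have [s sE] := semisimple_section ssV sL hs.
apply: (npA L sL); apply: stably_zero_id_projective.
apply: (stably_zero_ext (f := (g \o f) \o s)); first exact: sE.
by apply: stably_zero_compl; apply: stably_zero_compr.
Qed.

Lemma rk_inj (V W : fgmod A) (f : {linear W -> V}) :
  injective f -> (rk (fullsub W) <= rk (imsub f (fullsub W)))%N.
Proof.
move=> fi; have /asboolP[v [_ vI]] := rkP (fullsub W).
apply: rk_max; apply/asboolP; exists (fun i => f (v i)); split=> [i|c c0]; first exact: imsub_full.
apply: vI; apply: fi; rewrite linear0 -[RHS]c0 linear_sum.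
by apply: eq_bigr => i _; rewrite linearZ.
Qed.

(** [P] is chosen of least dimension among the projectives mapping onto [V]. If [U] maps onto [V], a
    map [P -> U] over [V] gives an endomorphism of [P] whose Fitting image is again projective and
    onto [V]; by minimality it is all of [P], and it lies in [U]. *)
Lemma projective_cover_exists (V : fgmod A) :
  exists (P : fgmod A) (p : {linear P -> V}), projective_cover p.
Proof.
pose Q n := `[< exists (P : fgmod A) (p : {linear P -> V}),
  [/\ projective P, forall y, exists x, p x = y & rk (fullsub P) = n] >].
have exQ : exists n, Q n.
  have [P [p [projP ps _ _]]] := free_cover V.
  by exists (rk (fullsub P)); apply/asboolP; exists P, p.
case: (ex_minnP exQ) => n /asboolP[P [p [projP ps rP]]] nmin.
exists P, p; split=> // U Us.
pose v : {linear fsub U -> P} := \val.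
have [y|g gE] := projP (fsub U) V (p \o v) p.
  by have [x Ux <-] := Us y; exists (exist _ x Ux : fsub U).
pose f := v \o g.
have [[|m] [W [i [h [t [// _ ii hE ht hi]]]]]] := fitting_summand f.
have pf j x : p (iter j f x) = p x by elim: j => //= j <-; apply: gE.
have QW : Q (rk (fullsub W)).
  apply/asboolP; exists W, (p \o i); split=> // [|y].
    apply: (projective_retract (i := i) (p := t \o h) _ projP) => w; exact: ht.
  by have [x <-] := ps y; exists (h x); rewrite /= hE pf.
have fi : subsub (fullsub P) (imsub i (fullsub W)).
  apply: rk_eq => [x _|]; first exact: fullsubP.
  by rewrite rP (leq_trans (nmin _ QW)) // rk_inj.
move=> x _; have /imsubP[w _ ->] := fi x (fullsubP _).
by rewrite -(hi w) hE; exact: valP.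
Qed.

Lemma cover_lift_surj (P V Y : fgmod A) (p : {linear P -> V}) (g : {linear Y -> P}) :
  projective_cover p -> (forall y, exists x, p (g x) = y) -> forall y, exists x, g x = y.
Proof.
move=> [_ _ pU] gs y.
have /imsubP[x _ ->] : y \in imsub g (fullsub Y); last by exists x.
by apply: pU (fullsubP y) => z; have [x xz] := gs z; exists (g x) => //; apply: imsub_full.
Qed.

Lemma projective_cover_ker (P V : fgmod A) (p : {linear P -> V}) x :
  projective_cover p -> semisimple V -> x \in radsub (fullsub P) <-> p x = 0.
Proof.
move=> [projP ps pU] ssV; split=> [|px]; first exact: semisimple_kill.
apply/radsubP; split=> [|M [_ nM Mmax]]; first exact: fullsubP.
case: (Mmax (addsub M (kersub p))) => [y My|y _|KM|fK].
- by apply/addsubP; exists y, 0; rewrite ?addr0 // My rpred0.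
- exact: fullsubP.
- apply/KM/addsubP; exists 0, x; rewrite ?add0r //; split; first exact: rpred0.
  exact/kersubP.
- case: nM; apply: pU => y; have [z zy] := ps y.
  have /addsubP[m [z' [Mm /kersubP pz'] zE]] := fK z (fullsubP _).
  by exists m => //; rewrite -zy zE linearD pz' addr0.
Qed.

(** Lift [F -> Q -> N] to a projective cover [P] of [N]: the lift is onto, hence splits, and makes
    [P] a projective summand of [F]. *)
Lemma stably_zero_surj0 (F N : fgmod A) (f : {linear F -> N}) :
  no_proj_retract F -> stably_zero f -> (forall y, exists x, f x = y) -> forall y : N, y = 0.
Proof.
move=> nF [Q [projQ [u [v uv]]]] fs.
have [P [p pcov]] := projective_cover_exists N; have [projP ps _] := pcov.
have [w wE] := projQ P N p v ps.
have [y|s sE] := projective_section (q := w \o u) projP.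
  apply: (cover_lift_surj (g := w \o u) pcov) => z; have [x <-] := fs z.
  by exists x; rewrite /= wE uv.
have P0 := nF P s (w \o u) projP sE.
by move=> y; have [x <-] := ps y; rewrite (P0 x) linear0.
Qed.

Lemma stably_zero_to_semisimple0 (F V : fgmod A) (f : {linear F -> V}) :
  no_proj_retract F -> semisimple V -> stably_zero f -> forall x, f x = 0.
Proof.
move=> nF ssV sf x; apply: contrapT => fx.
have [L [g [sL _ gfx]]] := semisimple_witness ssV fx.
have [[y /eqP y0] _] := sL; apply: y0; apply: (stably_zero_surj0 (f := g \o f) nF).
  exact: stably_zero_compr.
by apply: simple_surj => //; exists x.
Qed.

(** A projective summand [P] of [rad U] is injective, so it splits off [U]. The splitting maps
    [rad U] into [rad P], whence [P = rad P] and [P = 0]. *)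
Lemma no_proj_retract_rad (V : fgmod A) (U : submodClosed V) :
  self_injective A -> no_proj_retract (subm (radsub U)).
Proof.
move=> sA P i p projP pi.
pose w : {linear fsub (radsub U) -> fsub U} := subm_map (f := idfun) (@radsub_sub V U).
have wi : injective (w \o i).
  by move=> x y wxy; rewrite -[x]pi -[y]pi; congr (p _); apply: val_inj; apply: (congr1 val wxy).
have injP : injmodule P := projective_injective sA projP.
have [r rE] := injP P (fsub U) (w \o i) idfun wi.
have P0 : subsub (fullsub P) (radsub (fullsub P)).
  move=> x _; have <- : r (w (i x)) = x by exact: rE.
  have : w (i x) \in radsub (fullsub (fsub U)) by apply/radsub_subm; apply: (valP (i x)).
  by apply: radsub_hom => y _; apply: fullsubP.
by move=> x; apply/zerosubP/(radsub_full0 P0)/fullsubP.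
Qed.

Lemma dsum_reindex (J J' : finType) V (W : J -> lmodType A) (inj : forall j, {linear W j -> V})
    (h : J' -> J) : bijective h -> is_dsum inj -> is_dsum (fun j => inj (h j)).
Proof.
move=> hb [pr [prK pr0 prS]]; exists (fun j => pr (h j)); split=> // [i j x ij|x].
  by apply: pr0; rewrite (bij_eq hb).
by rewrite [LHS]prS (reindex h) //=; case: hb => h' ? ?; exists h'.
Qed.

Lemma dsum_iso (J : finType) V V' (W W' : J -> lmodType A) (inj : forall j, {linear W j -> V})
    (f : forall j, {linear W' j -> W j}) (g : {linear V -> V'}) :
  (forall j, bijective (f j)) -> bijective g -> is_dsum inj ->
  is_dsum (fun j => g \o inj j \o f j : {linear W' j -> V'}).
Proof.
move=> fb gb [pr [prK pr0 prS]]; have [g' [g1 g2]] := lin_inverse gb.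
have /all_tag[f' f'P] j : {f' : {linear W j -> W' j} | cancel (f j) f' /\ cancel f' (f j)}.
  exact: cid (lin_inverse (fb j)).
exists (fun j => f' j \o pr j \o g'); split=> [j x|i j x ij|x] /=.
- by rewrite g1 prK (proj1 (f'P j)).
- by rewrite g1 (pr0 _ _ _ ij) linear0.
- rewrite -[LHS]g2 {1}[g' x]prS linear_sum; apply: eq_bigr => j _ /=.
  by rewrite (proj2 (f'P j)).
Qed.

Lemma dsum_section (I J : finType) V (S : I -> lmodType A) (i : I) (c : J -> I)
    (f : {linear V -> S i}) (s : {linear S i -> V})
    (inj : forall j, {linear S (c j) -> subm (kersub f)}) :
  (forall x, f (s x) = x) -> is_dsum inj ->
  exists inj' : forall o, {linear S (oapp c i o) -> V}, is_dsum inj'.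
Proof.
move=> fs [pr [prK pr0 prS]]; set K := kersub f in inj pr prK pr0 prS.
pose v : {linear subm K -> V} := \val.
have fv x : f (v x) = 0 by apply/kersubP; apply: valP.
have [q qE] : exists q : {linear V -> subm K}, forall x, v (q x) = x - s (f x).
  apply: (@corestrict _ _ _ (idfun \- (s \o f)) K) => x.
  by apply/kersubP; rewrite linearB /= fs subrr.
have vi : injective v by exact: val_inj.
pose inj' o : {linear S (oapp c i o) -> V} :=
  match o with Some j => v \o inj j | None => s end.
pose pr' o : {linear V -> S (oapp c i o)} :=
  match o with Some j => pr j \o q | None => f end.
have qs x : q (s x) = 0 by apply: vi; rewrite qE fs subrr linear0.
have qv x : q (v x) = x by apply: vi; rewrite qE fv linear0 subr0.
exists inj', pr'; split.
- by case=> [j|] x /=; rewrite ?qv ?prK ?fs.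
- by case=> [j|] [j'|] x //= ij; rewrite ?fv // ?qs ?linear0 // qv pr0.
- move=> x; rewrite (bigD1 None) //= (reindex_omap Some id) /=; last by case.
  rewrite (eq_bigl xpredT) => [|j]; last by rewrite eqxx.
  rewrite -[X in X = _](subrK (s (f x))) addrC -qE [q x in LHS]prS linear_sum.
  by congr (_ + _).
Qed.

Lemma semisimple_dsum (I : finType) (L : I -> fgmod A) (V : fgmod A) :
  simple_representatives L -> semisimple V ->
  exists (J : finType) (c : J -> I) (inj : forall j, {linear L (c j) -> V}), is_dsum inj.
Proof.
move=> [sL _ Lall]; have [n] := ubnP (rk (fullsub V)); elim: n V => // n IHn V Vn ssV.
have [[x x0]|V0] := pselect (exists x : V, x <> 0); last first.
  exists 'I_0, (fun o : 'I_0 => match o with Ordinal _ h => False_rect _ (notF h) end).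
  exists (fun o => \0), (fun o => \0); split=> [[]//|[]//|x]; rewrite big_ord0.
  by apply: contrapT => x0; apply: V0; exists x.
have [L' [f' [sL' f's _]]] := semisimple_witness ssV x0.
have [i [g gb]] := Lall L' sL'.
pose f : {linear V -> L i} := g \o f'.
have fs y : exists x, f x = y.
  have [g' _ g2] := gb; have [z zE] := f's (g' y); exists z.
  by rewrite /= zE g2.
have [s sE] := semisimple_section ssV (sL i) fs.
have [_ nK _] := simple_maximal_ker (sL i) fs.
have [||J [c [inj injP]]] := IHn (fsub (kersub f)).
- rewrite ltnS in Vn; apply: leq_trans Vn; rewrite ltnNge; apply/negP => le.
  case: nK => y _; pose v : {linear fsub (kersub f) -> V} := \val.
  have vi : injective v by exact: val_inj.
  have /imsubP[z _ ->] : y \in imsub v (fullsub _).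
    apply: rk_eq (fullsubP y) => [z _|]; first exact: fullsubP.
    exact: leq_trans le (rk_inj vi).
  exact: valP.
- by apply: semisimple_inj ssV => y; apply: (subm_val0 (x := y)).
have [inj' inj'P] := dsum_section (S := L) sE injP.
by exists (option J), (oapp c i), inj'.
Qed.
End Radicals.

(** * The functor X (x)_B - *)

Lemma equivalence_full_faithful (C D : cat) (F : functor C D) : is_equivalence F ->
  (forall (M N : C) (f g : mor M N), fmor F f = fmor F g -> f = g) /\
  (forall (M N : C) (h : mor (F M) (F N)), exists f, fmor F f = h).
Proof.
move=> [G [[eta [eta_iso etaN]] [eps [eps_iso epsN]]]].
have Ffaithful M N (f g : mor M N) : fmor F f = fmor F g -> f = g.
  move=> Ffg; have [th [_ th2]] := eta_iso M; have [th' [th3 _]] := eta_iso M.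
  have : compm f (eta M) = compm g (eta M) by rewrite -!etaN /= Ffg.
  move/(congr1 (fun h => compm h th')); rewrite -!compmA th3.
  by rewrite ![compm _ (idm _)]compm1.
have Gfaithful M N (f g : mor M N) : fmor G f = fmor G g -> f = g.
  move=> Gfg; have [th' [th3 _]] := eps_iso M.
  have : compm f (eps M) = compm g (eps M) by rewrite -!epsN /= Gfg.
  move/(congr1 (fun h => compm h th')); rewrite -!compmA th3.
  by rewrite ![compm _ (idm _)]compm1.
split=> // M N h; have [th [th1 th2]] := eta_iso M.
exists (compm (eta N) (compm (fmor G h) th)); apply: Gfaithful.
have [th' [_ th4]] := eta_iso N.
have : compm (eta N) (fmor G (fmor F (compm (eta N) (compm (fmor G h) th)))) =
       compm (eta N) (fmor G h).
  have := etaN _ _ (compm (eta N) (compm (fmor G h) th)); rewrite /= => ->.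
  by rewrite -!compmA [compm th _]th2 compm1.
move/(congr1 (fun h => compm th' h)); rewrite !compmA th4.
by rewrite ![compm (idm _) _]comp1m.
Qed.

Section Tensoring.
Context {k : fieldType} {A B : falgType k} (X : bimod A B).
Local Notation T f := (@tensor_map k A B X _ _ f).

Lemma T_id (M : lmodType B) x : T (idfun : {linear M -> M}) x = x.
Proof. exact: tensor_map_id. Qed.

Lemma T_comp (L M N : lmodType B) (f : {linear M -> N}) (g : {linear L -> M}) x :
  T (f \o g) x = T f (T g x).
Proof. exact: tensor_map_comp. Qed.

Lemma T_ext (M N : lmodType B) (f g : {linear M -> N}) : f =1 g -> T f =1 T g.
Proof. by move=> fg; apply: tensor_ext => x m; rewrite !tensor_mapE fg. Qed.

Lemma T_comp_ext (L M N : lmodType B) (f : {linear M -> N}) (g : {linear L -> M})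
    (h : {linear L -> N}) x : (forall y, f (g y) = h y) -> T f (T g x) = T h x.
Proof. by move=> fgh; rewrite -T_comp; apply: T_ext. Qed.

Lemma T_sub (M N : lmodType B) (f g : {linear M -> N}) x : T (f \- g) x = T f x - T g x.
Proof. exact: (@tensor_mapB _ _ _ X M N f g x). Qed.

Lemma T_zero (M N : lmodType B) x : T (\0 : {linear M -> N}) x = 0.
Proof.
have e : T (idfun \- idfun : {linear N -> N}) (T (\0 : {linear M -> N}) x) = 0.
  by rewrite T_sub subrr.
by rewrite -[RHS]e -T_comp; apply: T_ext => y /=; rewrite subrr.
Qed.

Lemma T_eq0 (M N : lmodType B) (f : {linear M -> N}) x : (forall y, f y = 0) -> T f x = 0.
Proof. by move=> f0; rewrite -[RHS](T_zero N x); apply: T_ext. Qed.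

Lemma T_opp (M N : lmodType B) (f : {linear M -> N}) x : T (\- f) x = - T f x.
Proof.
rewrite -[RHS]sub0r -[X in X - _](T_zero N x) -T_sub; apply: T_ext => y /=.
by rewrite sub0r.
Qed.

Lemma T_add (M N : lmodType B) (f g : {linear M -> N}) x : T (f \+ g) x = T f x + T g x.
Proof.
rewrite -[T g x]opprK -T_opp -T_sub; apply: T_ext => y /=.
by rewrite opprK.
Qed.

Hypothesis Xexact : tensor_exact X.

Lemma ses_ker (M N : fgmod B) (f : {linear M -> N}) :
  (forall y, exists x, f x = y) -> ses (\val : {linear fsub (kersub f) -> M}) f.
Proof.
move=> fs; split=> //; first exact: val_inj.
move=> y; split=> [/kersubP Ky|[x ->]]; first by exists (exist _ y Ky).
by apply/kersubP; apply: valP.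
Qed.

Lemma T_surj (M N : fgmod B) (f : {linear M -> N}) :
  (forall y, exists x, f x = y) -> forall y, exists x, T f x = y.
Proof. by move=> /ses_ker/Xexact[]. Qed.

Lemma T_inj (M N : fgmod B) (f : {linear M -> N}) : injective f -> injective (T f).
Proof.
move=> fi; have [] // : ses (T f) (T (cls (imsub f (fullsub M)) : {linear N -> fquo _})).
apply: Xexact; split=> // [|y]; first exact: cls_surj.
split=> [/cls0/imsubP[x _ ->]|[x ->]]; first by exists x.
exact/cls0/imsub_full.
Qed.

Lemma T_exact (L M N : fgmod B) (u : {linear L -> M}) (v : {linear M -> N}) :
  (forall y, v y = 0 <-> exists x, y = u x) ->
  forall y, T v y = 0 <-> exists x, y = T u x.
Proof.
move=> uv y; split=> [vy|[x ->]]; last first.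
  by rewrite -T_comp; apply: T_eq0 => z /=; apply/uv; exists z.
pose i : {linear fsub (imsub v (fullsub M)) -> N} := \val.
have [w wE] := corestrict (@imsub_full _ _ _ v).
have ws z : exists x, w x = z.
  by have /imsubP[x _ zE] := valP z; exists x; apply: val_inj; rewrite wE.
have [_ _ ex] := Xexact (ses_ker (N := fsub (imsub v (fullsub M))) ws).
have : T w y = 0.
  apply: (T_inj (f := i)); first exact: val_inj.
  by rewrite linear0 (T_comp_ext (h := v)).
move=> /ex[x ->]; pose j : {linear fsub (kersub w) -> M} := \val.
have [c cE] : exists c : {linear L -> fsub (kersub w)}, forall x, val (c x) = u x.
  apply: corestrict => l; apply/kersubP/val_inj; rewrite wE; apply/uv; by exists l.
have [|x' <-] := T_surj (f := c) _ x; last by exists x'; apply: T_comp_ext.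
move=> z; have /kersubP/(congr1 val) := valP z; rewrite wE => /uv[l lE].
by exists l; apply: val_inj; rewrite cE.
Qed.

Lemma T_ker (M N : fgmod B) (f : {linear M -> N}) y :
  T f y = 0 <-> exists x, y = T (\val : {linear subm (kersub f) -> M}) x.
Proof.
apply: (T_exact (u := \val : {linear fsub (kersub f) -> M})) => z.
split=> [/kersubP Kz|[x ->]]; first by exists (exist _ z Kz).
by apply/kersubP; apply: valP.
Qed.

Lemma T_cls (M : fgmod B) (U : submodClosed M) y :
  T (cls U) y = 0 <-> exists x, y = T (\val : {linear subm U -> M}) x.
Proof.
apply: (T_exact (L := fsub U) (M := M) (N := fquo U)) => z.
split=> [/cls0 Uz|[x ->]]; first by exists (exist _ z Uz).
by apply/cls0; apply: valP.
Qed.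

Hypothesis Xproj : preserves_projectives X.
Hypothesis Xfull : forall (M N : fgmod B) (f : {linear tensor X M -> tensor X N}),
  exists g : {linear M -> N}, stably_zero (f \- T g).
Hypothesis Xfaith : forall (M N : fgmod B) (g : {linear M -> N}), stably_zero (T g) -> stably_zero g.
Hypothesis npB : no_projective_simple B.

(** If [X (x) M] vanishes and [M] does not, then [X (x) L] vanishes for a simple quotient [L] of
    [M]; the identity of [L] is then stably trivial and [L] is projective. *)
Lemma T_obj0 (M : fgmod B) : (forall x : tensor X M, x = 0) -> forall x : M, x = 0.
Proof.
move=> M0 x; apply: contrapT => x0.
have [L [f [sL fs]]] : exists (L : fgmod B) (f : {linear M -> L}),
    simple L /\ forall y, exists z, f z = y by apply: simple_quotient; exists x.
apply: (npB sL); apply: stably_zero_id_projective; apply: Xfaith.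
apply: (stably_zero_ext (f := \0)); last exact: stably_zero0.
by move=> y; have [z <-] := T_surj fs y; rewrite T_id (M0 z) !linear0.
Qed.

Lemma T_reflect0 (M N : fgmod B) (f : {linear M -> N}) :
  (forall x, T f x = 0) -> forall x, f x = 0.
Proof.
move=> f0 x; have [w wE] := corestrict (@imsub_full _ _ _ f).
pose i : {linear fsub (imsub f (fullsub M)) -> N} := \val.
rewrite -wE (@T_obj0 (fsub (imsub f (fullsub M))) _ (w x)) // => y.
have [|z <-] := T_surj (N := fsub (imsub f (fullsub M))) (f := w) _ y.
  by move=> z; have /imsubP[t _ zE] := valP z; exists t; apply: val_inj; rewrite wE.
apply: (T_inj (f := i)); first exact: val_inj.
by rewrite linear0 (T_comp_ext (h := f)) // f0.
Qed.

Lemma T_reflect_inj (M N : fgmod B) (f : {linear M -> N}) :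
  (forall x, T f x = 0 -> x = 0) -> forall x, f x = 0 -> x = 0.
Proof.
move=> fi x /kersubP Kx; pose v : {linear fsub (kersub f) -> M} := \val.
apply: (T_reflect0 (f := v) _ (exist _ x Kx)) => z; apply: fi.
by rewrite -T_comp; apply: T_eq0 => y /=; apply/kersubP; apply: valP.
Qed.

(* f and f' come stably from B-linear maps g and g'. Since R has no projective summand, g g' is
   invertible, so g is surjective and (X (x) g) f' is a surjective endomorphism. *)
Lemma no_proj_retract_reflect (F R : fgmod B) (f : {linear tensor X F -> tensor X R})
    (f' : {linear tensor X R -> tensor X F}) :
  no_proj_retract R -> stably_zero (f \o f' \- idfun) -> (forall y, exists x, f' x = y) ->
  (forall x, f' x = 0 -> x = 0) /\ exists g : {linear F -> R}, bijective g.
Proof.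
move=> nR ff' f's; have [g gE] := Xfull f; have [g' g'E] := Xfull f'.
have sgg : stably_zero (g \o g' \- idfun).
  apply: Xfaith.
  (* The map given here equals [T g \o T g' - id]: the errors of [f] and of [f'] are taken out one
     after the other. *)
  apply: (stably_zero_ext (f := (f \o f' \- idfun) \- ((f \- T g) \o f' \+ (T g \o (f' \- T g'))))).
    move=> x; rewrite T_sub T_id T_comp.
    rewrite -[LHS]/(f (f' x) - x - (f (f' x) - T g (f' x) + T g (f' x - T g' x))).
    by rewrite linearB subrKA opprB addrC subrKA.
  by apply: stably_zero_sub ff' _; apply: stably_zero_add; [apply: stably_zero_compl|apply: stably_zero_compr].
have [h _ hK] := no_proj_retract_stably_zero_bij nR sgg.
have gs y : exists x, g x = y by exists (g' (h y)); rewrite -[RHS]hK /= addrC subrK.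
have fi' x : f' x = 0 -> x = 0.
  move=> f'x; apply: (surj_endo_inj (V := tensfg X R) (f := T g \o f')) => [y|].
    by have [z <-] := T_surj gs y; have [w <-] := f's z; exists w.
  exact: etrans (congr1 (T g) f'x) (linear0 _).
split=> //; exists g; apply: surj_inj_bij => //; apply: T_reflect_inj => y.
have [x <-] := f's y => Tgx.
by rewrite (surj_endo_inj (V := tensfg X R) (f := T g \o f') _ Tgx) ?linear0 // => z;
  have [t <-] := T_surj gs z; have [w <-] := f's t; exists w.
Qed.
End Tensoring.

Section Extensions.
Context {k : fieldType} {A B : falgType k} (X : bimod A B).
Local Notation T f := (@tensor_map k A B X _ _ f).
Context (Xexact : tensor_exact X) (Xproj : preserves_projectives X).
Context (Xfull : forall (M N : fgmod B) (f : {linear tensor X M -> tensor X N}),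
  exists g : {linear M -> N}, stably_zero (f \- T g)).
Context (saA : self_injective A).

(* Ext^1 is computed by stable maps out of a syzygy, hence preserved by X; since projectives
   over A are injective, the stable map can be lifted to a genuine map of extensions. *)
Lemma lift_extension (N : fgmod A) (K V : fgmod B) (a : {linear tensor X K -> N})
    (b : {linear N -> tensor X V}) : ses a b ->
  exists (E : fgmod B) (u : {linear K -> E}) (v : {linear E -> V}) (h : {linear tensor X E -> N}),
  [/\ ses u v, bijective h, forall x, h (T u x) = a x & forall x, b (h x) = T v x].
Proof.
move=> [ai bs ab]; have [P [p [projP ps _ _]]] := free_cover V.
pose O := fsub (kersub p); pose w : {linear O -> P} := \val.
have pw x : p (w x) = 0 by apply/kersubP; apply: valP.
have wi : injective w by exact: val_inj.
have projXP : projective (tensfg X P) by apply: Xproj.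
(* [c] lifts the projection [T p] to [N]; its restriction [d] to the syzygy represents the class of
   the extension. *)
have [c cE] := projXP N (tensfg X V) b (T p) bs.
have [x|d dE] := factor_inj (f := c \o T w) ai.
  have [|y yE] := proj1 (ab (c (T w x))); last by exists y; rewrite -yE.
  by rewrite cE -T_comp; apply: T_eq0 => y; apply: pw.
have [g [Q [projQ [r [s rs]]]]] := Xfull d.
have rsE y : s (r y) = d y - T g y by rewrite -rs.
have injQ : injmodule Q := projective_injective saA projQ.
(* [d] and [T g] differ by [s \o r], which passes through the injective module [Q]. Extending [r] to
   [X (x) P] allows [c] to be changed so that its restriction becomes [a \o T g]. *)
have [r' r'E] := injQ (tensfg X O) (tensfg X P) (T w) r (T_inj Xexact wi).
pose c' : {linear tensor X P -> N} := c \- (a \o (s \o r')).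
have c'w x : c' (T w x) = a (T g x).
  rewrite -[LHS]/(c (T w x) - a (s (r' (T w x)))) r'E -[c _]/((c \o T w) x) -dE.
  by rewrite -linearB (rsE x); congr (a _); rewrite opprB addrC subrK.
have ba y : b (a y) = 0 by apply/ab; exists y.
have c'b x : b (c' x) = T p x.
  by rewrite -[c' x]/(c x - a (s (r' x))) linearB ba subr0 cE.
(* [E] is the pushout of [K] and [P] over the syzygy, along [g] and [w]. *)
pose m : {linear O -> prodfg K P} := lpair g (\- w).
pose D := imsub m (fullsub O); pose E := fquo D.
pose cl : {linear prodfg K P -> E} := cls D.
have cls_s : forall y, exists x, cl x = y by exact: cls_surj.
have clm x : cl (m x) = 0 by apply/cls0; apply: imsub_full.
pose u : {linear K -> E} := cl \o linl K P.
have [v vE] : exists v : {linear E -> V}, forall x, v (cl x) = p x.2.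
  apply: (factor_surj (p := cl) (q := p \o snd)); first exact: cls_s.
  move=> x /cls0/imsubP[z _ ->] /=.
  by rewrite linearN pw oppr0.
pose e : {linear tensor X (prodfg K P) -> N} :=
  (a \o T (fst : {linear prodfg K P -> K})) \+ (c' \o T (snd : {linear prodfg K P -> P})).
have eE x : e x = a (T (fst : {linear prodfg K P -> K}) x)
    + c' (T (snd : {linear prodfg K P -> P}) x) by [].
have [y|x clx|h hE] := factor_surj (p := T cl) (q := e).
- exact: (T_surj Xexact cls_s).
- have [z ->] : exists z, x = T m z.
    apply/(T_exact Xexact (v := cl) _ x) => // y; split=> [/cls0/imsubP[z _ ->]|[z ->]] //.
    by exists z.
  rewrite eE (T_comp_ext _ (h := g)) // (T_comp_ext _ (h := \- w)) //.
  by rewrite T_opp linearN c'w subrr.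
have hu x : h (T u x) = a x.
  rewrite T_comp hE eE (T_comp_ext _ (h := idfun)) // T_id -[T snd _]T_comp.
  by rewrite [T (snd \o _) _]T_eq0 // linear0 addr0.
have hv x : b (h x) = T v x.
  have [y <-] := T_surj Xexact cls_s x; rewrite hE eE linearD ba add0r c'b.
  by rewrite (T_comp_ext _ (h := p \o snd)) // (T_comp_ext _ (h := p \o snd)).
have uvE : ses u v.
  split=> [|y|y].
  - apply: lin_inj => x /cls0/imsubP[z _ /pair_equal_spec[/= xE /esym/eqP]].
    by rewrite oppr_eq0 => /eqP wz; rewrite xE (inj_lin0 wi wz) linear0.
  - by have [x <-] := ps y; exists (cl (0, x)); rewrite vE.
  - split=> [|[x ->]]; last by rewrite vE /= linear0.
    have [[x t] <-] := cls_s y; rewrite vE /= => /kersubP pt.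
    exists (x + g (exist _ t pt : O)); apply/clsP/imsubP.
    exists (- (exist _ t pt : O)); first exact: fullsubP.
    rewrite linearN; apply/pair_equal_spec; rewrite /= opprK subr0; split=> //.
    by rewrite opprD addNKr.
exists E, u, v, h; split=> //; have [ui vs uv] := uvE.
apply: surj_inj_bij => [n|x hx].
  have [y yE] := T_surj Xexact vs (b n).
  have [|z zE] := proj1 (ab (n - h y)); first by rewrite linearB hv yE subrr.
  by exists (T u z + y); rewrite linearD hu -zE subrK.
have [|y yE] := proj1 (T_exact Xexact uv x); first by rewrite -hv hx linear0.
rewrite yE (_ : y = 0) ?linear0 //; apply: (inj_lin0 ai).
by rewrite -hu -yE.
Qed.
End Extensions.

(** * Finite products, bases over [k] and the dual of [B] *)

Definition dprod (k : fieldType) (A : falgType k) (J : finType) (W : J -> lmodType A) : Type := forall j, W j.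

Section DependentProduct.
Context {k : fieldType} {A : falgType k} (J : finType) (W : J -> lmodType A).
HB.instance Definition _ := gen_eqMixin (dprod W).
HB.instance Definition _ := gen_choiceMixin (dprod W).

Lemma dprodP (f g : dprod W) : (forall j, f j = g j) -> f = g.
Proof. exact: functional_extensionality_dep. Qed.

Definition dprod_add (f g : dprod W) : dprod W := fun j => f j + g j.
Definition dprod_opp (f : dprod W) : dprod W := fun j => - f j.
Definition dprod_scale (a : A) (f : dprod W) : dprod W := fun j => a *: f j.
Lemma dprod_addA : associative dprod_add.
Proof. by move=> f g h; apply: dprodP => j; apply: addrA. Qed.
Lemma dprod_addC : commutative dprod_add.
Proof. by move=> f g; apply: dprodP => j; apply: addrC. Qed.
Lemma dprod_add0 : left_id ((fun=> 0) : dprod W) dprod_add.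
Proof. by move=> f; apply: dprodP => j; apply: add0r. Qed.
Lemma dprod_addN : left_inverse ((fun=> 0) : dprod W) dprod_opp dprod_add.
Proof. by move=> f; apply: dprodP => j; apply: addNr. Qed.
HB.instance Definition _ := GRing.isZmodule.Build (dprod W) dprod_addA dprod_addC dprod_add0 dprod_addN.
Lemma dprod_scaleA a b f : dprod_scale a (dprod_scale b f) = dprod_scale (a * b) f.
Proof. by apply: dprodP => j; apply: scalerA. Qed.
Lemma dprod_scale1 : left_id 1 dprod_scale.
Proof. by move=> f; apply: dprodP => j; apply: scale1r. Qed.
Lemma dprod_scaleDr : right_distributive dprod_scale +%R.
Proof. by move=> a f g; apply: dprodP => j; apply: scalerDr. Qed.
Lemma dprod_scaleDl f : {morph dprod_scale^~ f : a b / a + b}.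
Proof. by move=> a b; apply: dprodP => j; apply: scalerDl. Qed.
HB.instance Definition _ := GRing.Zmodule_isLmodule.Build A (dprod W)
  dprod_scaleA dprod_scale1 dprod_scaleDr dprod_scaleDl.

Lemma dpr_linear j : linear (fun f : dprod W => f j).
Proof. by []. Qed.
Definition dpr j : {linear dprod W -> W j} := mklin (@dpr_linear j).

Lemma din_linear j : linear (fun x : W j => dfwith (fun i => 0 : W i) x : dprod W).
Proof.
move=> a x y; apply: dprodP => i; rewrite -[RHS]/(a *: dfwith _ x i + dfwith _ y i).
have [<-|ij] := eqVneq j i; first by rewrite !dfwith_in.
by rewrite !dfwith_out // scaler0 addr0.
Qed.
Definition din j : {linear W j -> dprod W} := mklin (@din_linear j).

Lemma din_dsum : is_dsum din.
Proof.
exists dpr; split=> [j x|i j x ij|f]; [exact: dfwith_in|exact: dfwith_out|].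
apply: dprodP => j; rewrite -[RHS]/(dpr j _) linear_sum (bigD1 j) //= big1 ?addr0 => [|i ij].
  by rewrite dfwith_in.
by rewrite dfwith_out.
Qed.
End DependentProduct.

Section FinDsum.
Context {k : fieldType} {A : falgType k}.

Lemma fingen_dsum (J : finType) (V : lmodType A) (W : J -> fgmod A)
    (inj : forall j, {linear W j -> V}) : is_dsum inj -> fingen V.
Proof.
move=> [pr [_ _ prS]].
have /all_tag[s sP] j : {s : seq (W j) | forall x, x \in combsub s}.
  exact: cid (proj1 (fingenP _) (fgmodP (W j))).
apply/fingenP; exists (flatten [seq map (inj j) (s j) | j <- enum J]) => x.
rewrite [x]prS rpred_sum // => j _; apply/presubP.
apply: (@combsub_least _ _ _ (s j)) (sP j _) => y sy; apply/presubP/combsub_mem/flattenP.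
by exists (map (inj j) (s j)); [apply/mapP; exists j; rewrite ?mem_enum|apply: map_f].
Qed.

Definition dprodfg (J : finType) (W : J -> fgmod A) :=
  FgMod (fingen_dsum (@din_dsum k A J W)).

Lemma kbasis (V : fgmod A) : exists n (e : 'I_n -> V) (mu : 'I_n -> V -> k),
  [/\ forall v, v = \sum_m ((mu m v)%:A : A) *: e m,
      forall m a v w, mu m ((a%:A : A) *: v + w) = a * mu m v + mu m w &
      forall m l, mu m (e l) = (l == m)%:R].
Proof.
have /asboolP[e [_ eI]] := rkP (fullsub V).
have eV := kspan_rank (fun=> fullsubP _) eI erefl.
have [mu muE] := choice (fun v => eV v (fullsubP v)).
have uniq c d : \sum_m ((c m)%:A : A) *: e m = \sum_m ((d m)%:A : A) *: e m -> c =1 d.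
  move=> /eqP; rewrite -subr_eq0 -sumrB => /eqP S0 m; apply/eqP; rewrite -subr_eq0; apply/eqP.
  apply: (eI (fun m => c m - d m)); rewrite -[RHS]S0; apply: eq_bigr => i _.
  by rewrite !scalerBl.
exists (rk (fullsub V)), e, (fun m v => mu v m); split=> // [m a v w|m l].
  apply: (uniq (mu _) (fun m => a * mu v m + mu w m)); rewrite -muE {1}[v]muE {1}[w]muE.
  rewrite scaler_sumr -big_split; apply: eq_bigr => i _ /=.
  by rewrite scal_scale -scalerDl -scalerDl.
apply: (uniq (mu _) (fun m => (l == m)%:R)); rewrite -muE (bigD1 l) //= eqxx one_scale.
by rewrite big1 ?addr0 // => i; rewrite eq_sym => /negPf ->; rewrite !scale0r.
Qed.
End FinDsum.

Definition dualmod (k : fieldType) (B : falgType k) : Type := {linear B -> k^o}.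

Section DualModule.
Context {k : fieldType} (B : falgType k).
Local Notation D := (dualmod B).
HB.instance Definition _ := gen_eqMixin D.
HB.instance Definition _ := gen_choiceMixin D.

Lemma dualP (f g : D) : (forall b, (f : {linear B -> k^o}) b = (g : {linear B -> k^o}) b) -> f = g.
Proof.
move=> /funext; case: f g => [f cf] [g cg] /= fg; move: fg cf cg => -> cf cg.
congr GRing.Linear.Pack; case: cf cg => [[a] [b]] [[c] [d]].
by rewrite (Prop_irrelevance a c) (Prop_irrelevance b d).
Qed.

Definition dual_add (f g : D) : D := (f : {linear B -> k^o}) \+ (g : {linear B -> k^o}).
Definition dual_opp (f : D) : D := \- (f : {linear B -> k^o}).
Lemma dual_scale_linear (b : B) (f : D) : linear (fun b' : B => (f : {linear B -> k^o}) (b' * b)).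
Proof. by move=> c x y; rewrite mulrDl -scalerAl linearP. Qed.
Definition dual_scale (b : B) (f : D) : D := mklin (dual_scale_linear b f).
Lemma dual_addA : associative dual_add.
Proof. by move=> f g h; apply: dualP => j; apply: addrA. Qed.
Lemma dual_addC : commutative dual_add.
Proof. by move=> f g; apply: dualP => j; apply: addrC. Qed.
Lemma dual_add0 : left_id (\0 : {linear B -> k^o}) dual_add.
Proof. by move=> f; apply: dualP => j; apply: add0r. Qed.
Lemma dual_addN : left_inverse (\0 : {linear B -> k^o}) dual_opp dual_add.
Proof. by move=> f; apply: dualP => j; apply: addNr. Qed.
HB.instance Definition _ := GRing.isZmodule.Build D dual_addA dual_addC dual_add0 dual_addN.
Lemma dual_scaleA a b f : dual_scale a (dual_scale b f) = dual_scale (a * b) f.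
Proof. by apply: dualP => x /=; rewrite mulrA. Qed.
Lemma dual_scale1 : left_id 1 dual_scale.
Proof. by move=> f; apply: dualP => x /=; rewrite mulr1. Qed.
Lemma dual_scaleDr : right_distributive dual_scale +%R.
Proof. by move=> a f g; apply: dualP. Qed.
Lemma dual_scaleDl f : {morph dual_scale^~ f : a b / a + b}.
Proof. by move=> a b; apply: dualP => x /=; rewrite mulrDr linearD. Qed.
HB.instance Definition _ := GRing.Zmodule_isLmodule.Build B D
  dual_scaleA dual_scale1 dual_scaleDr dual_scaleDl.

Definition dval (b : B) (f : D) : k := (f : {linear B -> k^o}) b.
Lemma dval_linear b : forall (f g : D), dval b (f + g) = dval b f + dval b g.
Proof. by []. Qed.
Lemma dval_scale b b' (f : D) : dval b (b' *: f) = dval (b * b') f.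
Proof. by []. Qed.
Lemma dval_scalek b (c : k) (f : D) : dval b ((c%:A : B) *: f) = c * dval b f.
Proof. by rewrite dval_scale -scalerAr mulr1 /dval linearZ. Qed.
Lemma dval_sum b (J : Type) (r : seq J) (F : J -> D) :
  dval b (\sum_(j <- r) F j) = \sum_(j <- r) dval b (F j).
Proof. exact: (big_morph (dval b) (dval_linear b) erefl). Qed.

Local Notation n := (\dim {:B}).
Definition bs (i : 'I_n) : B := (vbasis {:B})`_i.
Definition dbs (i : 'I_n) : D := (coord (vbasis {:B}) i : {linear B -> k^o}).

Lemma bs_dbs (b : B) : b = \sum_i dval b (dbs i) *: bs i.
Proof. exact: coord_vbasis (memvf b). Qed.

Lemma dbs_bs (f : D) : f = \sum_i ((dval (bs i) f)%:A : B) *: dbs i.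
Proof.
apply: dualP => b; rewrite -[RHS]/(dval b _) dval_sum {1}[b]bs_dbs linear_sum.
by apply: eq_bigr => i _; rewrite dval_scalek linearZ mulrC.
Qed.

Lemma dual_fingen : fingen D.
Proof.
apply/fingenP; exists [seq dbs i | i <- enum 'I_n] => f; rewrite [f]dbs_bs rpred_sum // => i _.
by rewrite rpredZ // combsub_mem // map_f // mem_enum.
Qed.
Definition dualfg := FgMod dual_fingen.
End DualModule.

(** * Tensor products with simple modules have no projective summand *)

Section BimoduleSummands.
Context {k : fieldType} {A B : falgType k} (X : bimod A B).
Local Notation T f := (@tensor_map k A B X _ _ f).

Lemma tens_ind (L : lmodType B) (U : submodClosed (tensor X L)) :
  (forall x l, tens x l \in U) -> forall t, t \in U.
Proof.
move=> tU t; apply/cls0; move: t.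
by apply: (tensor_ext (f := cls U) (g := \0)) => x l; apply/cls0.
Qed.

Lemma tens_central (L : lmodType B) (c : k) (x : X) (l : L) :
  tens x ((c%:A : B) *: l) = (c%:A : A) *: tens x l.
Proof. by rewrite -tensA ract_central tensZ. Qed.

Lemma bimod_fingen_left : fingen X.
Proof.
have [s sX] := bimod_fingen X.
pose g := [seq ract x e | x <- s, e <- vbasis {:B}].
apply/fingenP; exists g => x; have [r rs ->] := sX x.
rewrite big_seq rpred_sum // => -[[a c] w] rw; rewrite -[(_, _).1.1]/a -[(_, _).2]/w -[(_, _).1.2]/c rpredZ //.
have sw : w \in s by apply/rs/(map_f snd rw).
rewrite (coord_vbasis (memvf c)) ract_sumr rpred_sum // => j _.
rewrite -[X in ract w X]mulr1 -scalerAl scalerAr -ractA ract_central rpredZ //.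
by apply: combsub_mem; apply: allpairs_f => //; rewrite mem_nth // size_tuple.
Qed.
Definition bimodfg := FgMod bimod_fingen_left.

(* A lifting form of the condition that theta factors through a projective bimodule. *)
Definition bistably_zero (theta : {linear X -> X}) := bimodule_map theta /\
  forall (Y Z : bimod A B) (p : {linear Y -> Z}) (f : {linear X -> Z}),
    bimodule_map p -> bimodule_map f -> (forall z, exists y, p y = z) ->
    exists2 g : {linear X -> Y}, bimodule_map g & forall x, p (g x) = f (theta x).

Lemma ract0 (Z : bimod A B) (b : B) : ract (0 : Z) b = 0.
Proof. by rewrite -[X in ract X b](scale0r 0) ractZ scale0r. Qed.

Lemma ract_sum (Z : bimod A B) (J : Type) (r : seq J) (F : J -> Z) b :
  ract (\sum_(j <- r) F j) b = \sum_(j <- r) ract (F j) b.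
Proof. by apply: (big_morph (fun z => ract z b)) => [x y|]; rewrite ?ractDl ?ract0. Qed.

Lemma ract_scale (Z : bimod A B) (c : k) (z : Z) b :
  ract z (c *: b) = (c%:A : A) *: ract z b.
Proof. by rewrite -[b in LHS]mul1r scalerAl -ractA ract_central ractZ. Qed.

Lemma bistably_zero0 : bistably_zero \0.
Proof.
split=> [x b|Y Z p f pb fb ps]; first by rewrite /= ract0.
by exists \0 => [x b|x]; rewrite /= ?ract0 // !linear0.
Qed.

Lemma bistably_zero_add th th' : bistably_zero th -> bistably_zero th' -> bistably_zero (th \+ th').
Proof.
move=> [b1 l1] [b2 l2]; split=> [x b|Y Z p f pb fb ps]; first by rewrite /= b1 b2 ractDl.
have [g gb gE] := l1 Y Z p f pb fb ps; have [h hb hE] := l2 Y Z p f pb fb ps.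
exists (g \+ h) => x; first by move=> b; rewrite /= gb hb ractDl.
by rewrite /= !linearD gE hE.
Qed.

Section FreeMaps.
Context (p : {linear tensor X (dualmod B) -> A^o}).

(* Under Hom_A(X (x)_B DB, A) = Hom_(A,B)(X, A (x)_k B), p corresponds to
   x |-> sum_j p(x (x) dbs j) (x) bs j; freemap composes it with 1 (x) 1 |-> z. *)
Definition freemap_fun (Z : bimod A B) (z : Z) (x : X) : Z :=
  \sum_j (p (tens x (dbs j)) : A) *: ract z (bs j).

Lemma freemap_linear (Z : bimod A B) (z : Z) : linear (@freemap_fun Z z).
Proof.
move=> a x y; rewrite /freemap_fun scaler_sumr -big_split; apply: eq_bigr => j _ /=.
by rewrite tensDl tensZ linearP scalerA -scalerDl.
Qed.
Definition freemap (Z : bimod A B) (z : Z) : {linear X -> Z} := mklin (@freemap_linear Z z).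

Lemma freemap_bimod (Z : bimod A B) (z : Z) : bimodule_map (freemap z).
Proof.
move=> x b; rewrite -[freemap z _]/(\sum_j _) -[freemap z x]/(\sum_j _) ract_sum.
(* The structure constants of right multiplication by [b] describe both its effect on the basis [bs]
   and the action of [b] on the dual basis [dbs]. *)
transitivity (\sum_i \sum_j (dval (bs i * b) (dbs j))%:A *: ((p (tens x (dbs i)) : A) *: ract z (bs j))).
  rewrite exchange_big; apply: eq_bigr => j _ /=.
  rewrite tensA [b *: dbs j]dbs_bs tens_sumr linear_sum scaler_suml; apply: eq_bigr => i _.
  by rewrite tens_central linearZ dval_scale scalerA.
apply: eq_bigr => i _; rewrite ractZ ractA [bs i * b]bs_dbs ract_sumr scaler_sumr.
apply: eq_bigr => j _; rewrite ract_scale -bs_dbs !scalerA.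
by rewrite -scalerAl mul1r -scalerAr mulr1.
Qed.

Lemma freemap_nat (Y Z : bimod A B) (f : {linear Y -> Z}) (y : Y) x :
  bimodule_map f -> f (freemap y x) = freemap (f y) x.
Proof.
by move=> fb; rewrite linear_sum; apply: eq_bigr => j _; rewrite linearZ /= fb.
Qed.

(** As [freemap z] factors through a free bimodule of rank one, lifting [f \o freemap z] only
    requires a preimage of [f z]. *)
Lemma freemap_bistably_zero (z : X) : bistably_zero (freemap z).
Proof.
split=> [|Y Z q f qb fb qs]; first exact: freemap_bimod.
have [y yE] := qs (f z); exists (freemap y); first exact: freemap_bimod.
by move=> x; rewrite !freemap_nat // yE.
Qed.
End FreeMaps.

Section DualEmbedding.
Context (L : fgmod B) (mu : L -> k).
Context (muL : forall a v w, mu ((a%:A : B) *: v + w) = a * mu v + mu w).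

Lemma coef_linear (l : L) : linear (fun b : B => mu (b *: l) : k^o).
Proof. by move=> c x y; rewrite scalerDl -[x in c *: x]mul1r scalerAl -scalerA muL. Qed.
Definition coef_fun (l : L) : dualmod B := mklin (coef_linear l).
Lemma coef_fun_linear : linear coef_fun.
Proof.
move=> b l l'; apply: dualP => c; rewrite /= scalerDr scalerA.
by rewrite -[(c * b) *: l in LHS]one_scale muL mul1r.
Qed.
Definition coef : {linear L -> dualmod B} := mklin coef_fun_linear.
Lemma coefE b l : dval b (coef l) = mu (b *: l).
Proof. by []. Qed.
Lemma coef_scale (c : k) l : mu ((c%:A : B) *: l) = c * mu l.
Proof. by rewrite -[_ *: l]scale1r -coefE linearZ dval_scalek coefE scale1r. Qed.
End DualEmbedding.

Context (Xexact : tensor_exact X) (saA : self_injective A) (splitB : split_algebra B).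

Section Simple.
Context (L : fgmod B) (sL : simple L).

(** A nonzero kernel contains a simple [T]. Through one nonzero coordinate [T] is [L], and by
    splitness every coordinate is then a scalar [c m]. Evaluating at [1] the functional attached to
    [e l] gives [c l = 0] for all [l], a contradiction. *)
Lemma simple_power_embedding n (e : 'I_n -> L) (mu : 'I_n -> L -> k)
    (muL : forall m a v w, mu m ((a%:A : B) *: v + w) = a * mu m v + mu m w) :
  (forall m l, mu m (e l) = (l == m)%:R) ->
  exists j : {linear dprodfg (fun _ : 'I_n => L) -> dualmod B}, injective j /\
    forall f, j f = \sum_m coef (muL m) (f m).
Proof.
move=> mue; pose V := dprodfg (fun _ : 'I_n => L).
have jL : linear (fun f : V => \sum_m coef (muL m) (f m)).
  move=> a f g; rewrite scaler_sumr -big_split; apply: eq_bigr => m _.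
  by rewrite -[(a *: f + g) m]/(a *: f m + g m) linearP.
pose j : {linear V -> dualmod B} := mklin jL.
exists j; split=> //; apply: lin_inj => f jf; apply: contrapT => f0.
pose P (T : submodClosed V) := subsub T (kersub j) /\ exists2 t, t \in T & t <> 0.
have [|T [Tj [t Tt t0]] Tmin] := @min_submod _ _ V P (kersub j).
  by split=> //; exists f => //; apply/kersubP.
have sT : simple (subm T).
  split; first by exists (exist _ t Tt : subm T); apply/eqP => /(congr1 val).
  move=> U; pose U' := imsub (\val : {linear subm T -> V}) U.
  have [Ux|U0] := pselect (exists2 u, u \in U & u <> 0); last first.
    by left=> u Uu; apply/zerosubP; apply: contrapT => u0; apply: U0; exists u.
  right=> x _; have [u Uu u0] := Ux.
  have PU' : P U'.
    split=> [_ /imsubP[v _ ->]|]; first by apply: Tj; apply: valP.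
    exists (val u); first by apply/imsubP; exists u.
    by move=> u0'; apply: u0; apply: subm_val0.
  have U'T : subsub U' T by move=> _ /imsubP[v _ ->]; apply: valP.
  by have /imsubP[y Uy /val_inj ->] := Tmin U' PU' U'T _ (valP x).
have [m tm] : exists m, t m <> 0.
  by apply: contrapT => tn; apply/t0/dprodP => m; apply: contrapT => tm; apply: tn; exists m.
pose q m' : {linear subm T -> L} := dpr _ m' \o (\val : {linear subm T -> V}).
have qb : bijective (q m) by apply: schur => //; exists (exist _ t Tt : subm T).
have [g [qg gq]] := lin_inverse qb.
have [c cE] := choice (fun m' => splitB sL (q m' \o g)).
have c0 l : c l = 0.
  have /kersubP : val (g (e l)) \in kersub j by apply: Tj; apply: valP.
  move=> /(congr1 (dval 1)); rewrite -[j _]/(\sum_m' _) dval_sum => E.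
  rewrite -[RHS]E (bigD1 l) //= big1 => [|m' lm'].
    by rewrite addr0 scale1r -[val _ l]/((q l \o g) (e l)) cE (coef_scale (muL l)) mue eqxx mulr1.
  rewrite scale1r -[val _ m']/((q m' \o g) (e l)) cE (coef_scale (muL m')) mue.
  by rewrite eq_sym (negPf lm') mulr0.
case: sL => -[x x0] _; move/eqP: x0; apply.
by rewrite -[x]gq -[q m _]/((q m \o g) x) cE c0 !scale0r.
Qed.

(** The map equal to [psi] on the copy [m0] of [L] and to zero on the others is extended along
    [X (x) L^n -> X (x) DB], which is injective because [X (x) -] is exact. *)
Lemma extend_functional n (e : 'I_n -> L) (mu : 'I_n -> L -> k)
    (muL : forall m a v w, mu m ((a%:A : B) *: v + w) = a * mu m v + mu m w)
    (psi : {linear tensor X L -> A^o}) (m0 : 'I_n) :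
  (forall m l, mu m (e l) = (l == m)%:R) ->
  exists p : {linear tensor X (dualmod B) -> A^o},
    forall m x l, p (tens x (coef (muL m) l)) = if m == m0 then psi (tens x l) else 0.
Proof.
move=> mue; have [j [ji jE]] := simple_power_embedding muL mue.
pose V := dprodfg (fun _ : 'I_n => L).
have injA : injmodule (A^o : lmodType A) := saA.
have [p pE] := injA (tensfg X V) (tensfg X (dualfg B)) (T j)
  (psi \o T (dpr _ m0 : {linear V -> L})) (T_inj (N := dualfg B) Xexact ji).
exists p => m x l.
have -> : coef (muL m) l = j (din (fun _ => L : lmodType B) m l).
  rewrite jE (bigD1 m) //= dfwith_in big1 ?addr0 // => i im.
  by rewrite dfwith_out 1?eq_sym //; exact: (linear0 (coef (muL i))).
rewrite -(tensor_mapE j) pE -[LHS]/(psi (T _ _)) tensor_mapE.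
rewrite -[dpr _ _ _]/(dfwith _ _ m0); case: eqVneq => [->|mm0]; first by rewrite dfwith_in.
have tens0 : tens x (0 : L) = 0 by apply: (addrI (tens x 0)); rewrite -tensDr !addr0.
by rewrite dfwith_out //; exact: etrans (congr1 psi tens0) (linear0 psi).
Qed.

(** The elements [t] with this property form a submodule, which reduces the claim to
    [t = x0 (x) e m]; there [freemap p x0] works, for a [p] that extends [psi] on the copy [m]. *)
Lemma rank_one_lift (psi : {linear tensor X L -> A^o}) (t : tensor X L) :
  exists2 th, bistably_zero th & forall x l, tens (th x) l = (psi (tens x l) : A) *: t.
Proof.
have [n [e [mu [muE muL mue]]]] := kbasis L.
(* [psi] is quantified inside [Q]: for [a *: s] the property of [s] is used with [psi] multiplied on
   the right by [a]. *)
pose Q t := forall psi : {linear tensor X L -> A^o},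
  exists2 th, bistably_zero th & forall x l, tens (th x) l = (psi (tens x l) : A) *: t.
have tens0 (l : L) : tens (0 : X) l = 0.
  by apply: (addrI (tens 0 l)); rewrite -tensDl !addr0.
have Q0 : Q 0 by move=> psi'; exists \0 => [|x l]; [exact: bistably_zero0|rewrite scaler0 tens0].
have rmulL (a : A) : linear (fun c : A^o => (c : A) * a : A^o).
  by move=> b x y; rewrite mulrDl -mulrA.
have Qc a s s' : Q s -> Q s' -> Q (a *: s + s').
  move=> Qs Qs' psi'; have [th b1 E1] := Qs (mklin (rmulL a) \o psi').
  have [th' b2 E2] := Qs' psi'; exists (th \+ th'); first exact: bistably_zero_add.
  by move=> x l; rewrite /= tensDl E1 E2 scalerDr scalerA.
pose U := mksub Q0 Qc; suff : t \in U by move/mksubP; apply.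
apply: tens_ind => x0 l0; rewrite [l0]muE tens_sumr rpred_sum // => m _.
rewrite tens_central rpredZ //; apply/mksubP => psi'.
have [p pE] := extend_functional muL psi' m mue.
exists (freemap p x0) => [|x l]; first exact: freemap_bistably_zero.
rewrite tens_suml.
transitivity (\sum_m' (p (tens x (coef (muL m') l)) : A) *: tens x0 (e m')); last first.
  rewrite (bigD1 m) //= big1 ?addr0 => [|m' /negPf mm']; rewrite pE ?eqxx //.
  by rewrite mm' scale0r.
transitivity (\sum_i \sum_m' (p (tens x (dbs i)) : A) *: (((mu m' (bs i *: l))%:A : A) *: tens x0 (e m'))).
  apply: eq_bigr => i _; rewrite tensZ tensA [bs i *: l]muE tens_sumr scaler_sumr.
  by apply: eq_bigr => m' _; rewrite tens_central -muE.
rewrite exchange_big; apply: eq_bigr => m' _.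
rewrite [coef (muL m') l in RHS]dbs_bs tens_sumr linear_sum scaler_suml; apply: eq_bigr => i _.
rewrite tens_central linearZ coefE scalerA; congr (_ *: _).
by rewrite -scalerAr mulr1 -[LHS]mul1r -scalerAr scalerAl.
Qed.

(** A dual basis of [P] writes [i \o q] as a sum of maps [x (x) l |-> psi (x (x) l) *: t], each of
    which lifts to [X]. *)
Lemma stable_endo_lift (P : fgmod A) (i : {linear P -> tensor X L}) (q : {linear tensor X L -> P}) :
  projective P -> exists2 th, bistably_zero th & forall x l, tens (th x) l = i (q (tens x l)).
Proof.
move=> projP; have [r rE] := dual_basis projP.
suff [th thb thE] : exists2 th, bistably_zero th &
    forall x l, tens (th x) l = i (\sum_(t <- r) (t.1 (q (tens x l)) : A) *: t.2).
  by exists th => // x l; rewrite thE -rE.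
elim: r {rE} => [|t r [th thb thE]].
  exists \0 => [|x l]; first exact: bistably_zero0.
  by rewrite big_nil linear0; apply: (addrI (tens 0 l)); rewrite -tensDl !addr0.
have [th' b' E'] := rank_one_lift (t.1 \o q) (i t.2).
exists (th' \+ th) => [|x l]; first exact: bistably_zero_add.
by rewrite /= tensDl E' thE big_cons linearD linearZ.
Qed.
End Simple.
End BimoduleSummands.

Section ImageSummand.
Context {k : fieldType} {A B : falgType k} (X : bimod A B).
Context (th : {linear X -> X}) (thb : bistably_zero th) (n : nat) (W : fgmod A).
Context (i : {linear W -> X}) (g : {linear X -> W}) (t : {linear W -> W}).
Hypotheses (ii : injective i) (ig : forall x, i (g x) = iter n.+1 th x)
  (tg : forall w, t (g (i w)) = w) (gt : forall w, g (i (t w)) = w).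

Lemma iter_bimod m : bimodule_map (iterlin th m).
Proof.
have [th_b _] := thb.
by move=> x b; elim: m => // m IHm; rewrite -[LHS]/(th (iterlin th m _)) IHm th_b.
Qed.

(** [g] sends [i (t w)] to [w], and [i \o g] is the bimodule map [th^(n+1)]; so [i] turns this
    action into that of [X]. *)
Definition ract_image (w : W) (b : B) : W := g (ract (i (t w)) b).
Lemma ract_imageE w b : i (ract_image w b) = ract (i w) b.
Proof.
rewrite ig -[iter _ _ _]/(iterlin th n.+1 _) iter_bimod.
by congr (ract _ b); rewrite -[LHS]/(iter n.+1 th _) -ig gt.
Qed.

Lemma ract_image_fingen : exists s : seq W, forall x,
  exists2 r : seq (A * B * W), {subset [seq t.2 | t <- r] <= s} &
    x = \sum_(t <- r) t.1.1 *: ract_image t.2 t.1.2.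
Proof.
have [s sW] := fgmodP W; exists s => x; have [r rs ->] := sW x.
exists [seq ((u.1, 1), u.2) | u <- r]; first by rewrite -map_comp.
rewrite big_map; apply: eq_bigr => u _ /=; congr (_ *: _).
by apply: ii; rewrite ract_imageE ract1.
Qed.

Definition image_bimod : bimod A B.
Proof.
apply: (@Bimod k A B W ract_image _ _ _ _ _ _ ract_image_fingen) => *; apply: ii.
- by rewrite linearD !ract_imageE linearD ractDl.
- by rewrite linearD !ract_imageE ractDr.
- by rewrite !ract_imageE ractA.
- by rewrite ract_imageE ract1.
- by rewrite linearZ !ract_imageE linearZ ractZ.
- by rewrite ract_imageE linearZ ract_central.
Defined.

Lemma image_incl_bimod : bimodule_map (X := image_bimod) (Y := X) i.
Proof. by move=> w b; apply: ract_imageE. Qed.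

Lemma image_proj_bimod : bimodule_map (X := X) (Y := image_bimod) g.
Proof.
move=> x b; apply: ii; rewrite image_incl_bimod !ig.
exact: (iter_bimod n.+1 x b).
Qed.

Lemma image_inv_bimod : bimodule_map (X := image_bimod) (Y := image_bimod) t.
Proof.
move=> w b; rewrite -[RHS]tg; congr (t _); rewrite image_incl_bimod image_proj_bimod.
by rewrite gt.
Qed.

(** If [g1] lifts [f \o g \o th], then [p \o g1 \o th^n] is [f \o g \o th^(n+1) = f \o g \o i \o g],
    and precomposing with [i \o t \o t] leaves [f]. *)
Lemma image_biprojective : biprojective image_bimod.
Proof.
move=> Y Z p f pb fb ps; have [_ lift] := thb.
have [|g1 g1b g1E] := lift Y Z p (f \o g) pb _ ps.
  by move=> x b /=; rewrite image_proj_bimod fb.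
exists (g1 \o iterlin th n \o i \o t \o t : {linear image_bimod -> Y}) => [w b|w].
  rewrite -[LHS]/(g1 (iterlin th n (i (t (t _))))) image_inv_bimod image_inv_bimod.
  by rewrite image_incl_bimod iter_bimod g1b.
rewrite -[LHS]/(p (g1 (iterlin th n (i (t (t w)))))) g1E.
rewrite -[LHS]/(f (g (iter n.+1 th (i (t (t w)))))) -ig gt.
by rewrite gt.
Qed.
End ImageSummand.

(** The bimodule endomorphism [th] induces the idempotent [i \o q]. Its Fitting image is a
    projective bimodule summand of [X], so [th] is nilpotent, and a nilpotent idempotent is zero. *)
Lemma no_proj_retract_tensor_simple (k : fieldType) (A B : falgType k) (X : bimod A B) (L : fgmod B) :
  tensor_exact X -> self_injective A -> split_algebra B -> no_projective_summand X ->
  simple L -> no_proj_retract (tensor X L).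
Proof.
move=> Xexact saA splitB npX sL P i q projP qi.
have [th thb thE] := stable_endo_lift Xexact saA splitB sL i q projP.
have [[|n] [W [j [g [t [// _ ji jg tg gt]]]]]] := fitting_summand (V := bimodfg X) th.
have gb := image_proj_bimod thb ji jg gt.
have W0 : forall w : W, w = 0.
  apply: (npX (image_bimod thb ji jg gt) j (t \o g)).
  - exact: image_incl_bimod.
  - by move=> x b /=; rewrite gb image_inv_bimod.
  - by move=> y /=; rewrite tg.
  - exact: image_biprojective.
have iter0 x : iter n.+1 th x = 0 by rewrite -jg (W0 (g x)) linear0.
have iq m x l : tens (iter m.+1 th x) l = i (q (tens x l)).
  by elim: m => [|m IHm]; [exact: thE|rewrite iterS thE IHm qi].
have iq0 : (i \o q) =1 (\0 : {linear tensor X L -> tensor X L}).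
  apply: tensor_ext => x l; rewrite /= -(iq n) iter0.
  by apply: (addrI (tens 0 l)); rewrite -tensDl !addr0.
move=> y; have iy : i (q (i y)) = 0 by exact: iq0.
by rewrite -[y]qi -[X in i X]qi iy linear0.
Qed.

(** * Filtrations with layers in add S *)

Definition scl (R : pzRingType) (V : lmodType R) (U U' : submodClosed V) :
  {linear subm U -> subquo U U'} := cls _.
Definition sval_lin (R : pzRingType) (V : lmodType R) (U : submodClosed V) :
  {linear subm U -> V} := \val.
Notation vl U := (sval_lin U).

Section TensorSubmodules.
Context {k : fieldType} {A B : falgType k} (X : bimod A B).
Local Notation T f := (@tensor_map k A B X _ _ f).

Lemma scl0 (R : pzRingType) (V : lmodType R) (U U' : submodClosed V) x :
  scl U U' x = 0 <-> val x \in U'.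
Proof. by rewrite cls0 presubP. Qed.

Lemma scl_surj (R : pzRingType) (V : lmodType R) (U U' : submodClosed V) y :
  exists x, scl U U' x = y.
Proof. exact: cls_surj. Qed.

Lemma fingen_subquo (E : fgmod B) (U U' : submodClosed E) : fingen (subquo U U').
Proof. exact: (fingen_quom (V := fsub U)). Qed.
Definition fsubquo (E : fgmod B) (U U' : submodClosed E) := FgMod (fingen_subquo U U').

Definition xsub (E : lmodType B) (U : submodClosed E) : submodClosed (tensor X E) :=
  imsub (T (vl U)) (fullsub _).

Lemma xsubP (E : lmodType B) (U : submodClosed E) y :
  y \in xsub U <-> exists z, y = T (vl U) z.
Proof.
split=> [/imsubP[z _ ->]|[z ->]]; first by exists z.
exact: imsub_full.
Qed.

Lemma xsub_map (E E' : lmodType B) (U : submodClosed E) (U' : submodClosed E')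
    (f : {linear E -> E'}) y :
  (forall x, x \in U -> f x \in U') -> y \in xsub U -> T f y \in xsub U'.
Proof.
move=> fU /xsubP[z ->]; apply/xsubP; exists (T (subm_map fU) z).
by rewrite !(T_comp_ext _ (h := f \o vl U)).
Qed.

Lemma xsub_mono (E : lmodType B) (U U' : submodClosed E) :
  subsub U U' -> subsub (xsub U) (xsub U').
Proof. by move=> UU' y Uy; rewrite -[y]T_id; apply: xsub_map Uy. Qed.

Lemma xsub_zero (E : lmodType B) (U : submodClosed E) y :
  subsub U (zerosub E) -> y \in xsub U -> y = 0.
Proof.
move=> U0 /xsubP[z ->]; apply: T_eq0 => x; apply/zerosubP/U0; exact: valP.
Qed.

Lemma xsub_full (E : lmodType B) (U : submodClosed E) y :
  subsub (fullsub E) U -> y \in xsub U.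
Proof.
move=> fU; have [g gE] := @corestrict _ _ _ idfun U (fun x => fU x (fullsubP x)).
by apply/xsubP; exists (T g y); rewrite (T_comp_ext _ (h := idfun)) ?T_id.
Qed.

Lemma T_dsum (J : finType) (V : lmodType B) (W : J -> lmodType B)
    (inj : forall j, {linear W j -> V}) :
  is_dsum inj -> is_dsum (fun j => T (inj j)).
Proof.
move=> [pr [prK pr0 prS]]; exists (fun j => T (pr j)); split=> [j x|i j x ij|x].
- by rewrite (T_comp_ext _ (h := idfun)) ?T_id.
- by rewrite (T_comp_ext _ (h := \0)) ?T_zero // => y; apply: pr0.
- have sL : linear (fun x => \sum_j T (inj j) (T (pr j) x)).
    move=> a y z; rewrite scaler_sumr -big_split; apply: eq_bigr => j _.
    by rewrite !linearP.
  rewrite -[LHS]/(idfun x); apply: (tensor_ext (g := mklin sL)) => y m.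
  rewrite -[RHS]/(\sum_j _) [m in LHS]prS [LHS]tens_sumr; apply: eq_bigr => j _.
  by rewrite !tensor_mapE.
Qed.

Context (Xexact : tensor_exact X).

Lemma xsub_cls (E : fgmod B) (U : submodClosed E) y : y \in xsub U <-> T (cls U) y = 0.
Proof. by rewrite xsubP; split=> /(T_cls Xexact). Qed.

Lemma vl_inj (E : fgmod B) (U : submodClosed E) : injective (T (vl U)).
Proof. by apply: (T_inj (M := fsub U) Xexact); exact: val_inj. Qed.

Lemma T_scl_surj (E : fgmod B) (U U' : submodClosed E) y : exists z, T (scl U U') z = y.
Proof. apply: (T_surj (M := fsub U) (N := fsubquo U U') Xexact) => z; exact: scl_surj. Qed.

Lemma xsub_scl (E : fgmod B) (U U' : submodClosed E) z :
  T (vl U) z \in xsub U' <-> T (scl U U') z = 0.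
Proof.
have [i iE] : exists i : {linear subquo U U' -> quom U'}, forall x, i (scl U U' x) = cls U' (vl U x).
  apply: (factor_surj (p := scl U U') (q := cls U' \o vl U)); first exact: scl_surj.
  by move=> x /scl0 U'x; apply/cls0.
have ii : injective (T i).
  apply: (T_inj (M := fsubquo U U') (N := fquo U') Xexact); apply: lin_inj => y.
  by have [x <-] := scl_surj y; rewrite iE => /cls0 U'x; apply/scl0.
rewrite xsub_cls.
have -> : T (cls U') (T (vl U) z) = T i (T (scl U U') z).
  by rewrite -!T_comp; apply: T_ext => y; rewrite /= iE.
by split=> [/(inj_lin0 ii)//|->]; rewrite linear0.
Qed.

Lemma xsub_presub (E : fgmod B) (U U' : submodClosed E) z :
  z \in xsub (presub (vl U) U') <-> T (vl U) z \in xsub U'.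
Proof. by rewrite xsub_scl (xsub_cls (E := fsub U)). Qed.

Lemma xsub_imsub (E E' : fgmod B) (u : {linear E -> E'}) (U : submodClosed E) y :
  y \in xsub (imsub u U) <-> exists2 z, z \in xsub U & y = T u z.
Proof.
have uU x : x \in U -> u x \in imsub u U by move=> Ux; apply/imsubP; exists x.
split=> [/xsubP[z ->]|[z Uz ->]]; last exact: xsub_map Uz.
have [t|w <-] := @T_surj _ _ _ _ Xexact (fsub U) (fsub (imsub u U)) (subm_map uU) _ z.
  have /imsubP[x Ux tE] := valP t; exists (exist _ x Ux : subm U); exact: val_inj.
exists (T (vl U) w); first by apply/xsubP; exists w.
by rewrite !(T_comp_ext _ (h := u \o vl U)).
Qed.

(** The value on classes is recorded because maps induced on layers are later compared, through
    these isomorphisms, with maps of the form [T g]. *)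
Lemma layer_iso (E : fgmod B) (N : lmodType A) (h : {linear tensor X E -> N})
    (U U' : submodClosed E) (F F' : submodClosed N) :
  injective h -> (forall y, y \in F <-> exists2 x, x \in xsub U & y = h x) ->
  (forall x, x \in xsub U -> h x \in F' <-> x \in xsub U') ->
  exists2 l : {linear tensor X (subquo U U') -> subquo F F'}, bijective l &
    forall z (Fz : h (T (vl U) z) \in F), l (T (scl U U') z) = sqcls F' Fz.
Proof.
move=> hi FE F'E.
have Fh z : h (T (vl U) z) \in F by apply/FE; exists (T (vl U) z) => //; apply/xsubP; exists z.
have [t tE] := corestrict (f := h \o T (vl U)) Fh.
have t0 z : scl F F' (t z) = 0 <-> T (scl U U') z = 0.
  rewrite scl0 tE /=; have Uz : T (vl U) z \in xsub U by apply/xsubP; exists z.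
  by rewrite -xsub_scl; apply: F'E.
have [|z /t0 //|l lE] := @factor_surj _ _ _ _ (T (scl U U')) (scl F F' \o t).
  exact: T_scl_surj.
exists l => [|z Fz]; last first.
  by rewrite lE; congr (cls _ _); apply: val_inj; rewrite tE.
apply: surj_inj_bij => y.
  have [[w Fw] <-] := scl_surj y; have /FE[x /xsubP[z ->] wE] := Fw.
  by exists (T (scl U U') z); rewrite lE /=; congr (scl _ _ _); apply: val_inj; rewrite tE.
by have [z <-] := T_scl_surj y; rewrite lE => /t0.
Qed.
End TensorSubmodules.

Lemma subquo_mapE (R : pzRingType) (V W : lmodType R) (f : {linear V -> W})
    (U U' : submodClosed V) (F F' : submodClosed W)
    (fU : forall x, x \in U -> f x \in F) (fU' : forall x, x \in U' -> f x \in F') x :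
  subquo_map fU fU' (scl U U' x) = scl F F' (subm_map fU x).
Proof. exact: quoliftE. Qed.

Lemma subquo_bij (R : pzRingType) (V W : lmodType R) (f : {linear V -> W})
    (U U' : submodClosed V) (F F' : submodClosed W) :
  (forall y, y \in F <-> exists2 x, x \in U & y = f x) ->
  (forall x, x \in U -> f x \in F' <-> x \in U') ->
  exists l : {linear subquo U U' -> subquo F F'}, bijective l.
Proof.
move=> FE F'E; have fU x : x \in U -> f x \in F by move=> Ux; apply/FE; exists x.
have [y|x /scl0 U'x|l lE] := factor_surj (p := scl U U') (q := scl F F' \o subm_map fU).
- exact: scl_surj.
- by apply/scl0/(F'E _ (valP x)).
exists l; apply: surj_inj_bij => y.
  have [[w Fw] <-] := scl_surj y; have /FE[x Ux wE] := Fw.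
  by exists (scl U U' (exist _ x Ux : subm U)); rewrite lE /=; congr (scl _ _ _); apply: val_inj.
have [x <-] := scl_surj y; rewrite lE => /scl0 F'x; apply/scl0/F'E => //.
exact: valP.
Qed.

Lemma dsum_bij (k : fieldType) (A : falgType k) (J : finType) (V V' : lmodType A)
    (W : J -> lmodType A) (inj : forall j, {linear W j -> V}) (inj' : forall j, {linear W j -> V'}) :
  is_dsum inj -> is_dsum inj' ->
  exists2 f : {linear V -> V'}, bijective f & forall j x, f (inj j x) = inj' j x.
Proof.
move=> [pr [prK pr0 prS]] [pr' [prK' pr0' prS']].
have fL : linear (fun x => \sum_j inj' j (pr j x)).
  move=> a x y; rewrite scaler_sumr -big_split; apply: eq_bigr => j _.
  by rewrite !linearP.
have gL : linear (fun x => \sum_j inj j (pr' j x)).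
  move=> a x y; rewrite scaler_sumr -big_split; apply: eq_bigr => j _.
  by rewrite !linearP.
have fE j x : \sum_i inj' i (pr i (inj j x)) = inj' j x.
  by rewrite (bigD1 j) //= prK big1 ?addr0 // => i ij; rewrite pr0 1?eq_sym // linear0.
have gE j x : \sum_i inj i (pr' i (inj' j x)) = inj j x.
  by rewrite (bigD1 j) //= prK' big1 ?addr0 // => i ij; rewrite pr0' 1?eq_sym // linear0.
exists (mklin fL); last exact: fE.
exists (mklin gL) => x.
  rewrite [RHS]prS -[mklin fL x]/(\sum_j _) linear_sum; apply: eq_bigr => j _; exact: gE.
rewrite [RHS]prS' -[mklin gL x]/(\sum_j _) linear_sum; apply: eq_bigr => j _; exact: fE.
Qed.

(** [good_full] and [good_faith] are fullness and faithfulness on stable categories, stated for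
    linear maps; [good_np] is what the absence of a projective bimodule summand provides. *)
Record good_bimodule (k : fieldType) (A B : falgType k) (X : bimod A B) : Prop := GoodBimodule {
  good_exact : tensor_exact X;
  good_proj : preserves_projectives X;
  good_full : forall (M N : fgmod B) (f : {linear tensor X M -> tensor X N}),
    exists g : {linear M -> N}, stably_zero (f \- @tensor_map k A B X M N g);
  good_faith : forall (M N : fgmod B) (g : {linear M -> N}), stably_zero (@tensor_map k A B X M N g) -> stably_zero g;
  good_np : forall L : fgmod B, simple L -> no_proj_retract (tensor X L);
  good_npB : no_projective_simple B;
  good_injA : self_injective A;
  good_injB : self_injective B
}.

Section Filtrations.
Context {k : fieldType} {A B : falgType k} (X : bimod A B) (I : finType) (L : I -> fgmod B).
Local Notation T f := (@tensor_map k A B X _ _ f).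
Context (gX : good_bimodule X) (repL : simple_representatives L).
Let S i := tensfg X (L i).
Let Xexact := good_exact gX.

Lemma no_proj_retract_tensor (V : fgmod B) : semisimple V -> no_proj_retract (tensor X V).
Proof.
move=> ssV; have [J [c [inj injP]]] := semisimple_dsum repL ssV.
apply: (no_proj_retract_dsum (W := fun j => S (c j)) (T_dsum X injP)) => j.
by apply: (good_np gX); case: repL.
Qed.

Lemma addS_tensor (V : lmodType A) : addS S V <->
  exists (W : fgmod B) (l : {linear tensor X W -> V}), semisimple W /\ bijective l.
Proof.
split=> [[n [c [inj injP]]]|[W [l [ssW lb]]]].
  pose W := dprodfg (fun j => L (c j)).
  have [l lb _] := dsum_bij (T_dsum X (din_dsum (fun j => L (c j)))) injP.
  exists W, l; split=> //.
  apply: (semisimple_prod_family (f := fun j => dpr _ j : {linear W -> L (c j)})).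
    by move=> j; apply: semisimple_simple; case: repL.
  by move=> x x0; apply: dprodP.
have [J [c [inj injP]]] := semisimple_dsum repL ssW.
exists #|J|, (fun j => c (enum_val j)).
have idb j : bijective (idfun : {linear S (c j) -> S (c j)}) by exists idfun.
have db := dsum_reindex (enum_val_bij J) (dsum_iso idb lb (T_dsum X injP)).
by eexists; exact: db.
Qed.

Lemma addS_bij (V V' : lmodType A) (f : {linear V -> V'}) : bijective f -> addS S V -> addS S V'.
Proof.
move=> fb /addS_tensor[W [l [ssW lb]]]; apply/addS_tensor; exists W, (f \o l); split=> //.
exact: bij_comp.
Qed.

Lemma addS_layer (E : fgmod B) (N : lmodType A) (h : {linear tensor X E -> N})
    (U : submodClosed E) (F F' : submodClosed N) :
  injective h -> (forall y, y \in F <-> exists2 x, x \in xsub X U & y = h x) ->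
  (forall x, x \in xsub X U -> h x \in F' <-> x \in xsub X (radsub U)) -> addS S (subquo F F').
Proof.
move=> hi FE F'E; have [l lb _] := layer_iso Xexact hi FE F'E.
apply/addS_tensor; exists (fsubquo U (radsub U)), l; split=> //.
exact: semisimple_subquo.
Qed.

Definition presents (E : fgmod B) (N : lmodType A) (F : nat -> submodClosed N)
    (h : {linear tensor X E -> N}) :=
  bijective h /\ forall j y, y \in xsub X (radn E j) <-> h y \in F j.

Lemma presents_filtration (E : fgmod B) (N : lmodType A) (F : nat -> submodClosed N) h :
  presents (E := E) F h -> filtration S F.
Proof.
move=> [hb hF]; have hs := bij_surj hb; split=> [y _|j y|| j].
- by have [x <-] := hs y; apply/hF/xsub_full.
- by have [x <-] := hs y; rewrite -!hF; apply: xsub_mono; apply: radsub_sub.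
- have [r rE] := radn_nilpotent E; exists r => y; have [x <-] := hs y.
  by rewrite -hF => /(xsub_zero rE) ->; rewrite linear0; apply/zerosubP.
- apply: (addS_layer (E := E) (h := h) (U := radn E j)) => [|y|x _].
  + exact: bij_inj.
  + split=> [Fy|[x Ux ->]]; last exact/hF.
    by have [x xy] := hs y; exists x => //; apply/hF; rewrite xy.
  + by rewrite -hF.
Qed.

Lemma filtrable_tensor (E : fgmod B) (N : lmodType A) (h : {linear tensor X E -> N}) :
  bijective h -> filtrable S N.
Proof.
move=> hb; exists (fun j => imsub h (xsub X (radn E j))); apply: (presents_filtration (h := h)).
split=> // j y; split=> [Uy|/imsubP[z Uz /(bij_inj hb) ->] //].
by apply/imsubP; exists y.
Qed.

(** Induction on the length. Once [F 1] is [X (x) E'], and [F 0 / F 1] is written as [X (x) V] with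
    [V] semisimple, [N] is an extension of [X (x) V] by [X (x) E'], which comes from an extension
    over [B]. That [radsub (G j)] lies in [G j.+1] expresses that the layers of [G] are
    semisimple. *)
Lemma lift_filtration r (N : fgmod A) (F : nat -> submodClosed N) :
  subsub (fullsub N) (F 0) -> (forall j, subsub (F j.+1) (F j)) -> subsub (F r) (zerosub N) ->
  (forall j, addS S (subquo (F j) (F j.+1))) ->
  exists (E : fgmod B) (G : nat -> submodClosed E) (h : {linear tensor X E -> N}),
    [/\ bijective h, subsub (fullsub E) (G 0), forall j, subsub (G j.+1) (G j),
        forall j, subsub (radsub (G j)) (G j.+1) & forall j y, y \in xsub X (G j) <-> h y \in F j].
Proof.
elim: r N F => [|r IHr] N F F0 Fdn Fr Fadd.
  have N0 (x : N) : x = 0 by apply/zerosubP/Fr/F0/fullsubP.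
  pose E := fsub (zerosub (regfg (A := B))).
  have E0 (x : E) : x = 0 by apply/subm_val0/zerosubP; apply: valP.
  have TE0 (y : tensor X E) : y = 0 by rewrite -[y]T_id; apply: T_eq0 => x; apply: E0.
  exists E, (fun=> fullsub E), \0; split=> [|x _|j x _|j x _|j y]; do ?exact: fullsubP.
  - by exists \0 => x; [rewrite [x]TE0|rewrite [x]N0].
  - by rewrite [y]TE0 !rpred0.
pose N1 := fsub (F 1); pose F' j : submodClosed N1 := presub (vl (F 1)) (F j.+1).
have [|j x /presubP Fx|x /presubP/Fr/zerosubP Fx|j|E' [G' [h' [h'b G'0 G'dn G'rad hG']]]] := IHr N1 F'.
- by move=> x _; apply/presubP; apply: valP.
- exact/presubP/Fdn.
- exact/zerosubP/subm_val0.
- have [|//|l lb] := subquo_bij (f := vl (F 1)) (U := F' j) (U' := F' j.+1) (F := F j.+1) (F' := F j.+2).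
  + move=> y; split=> [Fy|[x /presubP Fx ->] //].
    have F1y : y \in F 1 by elim: j Fy => // j IHj /Fdn/IHj.
    by exists (exist _ y F1y : N1) => //; apply/presubP.
  + by move=> x _; rewrite presubP.
  have [l' [ll' l'l]] := lin_inverse lb.
  apply: (addS_bij _ (Fadd j.+1)); exact: (Bijective l'l ll').
have [V [l [ssV lb]]] := proj1 (addS_tensor _) (Fadd 0).
have [l' [ll' l'l]] := lin_inverse lb.
have [c cE] := @corestrict _ _ _ idfun (F 0) (fun x => F0 x (fullsubP x)).
pose b : {linear N -> tensor X V} := l' \o (scl (F 0) (F 1) \o c).
have b0 y : b y = 0 <-> y \in F 1.
  rewrite -[y in y \in _]/(idfun y) -cE -scl0; split=> [by0|c0].
    by rewrite -[LHS]l'l -[l' _]/(b y) by0 linear0.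
  exact: etrans (congr1 l' c0) (linear0 l').
pose a : {linear tensor X E' -> N} := vl (F 1) \o h'.
have sab : ses a b.
  split=> [|z|y].
  - by apply: inj_comp; [exact: val_inj|exact: bij_inj].
  - have [[y Fy] yE] := scl_surj (l z); exists y; apply: (bij_inj lb).
    by rewrite -yE l'l; congr (scl _ _ _); apply: val_inj; rewrite cE.
  - rewrite b0; split=> [Fy|[x ->]]; last exact: valP.
    by have [x xE] := bij_surj h'b (exist _ y Fy : N1); exists x; rewrite /a /= xE.
have [E [u [v [h [[ui vs uv] hb hu hv]]]]] :=
  lift_extension Xexact (good_proj gX) (good_full gX) (good_injA gX) sab.
(* The filtration of [E'] is shifted by one place, and [V] becomes the new top layer. *)
pose G j := if j is j'.+1 then imsub u (G' j') else fullsub E.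
exists E, G, h; split=> // [j x|j x|j y].
- by case: j => [|j] /=; [move=> _; apply: fullsubP|move=> /imsubP[y /G'dn Gy ->]; apply/imsubP; exists y].
- case: j => [/(semisimple_kill v ssV)/uv[y ->]|j Gx] /=.
    by apply/imsubP; exists y => //; apply/G'0/fullsubP.
  have /imsubP[y Gy xE] := radsub_sub Gx; rewrite xE; apply/imsubP; exists y => //.
  by apply: G'rad; apply: (radsub_imsub Gy ui); rewrite -xE.
- case: j => [|j]; first by split=> _; [apply/F0/fullsubP|apply/xsub_full].
  rewrite /= (xsub_imsub Xexact); split=> [[z Gz ->]|Fy].
    by rewrite hu; have /hG'/presubP := Gz.
  have F1y : h y \in F 1 by elim: j Fy => // j IHj /Fdn/IHj.
  have [|z yE] := proj1 (T_exact Xexact uv y); first by rewrite -hv; apply/b0.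
  by exists z => //; apply/hG'/presubP; rewrite -[vl _ _]/(a z) -hu -yE.
Qed.

End Filtrations.

(** [f - g] is [v \o u] through a projective module; lifting [v] along [g] to [w] gives
    [f = g \o (id + w \o u)], and the second factor is bijective. *)
Lemma stably_zero_endo_correction (k : fieldType) (A : falgType k) (V W : fgmod A) (f g : {linear V -> W}) :
  no_proj_retract V -> (forall y, exists x, g x = y) -> stably_zero (f \- g) ->
  exists2 t : {linear V -> V}, bijective t & forall x, g (t x) = f x.
Proof.
move=> nV gs [P [projP [u [v uv]]]]; have [w wE] := projP V W g v gs.
have sw : stably_zero (w \o u) by exists P; split=> //; exists u, w.
exists (idfun \+ (w \o u)); first exact: no_proj_retract_stably_zero_bij.
by move=> x; rewrite linearD /= wE -uv /= addrC subrK.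
Qed.

(** * Radical filtrations correspond to radical series *)

Section RadicalFiltrations.
Context {k : fieldType} {A B : falgType k} (X : bimod A B) (I : finType) (L : I -> fgmod B).
Local Notation T f := (@tensor_map k A B X _ _ f).
Context (gX : good_bimodule X) (repL : simple_representatives L).
Let S i := tensfg X (L i).
Let Xexact := good_exact gX.

(* The iso X (x) V ~ X (x) M / U can be corrected so that the map to X (x) (M / rad M) comes from
   some g : V -> M / rad M. Lifting the extension, X (x) M ~ X (x) E where E -> V, and the kernel
   of E -> M / rad M becomes isomorphic to rad M, hence has no projective summand; but it maps
   stably trivially to V. *)
Lemma rad_minimal (M : fgmod B) (N : fgmod A) (h : {linear tensor X M -> N})
    (F0 F1 U : submodClosed N) :
  injective h -> (forall y, y \in F0 <-> exists x, y = h x) ->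
  (forall x, x \in xsub X (radsub (fullsub M)) <-> h x \in F1) ->
  subsub F1 F0 -> subsub U F1 -> filtrable S (subm U) -> addS S (subquo F0 U) -> subsub F1 U.
Proof.
move=> hi F0E hF1 F10 UF1 [F [Ffull Fdn [r Fr] Fadd]] /(addS_tensor X repL)[V [l [ssV lb]]].
have [K [_ [hK [hKb _ _ _ _]]]] := lift_filtration (N := fsub U) gX repL Ffull Fdn Fr Fadd.
have [l' [ll' l'l]] := lin_inverse lb.
have Fh x : h x \in F0 by apply/F0E; exists x.
have [c cE] := corestrict Fh.
pose sg : {linear tensor X M -> tensor X V} := l' \o (scl F0 U \o c).
have sg_s y : exists x, sg x = y.
  have [[z Fz] zE] := scl_surj (l y); have /F0E[x xE] := Fz; exists x; apply: (bij_inj lb).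
  by rewrite -zE l'l; congr (scl _ _ _); apply: val_inj; rewrite cE.
have sg0 x : sg x = 0 <-> h x \in U.
  rewrite -cE -scl0; split=> [s0|c0].
    by rewrite -[LHS]l'l -[l' _]/(sg x) s0 linear0.
  exact: etrans (congr1 l' c0) (linear0 l').
set R := radsub (fullsub M) in hF1.
pose W := fquo R; pose pi : {linear M -> W} := cls R.
have pi_s y : exists x, T pi x = y by apply: (T_surj (N := W) Xexact); exact: cls_surj.
have pi0 x : T pi x = 0 <-> h x \in F1 by rewrite -hF1 (xsub_cls Xexact).
have [//|x /sg0/UF1/pi0 //|q qE] := factor_surj (p := sg) (q := T pi).
have q_s y : exists x, q x = y by have [x <-] := pi_s y; exists (sg x).
have nXV := no_proj_retract_tensor gX repL ssV.
have [g gE] := good_full gX q.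
(* On the cokernel [Z] of [g], the map [T z \o q] is onto and stably trivial. As [X (x) V] has no
   projective summand, [X (x) Z] vanishes, and so does [Z]. *)
have g_s y : exists x, g x = y.
  pose Z := fquo (imsub g (fullsub V)); pose z : {linear W -> Z} := cls _.
  have Z0 : forall y : Z, y = 0.
    apply: (T_obj0 Xexact (good_faith gX) (good_npB gX)).
    apply: (stably_zero_surj0 (F := tensfg X V) (N := tensfg X Z) (f := T z \o q) nXV) => [|y'].
      apply: (stably_zero_ext (f := T z \o (q \- T g))); last exact: stably_zero_compr.
      move=> x; rewrite -[LHS]/(T z (q x - T g x)) linearB (T_comp_ext _ (h := \0)).
        by rewrite T_zero subr0.
      by move=> x'; apply/cls0; apply: imsub_full.
    have [w <-] := T_surj (N := Z) Xexact (@cls_surj _ _ _) y'; have [x <-] := q_s w.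
    by exists x.
  by have /cls0/imsubP[x _ ->] := Z0 (z y); exists x.
have Tg_s := T_surj Xexact g_s.
have [t tb tE] := stably_zero_endo_correction (V := tensfg X V) (W := tensfg X W) nXV Tg_s gE.
pose b : {linear tensfg X M -> tensor X V} := t \o sg.
have b0 x : b x = 0 <-> h x \in U.
  rewrite -sg0; split=> [|s0]; last exact: etrans (congr1 t s0) (linear0 t).
  exact: inj_lin0 (bij_inj tb).
have gb x : T g (b x) = T pi x by rewrite -[b x]/(t (sg x)) tE qE.
have UF0 y : y \in U -> y \in F0 by move=> /UF1/F10.
have [x|a aE] := factor_inj (f := vl U \o hK) hi.
  by have /UF0/F0E[z zE] := valP (hK x); exists z; rewrite -zE.
have sab : ses a b.
  split=> [|y|y].
  - apply: lin_inj => x ax; apply: (inj_lin0 (bij_inj hKb)); apply: subm_val0.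
    by rewrite -[val _]/((vl U \o hK) x) -aE ax linear0.
  - have [x xE] := bij_surj tb y; have [x' x'E] := sg_s x.
    by exists x'; rewrite -xE -x'E.
  - rewrite b0; split=> [Uy|[x ->]]; last by rewrite aE; apply: valP.
    have [x xE] := bij_surj hKb (exist _ (h y) Uy : subm U); exists x.
    by apply: hi; rewrite aE /= xE.
have [E [u [v [hE [[ui vs uv] hEb hu hv]]]]] :=
  lift_extension Xexact (good_proj gX) (good_full gX) (good_injA gX) (N := tensfg X M) sab.
pose gv : {linear E -> W} := g \o v.
pose F' := fsub (kersub gv); pose iF : {linear F' -> E} := \val.
have gvE x : T gv x = T pi (hE x) by rewrite -gb hv T_comp.
have iFi : injective (T iF) by apply: (T_inj Xexact); exact: val_inj.
have kF y : T gv y = 0 <-> exists z, y = T iF z by exact: (T_ker Xexact gv y).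
pose iR : {linear fsub R -> M} := vl R.
have kR y : T pi y = 0 <-> exists z, y = T iR z.
  by rewrite -(xsub_cls Xexact) xsubP.
have iRi : injective (T iR) by apply: (T_inj Xexact); exact: val_inj.
have [z|al alE] := factor_inj (f := hE \o T iF) iRi.
  have [|z' zE] := proj1 (kR (hE (T iF z))); last by exists z'; rewrite -zE.
  by rewrite -gvE; apply/kF; exists z.
have alb : bijective al.
  apply: surj_inj_bij => [y|x ax].
    have [x xE] := bij_surj hEb (T iR y); have [|z zE] := proj1 (kF x).
      by rewrite gvE xE; apply/kR; exists y.
    by exists z; apply: iRi; rewrite alE -xE; apply: congr1 (esym zE).
  apply: (inj_lin0 iFi); apply: (inj_lin0 (bij_inj hEb)).
  by rewrite -[hE _]/((hE \o T iF) x) -alE ax linear0.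
have [al' [al1 al2]] := lin_inverse alb.
have nR : no_proj_retract (fsub R) := no_proj_retract_rad (U := fullsub M) (good_injB gX).
have [|y|_ [ph phb]] := no_proj_retract_reflect Xexact (good_full gX) (good_faith gX) (good_npB gX)
    (f := al) (f' := al') nR.
- by apply: (stably_zero_ext (f := \0)); [move=> x /=; rewrite al2 subrr|exact: stably_zero0].
- by exists (al y).
have nF := no_proj_retract_bij phb nR.
(* Through [al], the map [T (v \o iF)] is [b] on [X (x) rad M]. Stably [b] is [T m] for some
   [m : M -> V], and [m] kills [rad M] because [V] is semisimple. *)
have vF x : v (iF x) = 0.
  apply: (stably_zero_to_semisimple0 (f := v \o iF) nF ssV); apply: (good_faith gX).
  have [m mE] := good_full gX b.
  apply: (stably_zero_ext (f := ((b \- T m) \o T iR) \o al)); last by do 2!apply: stably_zero_compl.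
  move=> z; rewrite -[LHS]/(b (T iR (al z)) - T m (T iR (al z))) (T_comp_ext _ (h := \0)).
    by rewrite T_zero subr0 alE T_comp -hv.
  by move=> y; apply: (semisimple_kill m ssV); apply: valP.
move=> y F1y; have /F10/F0E[x xE] := F1y; rewrite xE; apply/b0.
have [x' x'E] := bij_surj hEb x; rewrite -x'E hv.
have [|z ->] := proj1 (kF x'); first by rewrite gvE x'E; apply/pi0; rewrite -xE.
by rewrite -T_comp; apply: T_eq0.
Qed.

(** The minimality of [F j.+1] is [rad_minimal] for [radn E j] viewed as a module of its own. *)
Lemma presents_radical (E : fgmod B) (N : fgmod A) (F : nat -> submodClosed N) h :
  presents (X := X) (E := E) F h -> radical_filtration S F.
Proof.
move=> ph; have fF := presents_filtration gX repL ph; split=> // j U UF fU aU UF'.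
have [hb hF] := ph; have [_ Fdn _ _] := fF.
apply: (@rad_minimal (fsub (radn E j)) N (h \o T (vl (radn E j))) (F j) (F j.+1) U) => //.
- by apply: inj_comp; [exact: bij_inj|exact: (vl_inj Xexact)].
- move=> y; split=> [Fy|[x ->]]; last by apply/hF/xsubP; exists x.
  have [x xy] := bij_surj hb y; have /hF/xsubP[z zE] : h x \in F j by rewrite xy.
  by exists z; rewrite -xy; apply: congr1 zE.
- move=> x; rewrite -hF -(xsub_presub Xexact); split; apply: xsub_mono => y.
    by move=> /radsub_subm Uy; apply/presubP.
  by move=> /presubP Uy; apply/radsub_subm.
Qed.

Lemma xsub_reflect (E : fgmod B) (U U' : submodClosed E) :
  subsub (xsub X U) (xsub X U') -> subsub U U'.
Proof.
move=> UU' x Ux; apply/cls0.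
have f0 := T_reflect0 Xexact (good_faith gX) (good_npB gX) (M := fsub U) (N := fquo U')
  (f := cls U' \o vl U).
apply: (f0 _ (exist _ x Ux : subm U)) => y.
by rewrite T_comp; apply/(xsub_cls Xexact)/UU'/xsubP; exists y.
Qed.

(** The lifted filtration [G] is compared with the radical series by induction. Its semisimple
    layers put [rad (G j)] inside [G j.+1]; conversely the image of [X (x) rad (G j)] is a filtrable
    submodule competing with [F j.+1], so minimality applies. *)
Lemma radical_presents (N : fgmod A) (F : nat -> submodClosed N) :
  radical_filtration S F -> exists (E : fgmod B) h, presents (X := X) (E := E) F h.
Proof.
move=> [[Ffull Fdn [r Fr] Fadd] Fmin].
have [E [G [h [hb G0 Gdn Grad hG]]]] := lift_filtration gX repL Ffull Fdn Fr Fadd.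
exists E, h; split=> // j y; have hi := bij_inj hb.
suff GE : subsub (G j) (radn E j) /\ subsub (radn E j) (G j).
  by rewrite -hG; split; apply: xsub_mono; case: GE.
elim: j {y} => [|j [IH1 IH2]]; first by split=> x Ux; [exact: fullsubP|exact: G0].
split=> [|x /(radsub_mono IH2)/Grad //].
pose U := imsub h (xsub X (radsub (G j))).
have UE y : h y \in U <-> y \in xsub X (radsub (G j)).
  by split=> [/imsubP[z Uz /hi ->] //|Uy]; apply/imsubP; exists y.
suff FU : subsub (F j.+1) U.
  move=> x Gx; apply: (radsub_mono IH1); move: x Gx; apply: xsub_reflect => y Gy.
  by apply/UE/FU/hG.
apply: Fmin.
- by move=> _ /imsubP[y /(xsub_mono (@radsub_sub _ _ _ (G j)))/hG Fy ->].
- have [y|f fE] := corestrict (f := h \o T (vl (radsub (G j)))) (T := U).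
    by apply/UE/xsubP; exists y.
  apply: (filtrable_tensor gX repL (E := fsub (radsub (G j))) (h := f)).
  apply: surj_inj_bij => [[y Uy]|y fy].
    have /imsubP[x /xsubP[z xE] yE] := Uy.
    by exists z; apply: val_inj; rewrite fE /= yE; apply: congr1 (esym xE).
  apply: (vl_inj Xexact (U := radsub (G j))); rewrite linear0; apply: (inj_lin0 hi).
  exact: etrans (esym (fE y)) (congr1 val fy).
- apply: (addS_layer gX repL (U := G j) hi) => [y|y _]; last exact: UE.
  split=> [Fy|[z Gz ->]]; last exact/hG.
  by have [x xy] := bij_surj hb y; exists x => //; apply/hG; rewrite xy.
- by move=> _ /imsubP[y /(xsub_mono (@Grad j))/hG Fy ->].
Qed.
End RadicalFiltrations.

(** * Graded homomorphisms and presentations *)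

Section GradedHoms.
Context {k : fieldType} {A : falgType k}.
Implicit Types L M N : filmod A.

Lemma mkG_subproof M N i (f : subm (filhom M N i)) : phi M N i 0 f \in imsub (phi M N i 0) (fullsub _).
Proof. exact: imsub_full. Qed.
Definition mkG_fun M N i (f : subm (filhom M N i)) : homG M N i :=
  exist (fun h => h \in _) _ (mkG_subproof f).
Lemma mkG_linear M N i : linear (@mkG_fun M N i).
Proof. by move=> a f g; apply: val_inj; exact: (linearP (phi M N i 0)). Qed.
Definition mkG M N i : {linear subm (filhom M N i) -> homG M N i} := mklin (@mkG_linear M N i).

Lemma mkG_surj M N i (f : homG M N i) : mkG M N i (liftG f) = f.
Proof. by apply: val_inj; rewrite [RHS]liftGP. Qed.

Lemma phi0 M N i j (f : subm (filhom M N i)) : phi M N i j f = 0 <-> stably_zero (layer_map j f).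
Proof.
rewrite -factors_projE -[phi _ _ _ _ f]/(cls (projmaps _ _) (layer_map j f)) cls0.
exact: mksubP.
Qed.

Lemma mkG0 M N i (f : subm (filhom M N i)) : mkG M N i f = 0 <-> stably_zero (layer_map 0 f).
Proof. by rewrite -phi0; split=> [/(congr1 val)|f0] //; apply: val_inj. Qed.

(** Iterated from [j = 0], this says that [phi j] of a filtered map depends only on its [phi 0],
    which makes the composition in [G] independent of the chosen lift. *)
Definition independent_lifts M N := forall i j (f : subm (filhom M N i)),
  stably_zero (layer_map j f) -> stably_zero (layer_map j.+1 f).

(** The chosen lift of [mkG M N i f] differs from [f] by a map whose [phi 0] vanishes, and then so
    does its [phi j]. Composition can thus be computed with any lift. *)
Lemma compG_mkG L M N i j (f : subm (filhom M N i)) (g : subm (filhom L M j)) :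
  independent_lifts M N ->
  compG (mkG M N i f) (mkG L M j g) = mkG L N (j + i) (filcomp f g).
Proof.
move=> indep; apply: val_inj; rewrite -[RHS]/(phi L N (j + i) 0 _) phi_comp.
congr (scomp _ (phi L M j 0 g)); change (phi M N i j (liftG (mkG M N i f)) = phi M N i j f).
apply/eqP; rewrite -subr_eq0 -linearB; apply/eqP/phi0.
elim: j {g} => [|j IHj]; last exact: indep.
by apply/phi0; rewrite linearB -liftGP /= subrr.
Qed.

Lemma existT_mkG M N i j (f : subm (filhom M N i)) (g : subm (filhom M N j)) :
  i = j -> val f = val g ->
  existT (fun n => homG M N n) i (mkG M N i f) = existT (fun n => homG M N n) j (mkG M N j g).
Proof. by move=> ij; case: _ / ij g => g /val_inj ->. Qed.
End GradedHoms.

Section RadicalHoms.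
Context {k : fieldType} {B : falgType k}.
Implicit Types L M N : lmodType B.

Definition mkgr M N i : {linear subm (radhom M N i) -> grhom i M N} := scl _ _.

Lemma radhomP M N i (f : hom M N) : f \in radhom M N i <-> forall x, f x \in radn N i.
Proof. exact: mksubP. Qed.

Lemma mkgr_surj M N i (f : grhom i M N) : exists g, mkgr M N i g = f.
Proof. exact: scl_surj. Qed.

Lemma mkgr0 M N i (f : subm (radhom M N i)) : mkgr M N i f = 0 <-> val f \in radhom M N i.+1.
Proof. exact: scl0. Qed.

Definition radcomp L M N i j (f : subm (radhom M N i)) (g : subm (radhom L M j)) :
    subm (radhom L N (j + i)) :=
  exist (fun h => h \in _) (comphom (val f) (val g)) (radhom_comp (valP f) (valP g)).

Definition radone M : subm (radhom M M 0) := exist (fun h => h \in _) _ (radhom_id M).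

Lemma grcomp_mkgr L M N i j (f : subm (radhom M N i)) (g : subm (radhom L M j)) :
  grcomp (mkgr M N i f) (mkgr L M j g) = mkgr L N (j + i) (radcomp f g).
Proof.
set f' := mkgr M N i f; set g' := mkgr L M j g.
have fE : sqrepr f' - val f \in radhom M N i.+1.
  by have := repr_cls (presub (\val : {linear subm (radhom M N i) -> hom M N}) (radhom M N i.+1)) f; rewrite presubP.
have gE : sqrepr g' - val g \in radhom L M j.+1.
  by have := repr_cls (presub (\val : {linear subm (radhom L M j) -> hom L M}) (radhom L M j.+1)) g; rewrite presubP.
apply/clsP/presubP; apply/radhomP => x.
rewrite -[(_ : hom L N) x]/(sqrepr f' (sqrepr g' x) - (val f : hom M N) ((val g : hom L M) x)).
rewrite -(subrK (sqrepr f' ((val g : hom L M) x)) (sqrepr f' _)) -addrA rpredD //.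
  rewrite -linearB; apply: (radn_hom (j := j.+1)) => [y|].
    by have /radhomP := sqreprP f'; apply.
  by have /radhomP /(_ x) := gE.
rewrite -addnS; apply: (radn_hom (f := (sqrepr f' - val f : hom M N)) (i := i.+1)) => [y|].
  by have /radhomP /(_ y) := fE.
by have /radhomP := valP g; apply.
Qed.

Lemma existT_mkgr M N i j (f : subm (radhom M N i)) (g : subm (radhom M N j)) :
  i = j -> val f = val g ->
  existT (fun n => grhom n M N) i (mkgr M N i f) = existT (fun n => grhom n M N) j (mkgr M N j g).
Proof. by move=> ij; case: _ / ij g => g /val_inj ->. Qed.

Lemma grmod_axioms : gcat_axioms (grmod B).
Proof.
split.
- move=> L M N i j f a g g'; have [f1 <-] := mkgr_surj f.
  have [g1 <-] := mkgr_surj g; have [g2 <-] := mkgr_surj g'.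
  change (grcomp (mkgr M N i f1) (a *: mkgr L M j g1 + mkgr L M j g2) =
    a *: grcomp (mkgr M N i f1) (mkgr L M j g1) + grcomp (mkgr M N i f1) (mkgr L M j g2)).
  rewrite -linearP !grcomp_mkgr -linearP; congr (mkgr _ _ _ _); apply: val_inj; apply/homP => x /=.
  by rewrite linearD; congr (_ + _); rewrite /homZ_fun linearZ.
- move=> L M N i j g a f f'; have [g1 <-] := mkgr_surj g.
  have [f1 <-] := mkgr_surj f; have [f2 <-] := mkgr_surj f'.
  change (grcomp (a *: mkgr M N i f1 + mkgr M N i f2) (mkgr L M j g1) =
    a *: grcomp (mkgr M N i f1) (mkgr L M j g1) + grcomp (mkgr M N i f2) (mkgr L M j g1)).
  by rewrite -linearP !grcomp_mkgr -linearP; congr (mkgr _ _ _ _); apply: val_inj; apply/homP.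
- move=> M N i f; have [f1 <-] := mkgr_surj f.
  change (existT (fun n => grhom n M N) (i + 0)%N (grcomp (mkgr N N 0 (radone N)) (mkgr M N i f1)) =
      existT (fun n => grhom n M N) i (mkgr M N i f1) /\
    existT (fun n => grhom n M N) i (grcomp (mkgr M N i f1) (mkgr M M 0 (radone M))) =
      existT (fun n => grhom n M N) i (mkgr M N i f1)).
  by rewrite !grcomp_mkgr; split; apply: existT_mkgr; rewrite ?addn0 //; apply/homP.
- move=> K L M N a b c f g e; have [f1 <-] := mkgr_surj f; have [g1 <-] := mkgr_surj g.
  have [e1 <-] := mkgr_surj e.
  change (existT (fun n => grhom n K N) (a + c + b)%N
      (grcomp (mkgr M N b f1) (grcomp (mkgr L M c g1) (mkgr K L a e1))) =
    existT (fun n => grhom n K N) (a + (c + b))%N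
      (grcomp (grcomp (mkgr M N b f1) (mkgr L M c g1)) (mkgr K L a e1))).
  rewrite !grcomp_mkgr.
  by apply: existT_mkgr; rewrite ?addnA //; apply/homP.
Qed.
End RadicalHoms.

(** Compared with [presents], the inverse is data, since [transport] conjugates by it. *)
Record pres (k : fieldType) (A B : falgType k) (X : bimod A B) (E : fgmod B) (M : filmod A) := Pres {
  pres_to : {linear tensor X E -> M};
  pres_from : {linear M -> tensor X E};
  pres_toK : cancel pres_to pres_from;
  pres_fromK : cancel pres_from pres_to;
  presP : forall j y, y \in xsub X (radn E j) <-> pres_to y \in fil M j
}.

(** * Presented modules: graded maps over [B] and over [A] *)

Section Presentations.
Context {k : fieldType} {A B : falgType k} (X : bimod A B).
Local Notation T f := (@tensor_map k A B X _ _ f).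
Context (gX : good_bimodule X).
Let Xexact := good_exact gX.
Local Opaque tensor_map.

Lemma presents_pres (E : fgmod B) (M : filmod A) h :
  presents (X := X) (E := E) (fil M) h -> exists p : pres X E M, pres_to p = h.
Proof. by move=> [hb hP]; have [h' [hh' h'h]] := lin_inverse hb; exists (Pres hh' h'h hP). Qed.

Lemma pres_inj E M (p : pres X E M) : injective (pres_to p).
Proof. exact: can_inj (pres_toK p). Qed.

Lemma pres_layer E M (p : pres X E M) j :
  exists2 l : {linear tensor X (subquo (radn E j) (radn E j.+1)) -> layer M j}, bijective l &
    forall z (Fz : pres_to p (T (vl (radn E j)) z) \in fil M j),
      l (T (scl (radn E j) (radn E j.+1)) z) = sqcls (fil M j.+1) Fz.
Proof.
apply: layer_iso => //; first exact: pres_inj.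
- move=> y; split=> [Fy|[x Ux ->]]; last exact/presP.
  by exists (pres_from p y); rewrite ?pres_fromK //; apply/(presP p); rewrite pres_fromK.
- by move=> x _; rewrite -presP.
Qed.

Section Beta.
Context (E E' : fgmod B) (M N : filmod A) (p : pres X E M) (q : pres X E' N) (i : nat).

Definition transport (g : hom E E') : hom M N := pres_to q \o (T g \o pres_from p).

Lemma transportE g y : transport g (pres_to p y) = pres_to q (T g y).
Proof. by rewrite -[LHS]/(pres_to q (T g (pres_from p (pres_to p y)))) pres_toK. Qed.

Lemma transport_rad (g : hom E E') j j' : (forall x, x \in radn E j -> g x \in radn E' j') ->
  forall y, y \in fil M j -> transport g y \in fil N j'.
Proof.
move=> gj y My; apply/presP; apply: (xsub_map (U := radn E j)) => //.
by apply/(presP p); rewrite pres_fromK.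
Qed.

Lemma transport_filhom (g : subm (radhom E E' i)) : transport (val g) \in filhom M N i.
Proof.
apply/mksubP => j; apply: transport_rad => x; apply: radn_hom.
exact/radhomP/valP.
Qed.

Definition bmap_fun (g : subm (radhom E E' i)) : subm (filhom M N i) :=
  exist (fun h => h \in _) _ (transport_filhom g).
Lemma bmap_linear : linear bmap_fun.
Proof.
move=> c g g'; apply: val_inj; apply/homP => y.
have TZ (h : hom E E') z : T (c *: h) z = (c%:A : A) *: T h z.
  have TZL : linear (fun z => (c%:A : A) *: T h z) by exact: (@homZ_linear _ _ _ _ c (T h)).
  apply: (tensor_ext (g := mklin TZL)) => x m; rewrite tensor_mapE.
  by rewrite -[RHS]/((c%:A : A) *: T h (tens x m)) tensor_mapE -tens_central.
change (pres_to q (T ((c *: val g : hom E E') \+ val g') (pres_from p y)) =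
  (c%:A : A) *: pres_to q (T (val g) (pres_from p y)) + pres_to q (T (val g') (pres_from p y))).
by rewrite T_add TZ linearP.
Qed.
Definition bmap := mklin bmap_linear.

(** The layer isomorphisms turn the induced map into [T g'], with [g'] between semisimple
    [B]-modules. If it is stably trivial then so is [g'], and hence [g' = 0]. *)
Lemma stably_zero_layer_bmap (g : subm (radhom E E' i)) j :
  stably_zero (layer_map j (bmap g)) <->
  forall x, x \in radn E j -> (val g : hom E E') x \in radn E' (j + i).+1.
Proof.
split=> [sg|gj]; last first.
  apply: (stably_zero_ext (f := \0)); last exact: stably_zero0.
  move=> y; have [x <-] := scl_surj y; rewrite [RHS]layer_mapE; apply/esym/scl0.
  exact: (transport_rad gj (valP x)).
have gU j' x : x \in radn E j' -> (val g : hom E E') x \in radn E' (j' + i).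
  by apply: radn_hom; apply/radhomP/valP.
pose g' := subquo_map (f := (val g : hom E E')) (@gU j) (@gU j.+1).
have [l lb lE] := pres_layer p j; have [l' lb' lE'] := pres_layer q (j + i).
have [m [lm ml]] := lin_inverse lb; have [m' [lm' ml']] := lin_inverse lb'.
have g'0 : forall x, g' x = 0.
  apply: (semisimple_stably_zero0 (V := fsubquo (radn E j) (radn E j.+1))
    (W := fsubquo (radn E' (j + i)) (radn E' (j + i).+1)) (good_npB gX)).
  - exact: semisimple_subquo.
  - exact: semisimple_subquo.
  - apply: (good_faith gX (M := fsubquo _ _) (N := fsubquo _ _)).
    apply: (stably_zero_ext (f := m' \o layer_map j (bmap g) \o l)); last first.
      by apply: stably_zero_compl; apply: stably_zero_compr.
    move=> y; have [z <-] := T_scl_surj Xexact y; apply: (can_inj lm').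
    have Fz : pres_to p (T (vl (radn E j)) z) \in fil M j.
      by apply/presP/xsubP; exists z.
    have T1 : T g' (T (scl _ _) z) = T (scl _ _) (T (subm_map (@gU j)) z).
      by rewrite -!T_comp; apply: T_ext => x; exact: (subquo_mapE (@gU j) (@gU j.+1) x).
    have Fz' : pres_to q (T (vl (radn E' (j + i))) (T (subm_map (@gU j)) z)) \in fil N (j + i).
      by apply/presP/xsubP; exists (T (subm_map (@gU j)) z).
    rewrite T1 (lE' _ Fz').
    change (l' (m' (layer_map j (bmap g) (l (T (scl _ _) z)))) = sqcls (fil N (j + i).+1) Fz').
    rewrite ml' (lE _ Fz) [LHS]layer_mapE; congr (cls _ _); apply: val_inj => /=.
    change (transport (val g) (pres_to p (T (vl (radn E j)) z)) =
      pres_to q (T (vl (radn E' (j + i))) (T (subm_map (@gU j)) z))).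
    rewrite transportE; congr (pres_to q _); rewrite -!T_comp; exact: T_ext.
move=> x Ex; have := g'0 (scl _ _ (exist _ x Ex : subm (radn E j))).
by rewrite /g' subquo_mapE => /scl0.
Qed.

(* The map induced on the top of M comes stably from a map E / rad E -> rad^i E' / rad^(i+1) E'.
   The obstruction to lifting it to E -> rad^i E' factors through a projective module,
   so it can be removed. *)
Lemma bmap_full (f : subm (filhom M N i)) : exists g, mkG M N i (bmap g) = mkG M N i f.
Proof.
set U := radn E' (0 + i); set U' := radn E' (0 + i).+1.
have fE y : pres_from q ((val f : hom M N) (pres_to p y)) \in xsub X U.
  apply/(presP q); rewrite pres_fromK; apply: (filhomP f (j := 0)).
  by apply/presP/xsub_full.
have [y|f1 f1E] := factor_inj (f := pres_from q \o ((val f : hom M N) \o pres_to p))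
    (vl_inj Xexact (U := U)).
  by have /xsubP[z zE] := fE y; exists z; rewrite -zE.
have [g0 g0E] := good_full gX (M := E) (N := fsub U) f1.
pose W := fsubquo U U'; pose pW : {linear fsub U -> W} := scl U U'.
have ssW : semisimple W by exact: semisimple_subquo.
have [l lb lE] := pres_layer p 0; have [l' lb' lE'] := pres_layer q (0 + i).
have [m [lm ml]] := lin_inverse lb; have [m' [lm' ml']] := lin_inverse lb'.
pose V := fsubquo (radn E 0) (radn E 1).
pose F : {linear tensor X V -> tensor X W} := m' \o (layer_map 0 f \o l).
have [h0 h0E] := good_full gX (M := V) (N := W) F.
have [c cE] := @corestrict _ _ _ idfun (radn E 0) (@fullsubP _ E).
pose pV : {linear E -> V} := scl (radn E 0) (radn E 1) \o c.
have pVE x : pV (val x) = scl (radn E 0) (radn E 1) x.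
  by congr (scl _ _ _); apply: val_inj; rewrite cE.
have Mz z : pres_to p (T (vl (radn E 0)) z) \in fil M 0 by apply/presP/xsubP; exists z.
have lF z : l' (F (T (scl (radn E 0) (radn E 1)) z)) =
    scl (fil N (0 + i)) (fil N (0 + i).+1) (subm_map (@filhomP _ _ _ _ _ f 0)
      (exist _ (pres_to p (T (vl (radn E 0)) z)) (Mz z))).
  by rewrite -[F _]/(m' (layer_map 0 f (l (T (scl _ _) z)))) ml' (lE _ (Mz z)) [LHS]layer_mapE.
have Fz' y : pres_to q (T (vl U) y) \in fil N (0 + i) by apply/(presP q)/xsubP; exists y.
have l'E y : l' (T pW y) = scl (fil N (0 + i)) (fil N (0 + i).+1) (exist _ (pres_to q (T (vl U) y)) (Fz' y)).
  exact: lE'.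
have FpV y : F (T pV y) = T pW (f1 y).
  apply: (bij_inj lb'); rewrite [T pV y]T_comp lF l'E; congr (scl _ _ _); apply: val_inj.
  rewrite -[RHS]/(pres_to q (T (vl U) (f1 y))) f1E -[RHS]/(pres_to q (pres_from q _)) pres_fromK.
  rewrite -[LHS]/((val f : hom M N) (pres_to p (T (vl (radn E 0)) (T c y)))).
  by rewrite (T_comp_ext _ (h := idfun)) ?T_id.
(* [F \o T pV] equals [T pW \o f1]; replacing [F] by [T h0] and [f1] by [T g0] changes the two sides
   only by stably trivial maps. *)
have [P [projP [u [v uv]]]] : stably_zero ((h0 \o pV) \- (pW \o g0)).
  apply: (good_faith gX).
  apply: (stably_zero_ext (f := (T pW \o (f1 \- T g0)) \- ((F \- T h0) \o T pV))).
    move=> y; have -> : T ((h0 \o pV) \- (pW \o g0)) y = T h0 (T pV y) - T pW (T g0 y).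
      by rewrite T_sub; congr (_ - _); exact: T_comp.
    change (T pW (f1 y - T g0 y) - (F (T pV y) - T h0 (T pV y)) = T h0 (T pV y) - T pW (T g0 y)).
    by rewrite linearB FpV opprB addrC subrKA.
  by apply: stably_zero_sub; [apply: stably_zero_compr|apply: stably_zero_compl].
have [w wE] := projP (fsub U) W pW v (@scl_surj _ _ _ _).
pose g1 : {linear E -> fsub U} := g0 \+ (w \o u).
have g1E x : pW (g1 x) = h0 (pV x).
  by rewrite linearD wE -uv /= addrC subrK.
pose g : hom E E' := vl U \o g1.
have gP : g \in radhom E E' i by apply/radhomP => x; apply: (valP (g1 x)).
exists (exist (fun h => h \in radhom E E' i) g gP).
apply/eqP; rewrite -subr_eq0 -linearB; apply/eqP/mkG0.
set b := bmap _.
have lb0 z : l' (T h0 (T (scl (radn E 0) (radn E 1)) z)) = layer_map 0 b (l (T (scl (radn E 0) (radn E 1)) z)).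
  have Fz : pres_to p (T (vl (radn E 0)) z) \in fil M 0 by apply/presP/xsubP; exists z.
  rewrite (lE _ Fz) [RHS]layer_mapE.
  have -> : T h0 (T (scl (radn E 0) (radn E 1)) z) = T pW (T g1 (T (vl (radn E 0)) z)).
    by rewrite -!T_comp; apply: T_ext => x; rewrite /= g1E pVE.
  rewrite l'E; congr (scl _ _ _); apply: val_inj.
  rewrite -[RHS]/(transport g (pres_to p _)) transportE.
  by congr (pres_to q _); apply: esym; apply: T_comp.
apply: (stably_zero_ext (f := l' \o (T h0 \- F) \o m)); last first.
  apply: stably_zero_compl; apply: stably_zero_compr; apply: (stably_zero_ext (f := \- (F \- T h0))); last exact: stably_zero_opp.
  by move=> y; apply: opprB.
move=> y; have [z zE] := T_scl_surj Xexact (m y).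
have yE : y = l (T (scl _ _) z) by rewrite zE ml.
change (l' (T h0 (m y) - F (m y)) = layer_map 0 (b - f) y).
rewrite -zE yE linearB lb0.
rewrite -[F _]/(m' (layer_map 0 f (l (T (scl _ _) z)))) ml'.
move: (l _) => t; have [t' <-] := scl_surj t.
rewrite [layer_map 0 b _]layer_mapE [layer_map 0 f _]layer_mapE [RHS]layer_mapE.
by rewrite -[LHS]linearB; congr (scl _ _ _); apply: val_inj.
Qed.

Lemma bmap_grhom0 (g : subm (radhom E E' i)) :
  mkG M N i (bmap g) = 0 <-> mkgr E E' i g = 0.
Proof.
rewrite mkG0 stably_zero_layer_bmap mkgr0 radhomP; split=> g0 x; last by move=> _; apply: g0.
by apply: (g0 x); apply: fullsubP.
Qed.

Lemma beta_subproof (g : subm (radhom E E' i)) :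
  g \in presub (\val : {linear subm (radhom E E' i) -> hom E E'}) (radhom E E' i.+1) ->
  (mkG M N i \o bmap) g = 0.
Proof. by move=> /presubP g0; apply/bmap_grhom0/mkgr0. Qed.
Definition beta : {linear grhom i E E' -> homG M N i} := quolift beta_subproof.

Lemma betaE g : beta (mkgr E E' i g) = mkG M N i (bmap g).
Proof. exact: quoliftE. Qed.

Lemma beta_bij : bijective beta.
Proof.
apply: surj_inj_bij => [f|g].
  by have [g gE] := bmap_full (liftG f); exists (mkgr E E' i g); rewrite betaE gE mkG_surj.
by have [g' <-] := mkgr_surj g; rewrite betaE => /bmap_grhom0.
Qed.
End Beta.

(* If f induces a stably trivial map on M_j / M_(j+1), then it can be changed outside M_(j+1) so
   that M_j is sent to N_(j+i+1). The resulting map M_j / M_(j+2) -> N_(j+i+1) / N_(j+i+2) comes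
   stably from a map to a semisimple B-module, which kills the radical. *)
Lemma pres_independent (E E' : fgmod B) (M N : filmod A) (p : pres X E M) (q : pres X E' N) :
  independent_lifts M N.
Proof.
move=> i j f [Q [projQ [u [v uv]]]].
have [w wE] := projQ (fsub (fil N (j + i))) (fsubquo (fil N (j + i)) (fil N (j + i).+1))
  (scl _ _) v (@scl_surj _ _ _ _).
pose uc : {linear subm (fil M j) -> Q} := u \o scl (fil M j) (fil M j.+1).
pose f1 : {linear subm (fil M j) -> N} :=
  ((val f : hom M N) \o vl (fil M j)) \- (vl (fil N (j + i)) \o w \o uc).
have f1E x : f1 x = (val f : hom M N) (val x) - val (w (uc x)) by [].
have f1N x : f1 x \in fil N (j + i).+1.
  have : scl (fil N (j + i)) (fil N (j + i).+1) (subm_map (@filhomP _ _ _ _ _ f j) x - w (uc x)) = 0.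
    by rewrite linearB wE -uv layer_mapE subrr.
  by move=> /scl0.
have [f2 f2E] := corestrict f1N.
have uc0 x : val x \in fil M j.+1 -> f1 x = (val f : hom M N) (val x).
  move=> Mx; have u0 : uc x = 0 := etrans (congr1 u (proj2 (scl0 _ _) Mx)) (linear0 u).
  by rewrite f1E u0 linear0; exact: subr0.
have Mz (z : tensor X (subm (radn E j))) : pres_to p (T (vl (radn E j)) z) \in fil M j.
  by apply/presP/xsubP; exists z.
have [c cE] := corestrict (f := pres_to p \o T (vl (radn E j))) Mz.
have cE' z : val (c z) = pres_to p (T (vl (radn E j)) z) by exact: cE.
set Ej := radn E j; set Ej2 := radn E j.+2.
pose psi := scl (fil N (j + i).+1) (fil N (j + i).+2) \o (f2 \o c).
(* [psi] factors because on [M_(j+2)] the corrected map agrees with [f], which raises the filtration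
   index by [i]. *)
have [|z z0|r rE] := factor_surj (p := T (scl Ej Ej2)) (q := psi).
- exact: T_scl_surj.
- have /(presP p) Mz2 : T (vl Ej) z \in xsub X Ej2 by apply/(xsub_scl Xexact).
  have Fdn : subsub (fil M j.+2) (fil M j.+1).
    move=> y; rewrite -[y](pres_fromK p) -!presP; apply: xsub_mono; exact: radsub_sub.
  have cM : val (c z) \in fil M j.+1 by rewrite cE'; apply: Fdn.
  apply/scl0; change (val (f2 (c z)) \in fil N (j + i).+2); rewrite (f2E (c z)) (uc0 _ cM) cE'.
  exact: (filhomP f (j := j.+2)).
have [l lb lE] := pres_layer p j.+1; have [l' lb' lE'] := pres_layer q (j.+1 + i).
have [m [lm ml]] := lin_inverse lb; have [m' [lm' ml']] := lin_inverse lb'.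
pose W := fsubquo (radn E' (j.+1 + i)) (radn E' (j.+1 + i).+1).
have ssW : semisimple W by exact: semisimple_subquo.
have [h hE] := good_full gX (M := fsubquo Ej Ej2) (N := W) (m' \o r).
have E1 x : x \in radn E j.+1 -> (idfun : {linear E -> E}) x \in Ej by apply: radsub_sub.
pose io := subquo_map E1 (fun x (Ex : x \in Ej2) => Ex : (idfun : {linear E -> E}) x \in Ej2).
have h0 y : h (io y) = 0.
  have [x <-] := scl_surj y; rewrite /io subquo_mapE.
  apply: (semisimple_kill (h \o scl Ej Ej2) ssW); apply/radsub_subm; exact: (valP x).
apply: (stably_zero_ext (f := l' \o ((m' \o r) \- T h) \o (T io \o m))); last first.
  by apply: stably_zero_compl; apply: stably_zero_compr.
move=> y; have [z zE] := T_scl_surj Xexact (m y).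
have yE : y = l (T (scl _ _) z) by rewrite zE ml.
change (l' (m' (r (T io (m y))) - T h (T io (m y))) = layer_map j.+1 f y).
rewrite -zE yE.
have Th0 x : T h (T io x) = 0 by rewrite -T_comp; apply: T_eq0 => x'; apply: h0.
rewrite Th0 subr0 ml'.
have -> : T io (T (scl (radn E j.+1) Ej2) z) = T (scl Ej Ej2) (T (subm_map E1) z).
  by rewrite -!T_comp; apply: T_ext => x; exact: (subquo_mapE E1 _ x).
have Fz : pres_to p (T (vl (radn E j.+1)) z) \in fil M j.+1 by apply/presP/xsubP; exists z.
rewrite rE (lE _ Fz) [RHS]layer_mapE; congr (scl _ _ _); apply: val_inj.
have valc : val (c (T (subm_map E1) z)) = pres_to p (T (vl (radn E j.+1)) z).
  by rewrite cE'; congr (pres_to p _); rewrite -T_comp; apply: T_ext.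
by rewrite -[LHS]/(val (f2 _)) f2E uc0 valc.
Qed.
End Presentations.

Section CategoryAxioms.
Context {k : fieldType} {A B : falgType k} (X : bimod A B) (I : finType) (L : I -> fgmod B).
Context (gX : good_bimodule X) (repL : simple_representatives L).
Let S i := tensfg X (L i).

Lemma gobj_pres (M : gobj S) : exists E, inhabited (pres X E M).
Proof.
have [E [h /presents_pres[p _]]] := radical_presents gX repL (gobjP M).
by exists E.
Qed.

Lemma gobj_independent (M N : gobj S) : independent_lifts M N.
Proof.
have [E [p]] := gobj_pres M; have [E' [q]] := gobj_pres N.
by move=> i j f; apply: (pres_independent gX p q).
Qed.

Definition filone (M : filmod A) : subm (filhom M M 0) :=
  exist (fun h => h \in _) _ (filid_subproof M).

Lemma idG_mkG (M : filmod A) : idG M = mkG M M 0 (filone M).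
Proof.
apply: val_inj; apply: (congr1 (fun f => scls f)); apply/homP => q; rewrite -[q]clsK layer_mapE.
by congr (cls _ _); apply: val_inj.
Qed.

Lemma catG_axioms : gcat_axioms (catG S).
Proof.
split.
- move=> L' M N i j f a g g'; rewrite -[f]mkG_surj -[g]mkG_surj -[g']mkG_surj.
  move: (liftG f) (liftG g) (liftG g') => f1 g1 g2.
  change (compG (mkG M N i f1) (a *: mkG L' M j g1 + mkG L' M j g2) =
    a *: compG (mkG M N i f1) (mkG L' M j g1) + compG (mkG M N i f1) (mkG L' M j g2)).
  rewrite -linearP !compG_mkG; do ?exact: gobj_independent.
  rewrite -linearP; congr (mkG _ _ _ _); apply: val_inj; apply/homP => x /=.
  by rewrite linearD; congr (_ + _); rewrite /homZ_fun linearZ.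
- move=> L' M N i j g a f f'; rewrite -[f]mkG_surj -[g]mkG_surj -[f']mkG_surj.
  move: (liftG f) (liftG g) (liftG f') => f1 g1 f2.
  change (compG (a *: mkG M N i f1 + mkG M N i f2) (mkG L' M j g1) =
    a *: compG (mkG M N i f1) (mkG L' M j g1) + compG (mkG M N i f2) (mkG L' M j g1)).
  rewrite -linearP !compG_mkG; do ?exact: gobj_independent.
  by rewrite -linearP; congr (mkG _ _ _ _); apply: val_inj; apply/homP.
- move=> M N i f; rewrite -[f]mkG_surj; move: (liftG f) => f1.
  change (existT (fun n => homG M N n) (i + 0)%N (compG (idG N) (mkG M N i f1)) =
      existT (fun n => homG M N n) i (mkG M N i f1) /\
    existT (fun n => homG M N n) i (compG (mkG M N i f1) (idG M)) =
      existT (fun n => homG M N n) i (mkG M N i f1)).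
  rewrite !idG_mkG !compG_mkG; do ?exact: gobj_independent.
  by split; apply: existT_mkG; rewrite ?addn0 //; apply/homP.
- move=> K L' M N a b c f g e; rewrite -[f]mkG_surj -[g]mkG_surj -[e]mkG_surj.
  move: (liftG f) (liftG g) (liftG e) => f1 g1 e1.
  change (existT (fun n => homG K N n) (a + c + b)%N
      (compG (mkG M N b f1) (compG (mkG L' M c g1) (mkG K L' a e1))) =
    existT (fun n => homG K N n) (a + (c + b))%N
      (compG (compG (mkG M N b f1) (mkG L' M c g1)) (mkG K L' a e1))).
  rewrite !compG_mkG; do ?exact: gobj_independent.
  by apply: existT_mkG; rewrite ?addnA //; apply/homP.
Qed.

Lemma beta_id (E : fgmod B) (M : gobj S) (p : pres X E M) :
  beta gX p p 0 (mkgr E E 0 (radone E)) = idG M.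
Proof.
rewrite betaE idG_mkG; congr (mkG _ _ _ _); apply: val_inj; apply/homP => y.
change (pres_to p (tensor_map X (idfun : {linear E -> E}) (pres_from p y)) = y).
rewrite -[RHS](pres_fromK p).
by congr (pres_to p _); apply: tensor_map_id.
Qed.

Lemma beta_comp (E E' E'' : fgmod B) (M N O : gobj S) (p : pres X E M) (q : pres X E' N)
    (r : pres X E'' O) i j (f : grhom i E' E'') (g : grhom j E E') :
  beta gX p r (j + i) (grcomp f g) = compG (beta gX q r i f) (beta gX p q j g).
Proof.
have [f1 <-] := mkgr_surj f; have [g1 <-] := mkgr_surj g.
rewrite grcomp_mkgr !betaE compG_mkG; last exact: gobj_independent.
congr (mkG _ _ _ _); apply: val_inj; apply/homP => y.
change (pres_to r (tensor_map X (comphom (val f1) (val g1)) (pres_from p y)) =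
  pres_to r (tensor_map X (val f1) (pres_from q (pres_to q (tensor_map X (val g1) (pres_from p y)))))).
rewrite pres_toK.
by congr (pres_to r _); apply: tensor_map_comp.
Qed.
End CategoryAxioms.

(** * Graded equivalences *)

Section GradedEquivalence.
Context {k : fieldType} (C D : gcat k) (axC : gcat_axioms C) (axD : gcat_axioms D).
Context (Pr : C -> D -> Type).
Context (bt : forall (E E' : C) (M N : D), Pr E M -> Pr E' N -> forall i,
  {linear ghom i E E' -> ghom i M N}).
Context (bt_bij : forall E E' M N (p : Pr E M) (q : Pr E' N) i, bijective (bt p q i)).
Context (bt_id : forall E M (p : Pr E M), bt p p 0 (gid E) = gid M).
Context (bt_comp : forall E E' E'' M N O (p : Pr E M) (q : Pr E' N) (r : Pr E'' O) i j
  (f : ghom i E' E'') (g : ghom j E E'), bt p r (j + i) (gcomp f g) = gcomp (bt q r i f) (bt p q j g)).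
Context (Phi : C -> D) (pPhi : forall E, Pr E (Phi E)) (Psi : D -> C) (pPsi : forall M, Pr (Psi M) M).

Lemma existT_nat_inj (F : nat -> Type) n (x y : F n) : existT F n x = existT F n y -> x = y.
Proof. exact: eq_from_Tagged. Qed.

Definition ibt E E' M N (p : Pr E M) (q : Pr E' N) i : {linear ghom i M N -> ghom i E E'} :=
  sval (cid (lin_inverse (bt_bij p q i))).
Lemma btK E E' M N (p : Pr E M) (q : Pr E' N) i : cancel (bt p q i) (ibt p q i).
Proof. by case: (svalP (cid (lin_inverse (bt_bij p q i)))). Qed.
Lemma ibtK E E' M N (p : Pr E M) (q : Pr E' N) i : cancel (ibt p q i) (bt p q i).
Proof. by case: (svalP (cid (lin_inverse (bt_bij p q i)))). Qed.

Lemma gsame_bt E E' M N (p : Pr E M) (q : Pr E' N) i j (f : ghom i E E') (g : ghom j E E') :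
  gsame (bt p q i f) (bt p q j g) <-> gsame f g.
Proof.
split=> fg; have ij : i = j by exact: (congr1 (fun t => projT1 t) fg).
  case: _ / ij g fg => g fg; rewrite /gsame; congr existT.
  exact: (bij_inj (bt_bij p q i) (@existT_nat_inj _ _ _ _ fg)).
by case: _ / ij g fg => g fg; rewrite (@existT_nat_inj _ _ _ _ fg).
Qed.

Lemma phi_functor_id E : bt (pPhi E) (pPhi E) 0 (gid E) = gid (Phi E).
Proof. exact: bt_id. Qed.
Lemma phi_functor_comp E E' E'' i j (f : ghom i E' E'') (g : ghom j E E') :
  bt (pPhi E) (pPhi E'') (j + i) (gcomp f g) =
  gcomp (bt (pPhi E') (pPhi E'') i f) (bt (pPhi E) (pPhi E') j g).
Proof. exact: bt_comp. Qed.
Definition phi_functor : gfunctor C D := GFunctor phi_functor_id phi_functor_comp.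

Lemma psi_functor_id M : ibt (pPsi M) (pPsi M) 0 (gid M) = gid (Psi M).
Proof. by rewrite -(bt_id (pPsi M)) btK. Qed.
Lemma psi_functor_comp M N O i j (f : ghom i N O) (g : ghom j M N) :
  ibt (pPsi M) (pPsi O) (j + i) (gcomp f g) =
  gcomp (ibt (pPsi N) (pPsi O) i f) (ibt (pPsi M) (pPsi N) j g).
Proof. by apply: (bij_inj (bt_bij (pPsi M) (pPsi O) _)); rewrite (bt_comp _ (pPsi N)) !ibtK. Qed.
Definition psi_functor : gfunctor D C := GFunctor psi_functor_id psi_functor_comp.

Lemma gid_gid (Q : gcat k) (M : Q) : gcat_axioms Q -> gcomp (gid M) (gid M) = gid M.
Proof. by move=> [_ _ ax _]; have [e _] := ax M M 0 (gid M); exact: (@existT_nat_inj _ _ _ _ e). Qed.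

(** Unit and counit are identities read through two presentations that share an object; they are
    natural and invertible because the bijections [bt] respect composition and identities. *)
Lemma gequivalent_presentations : gequivalent C D.
Proof.
split=> //; exists phi_functor, psi_functor.
have [_ _ idC _] := axC; have [_ _ idD _] := axD; split.
  pose eta E : ghom 0 (Psi (Phi E)) E := ibt (pPsi (Phi E)) (pPhi E) 0 (gid (Phi E)).
  exists eta; split=> [E|E E' i f].
    exists (ibt (pPhi E) (pPsi (Phi E)) 0 (gid (Phi E))); split.
      apply: (bij_inj (bt_bij (pPhi E) (pPhi E) 0)).
      by rewrite (bt_comp _ (pPsi (Phi E)) _ (i := 0) (j := 0)) !ibtK gid_gid // bt_id.
    apply: (bij_inj (bt_bij (pPsi (Phi E)) (pPsi (Phi E)) 0)).
    by rewrite (bt_comp _ (pPhi E) _ (i := 0) (j := 0)) !ibtK gid_gid // bt_id.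
  apply/(gsame_bt (pPsi (Phi E)) (pPhi E')).
  rewrite (bt_comp _ (pPsi (Phi E')) _) (bt_comp _ (pPhi E) _ (j := 0)) !ibtK.
  set g := bt (pPhi E) (pPhi E') i f; have [g1 g2] := idD _ _ _ g.
  exact: etrans g1 (esym g2).
pose eps M : ghom 0 (Phi (Psi M)) M := bt (pPhi (Psi M)) (pPsi M) 0 (gid (Psi M)).
exists eps; split=> [M|M N i f].
  exists (bt (pPsi M) (pPhi (Psi M)) 0 (gid (Psi M))).
  by rewrite -!(bt_comp _ _ _ (i := 0) (j := 0)) !gid_gid // !bt_id.
set g := ibt (pPsi M) (pPsi N) i f; have [g1 g2] := idC _ _ _ g.
have fE : f = bt (pPsi M) (pPsi N) i g by rewrite ibtK.
rewrite -[gfmor (idgfunctor D) f]/f fE -[gfmor (compgfunctor _ _) _]/(bt _ _ i (ibt _ _ i _)) btK.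
rewrite -(bt_comp _ (pPhi (Psi N)) _) -(bt_comp _ (pPsi M) _ (j := 0)).
apply/gsame_bt; exact: etrans g1 (esym g2).
Qed.
End GradedEquivalence.

(** * The object M *)

Section CoverData.
Context {k : fieldType} {A B : falgType k} (X : bimod A B) (I : finType) (L : I -> fgmod B).
Local Notation T f := (@tensor_map k A B X _ _ f).
Context (gX : good_bimodule X) (repL : simple_representatives L).
Let S i := tensfg X (L i).
Let Xexact := good_exact gX.
Local Opaque tensor_map.

Lemma xsub_dsum (J : finType) (V : lmodType B) (W : J -> lmodType B)
    (inj : forall j, {linear W j -> V}) n x :
  is_dsum inj -> x \in xsub X (radn V n) <->
  exists2 y : forall j, tensor X (W j), forall j, y j \in xsub X (radn (W j) n) &
    x = \sum_j T (inj j) (y j).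
Proof.
move=> injP; have [pr [prK pr0 prS]] := injP; split=> [Vx|[y yn ->]]; last first.
  by apply: rpred_sum => j _; apply: xsub_map (yn j) => z; apply: radn_lin.
exists (fun j => T (pr j) x) => [j|].
  by apply: xsub_map Vx => z; apply: radn_lin.
have [pr' [_ _ prS']] := T_dsum X injP; rewrite [LHS]prS'; apply: eq_bigr => j _.
congr (T (inj j) _).
have [q [qK q0 qS]] := T_dsum X injP.
rewrite [x in RHS]prS' linear_sum (bigD1 j) //= big1 ?addr0 => [|i ij].
  by rewrite (T_comp_ext _ (h := idfun)) ?T_id.
rewrite (T_comp_ext _ (h := \0)) ?T_zero // => z; exact: pr0.
Qed.

Lemma xsub_rad_cover (P V : fgmod B) (q : {linear P -> V}) y :
  (forall x, x \in radsub (fullsub P) <-> q x = 0) -> y \in xsub X (radsub (fullsub P)) <-> T q y = 0.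
Proof.
move=> radq; have -> : T q y = 0 <-> y \in xsub X (kersub q).
  by rewrite xsubP; exact: (T_ker Xexact).
by split; apply: xsub_mono => x; [move=> /radq/kersubP|move=> /kersubP/radq].
Qed.

(** For a projective cover [P -> V], the module [X (x) P] is projective and maps onto [X (x) V]; so
    it is a projective cover of [X (x) V] plus a rest. For simple [V] this rest is the module
    [Q_S]. *)
Record cover_data (V : fgmod B) := CoverData {
  cd_proj : fgmod B;
  cd_top : {linear cd_proj -> V};
  cd_cover : fgmod A;
  cd_map : {linear cd_cover -> tensfg X V};
  cd_rest : fgmod A;
  cd_iso : {linear tensfg X cd_proj -> prodfg cd_cover cd_rest};
  cd_projP : projective_cover cd_top;
  cd_coverP : projective_cover cd_map;
  cd_restP : projective cd_rest;
  cd_isoP : bijective cd_iso;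
  cd_isoE : forall y, cd_map (cd_iso y).1 = T cd_top y
}.

Lemma cover_data_exists (V : fgmod B) : inhabited (cover_data V).
Proof.
have [P [q qcov]] := projective_cover_exists V.
have [R [p pcov]] := projective_cover_exists (tensfg X V).
have [projP qs _] := qcov; have [projR ps _] := pcov.
have projXP : projective (tensfg X P) by apply: (good_proj gX).
have Tq_s := T_surj Xexact qs.
have [g gE] := projXP R (tensfg X V) p (T q) ps.
have [y|s sE] := projective_section (N := tensfg X P) (q := g) projR.
  apply: (cover_lift_surj (g := g) pcov) => z; have [x <-] := Tq_s z.
  by exists x; apply: gE.
pose Q := fsub (V := tensfg X P) (kersub g).
have [x|c cE] := @corestrict _ _ _ (idfun \- (s \o g)) (kersub g).
  by apply/kersubP; rewrite linearB /= sE subrr.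
pose iQ : {linear Q -> tensfg X P} := \val.
have cE' x : iQ (c x) = x - s (g x) by exact: cE.
have gQ z : g (iQ z) = 0 by apply/kersubP; apply: valP.
pose phi : {linear tensfg X P -> prodfg R Q} := lpair g c.
have phib : bijective phi.
  apply: surj_inj_bij => [[x z]|x phix].
    exists (s x + iQ z); apply/pair_equal_spec; split.
      by change (g (s x + iQ z) = x); rewrite linearD sE gQ addr0.
    apply: val_inj; change (iQ (c (s x + iQ z)) = iQ z).
    by rewrite cE' linearD sE gQ addr0 addrC addKr.
  have gx : g x = 0 := congr1 fst phix; have cx : c x = 0 := congr1 snd phix.
  by have := cE' x; rewrite cx gx (linear0 iQ) (linear0 s) subr0 => <-.
have projQ : projective Q.
  apply: (projective_retract (i := iQ) (p := c) _ projXP) => z.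
  by apply: val_inj; change (iQ (c (iQ z)) = iQ z); rewrite cE' gQ linear0 subr0.
by split; apply: (CoverData qcov pcov projQ phib) => y; apply: gE.
Qed.

Section Summand.
Context (V : fgmod B) (sV : simple V) (d : cover_data V).
Local Notation P := (cd_proj d).
Local Notation p := (cd_map d).
Local Notation Q := (cd_rest d).
Local Notation phi := (cd_iso d).

Lemma cover_rad x : x \in radsub (fullsub P) <-> cd_top d x = 0.
Proof. by apply: projective_cover_ker (cd_projP d) _; apply: semisimple_simple. Qed.

Definition cd_fil j : submodClosed (prodfg (cd_cover d) Q) := imsub phi (xsub X (radn P j)).

Lemma cd_presents : presents (X := X) (E := P) cd_fil phi.
Proof.
split=> [|j y]; first exact: cd_isoP.
split=> [Uy|/imsubP[z Uz /(bij_inj (cd_isoP d)) ->] //].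
by apply/imsubP; exists y.
Qed.

Lemma cd_fil1 x : x \in cd_fil 1 <-> p x.1 = 0.
Proof.
have [y <-] := bij_surj (cd_isoP d) x; rewrite cd_isoE -(xsub_rad_cover _ cover_rad).
by have [_ <-] := cd_presents.
Qed.

(** The kernel of [X (x) P -> X (x) V] is [X (x) rad P] on one side and the syzygy of [X (x) V] plus
    [Q] on the other. This is why adding [Q] makes the syzygy filtrable. *)
Lemma syzygy_iso : exists2 f : {linear tensor X (subm (radsub (fullsub P))) -> (subm (kersub p) * Q)%type},
  bijective f & forall y, (val (f y).1, (f y).2) = phi (T (vl (radsub (fullsub P))) y).
Proof.
set R := radsub (fullsub P).
have k0 y : p (phi (T (vl R) y)).1 = 0.
  rewrite cd_isoE; apply/(xsub_rad_cover _ cover_rad)/xsubP; by exists y.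
have [y|f1 f1E] := @corestrict _ _ _ (fst \o phi \o T (vl R)) (kersub p).
  exact/kersubP/k0.
pose f : {linear tensor X (subm R) -> (subm (kersub p) * Q)%type} := lpair f1 (snd \o phi \o T (vl R)).
have fE y : (val (f y).1, (f y).2) = phi (T (vl R) y).
  change ((val (f1 y), (phi (T (vl R) y)).2) = phi (T (vl R) y)).
  have -> : val (f1 y) = (phi (T (vl R) y)).1 by exact: f1E.
  by case: (phi _).
exists f => //; apply: surj_inj_bij => [[w z]|y fy].
  have [y yE] := bij_surj (cd_isoP d) (val w, z).
  have /xsubP[x xE] : y \in xsub X R.
    by apply/(xsub_rad_cover _ cover_rad); rewrite -cd_isoE yE; apply/kersubP/valP.
  have := fE x; rewrite -xE yE => /pair_equal_spec[e1 e2]; exists x.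
  by apply/pair_equal_spec; split; [apply: val_inj|].
apply: (vl_inj Xexact (U := R)); rewrite linear0; apply: (bij_inj (cd_isoP d)).
by rewrite -fE fy [RHS]linear0.
Qed.

(** Suppose [Q = Q' (+) Q''] and the syzygy plus [Q'] is some [X (x) K]. Then [a'] projects
    [X (x) rad P] onto [X (x) K] with kernel [Q''], and [a \o a' - id] factors through the
    projective [Q'']. As [rad P] has no projective summand, [no_proj_retract_reflect] makes [a']
    injective, so [Q'' = 0]. *)
Lemma cd_minimal : minimal_projective S (subm (kersub p)) Q.
Proof.
have [f fb fE] := syzygy_iso; split; first exact: cd_restP.
  exact: (filtrable_tensor gX repL (E := fsub (radsub (fullsub P))) fb).
move=> Q' Q'' [e eb] [F [Ffull Fdn [r Fr] Fadd]] z''.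
pose N := prodfg (fsub (kersub p)) Q'.
have [K [_ [h [hb _ _ _ _]]]] := lift_filtration (N := N) gX repL Ffull Fdn Fr Fadd.
have [h' [hh' h'h]] := lin_inverse hb; have [e' [ee' e'e]] := lin_inverse eb.
have [f' [ff' f'f]] := lin_inverse fb.
pose R := fsub (radsub (fullsub P)).
have projQ'' : projective Q''.
  pose i0 : {linear Q'' -> Q} := e' \o linr Q' Q''; pose p0 : {linear Q -> Q''} := snd \o e.
  apply: (@projective_retract _ _ Q Q'' i0 p0 _ (@cd_restP _ d)) => x.
  by rewrite /= e'e.
pose a' : {linear tensor X R -> tensor X K} :=
  h' \o lpair (fst \o f : {linear tensor X R -> subm (kersub p)})
    (fst \o e \o (snd \o f : {linear tensor X R -> Q})).
pose a : {linear tensor X K -> tensor X R} :=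
  f' \o lpair (fst \o h : {linear tensor X K -> subm (kersub p)})
    (e' \o (linl Q' Q'' \o (snd \o h : {linear tensor X K -> Q'}))).
have a'E x : h (a' x) = ((f x).1, (e (f x).2).1) by apply: h'h.
have aE x : f (a x) = ((h x).1, e' ((h x).2, 0)) by apply: f'f.
have nR : no_proj_retract R := no_proj_retract_rad (U := fullsub P) (good_injB gX).
have [||a'i _] := no_proj_retract_reflect Xexact (good_full gX) (good_faith gX) (good_npB gX)
    (F := K) (R := R) (f := a) (f' := a') nR.
- exists Q''; split=> //; exists (snd \o e \o (snd \o f : {linear tensor X R -> Q})).
  exists (\- (f' \o (linr _ Q \o (e' \o linr Q' Q'')))) => x.
  apply: (bij_inj fb); change (f (a (a' x) - x) = f (- f' (0, e' (0, (e (f x).2).2)))).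
  rewrite linearB aE a'E linearN f'f /=; apply/pair_equal_spec; split=> /=.
    by rewrite subrr oppr0.
  move: (f x).2 => t; have tE : t = e' ((e t).1, 0) + e' (0, (e t).2).
    by rewrite -linearD -[LHS]ee'; congr (e' _); exact: prod_split.
  by rewrite [X in _ - X]tE opprD addrA subrr sub0r.
- move=> y; exists (f' ((h y).1, e' ((h y).2, 0))); apply: (bij_inj hb).
  by rewrite a'E f'f /= e'e /=; case: (h y).
have /a'i x0 : a' (f' (0, e' (0, z''))) = 0.
  by apply: (bij_inj hb); rewrite a'E f'f /= e'e linear0.
have : e (f (f' (0, e' (0, z'')))).2 = (0, z'') by rewrite f'f /= e'e.
by rewrite x0 !linear0 => /pair_equal_spec[_ ->].
Qed.
End Summand.

(** The witness is [X (x) E], with [E] the sum of the projective covers of the simple [B]-modules,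
    filtered by the images of the radical series. *)
Lemma objectM_exists : exists M : gobj S, objectM M.
Proof.
have d i : cover_data (L i) by apply: inhabited_witness; apply: cover_data_exists.
pose E := dprodfg (fun i => cd_proj (d i)).
pose M0 := @FilMod k A (tensfg X E) (fun j => xsub X (radn E j)).
have M0P : presents (X := X) (E := E) (fil M0) (idfun : {linear tensor X E -> M0}).
  by split=> //; exists idfun.
pose M : gobj S := GObj (presents_radical gX repL M0P).
have sL i : simple (L i) by case: repL.
have /all_tag[f' f'P] i : {f' : {linear prodfg (cd_cover (d i)) (cd_rest (d i)) -> tensfg X (cd_proj (d i))} |
    cancel (cd_iso (d i)) f' /\ cancel f' (cd_iso (d i))}.
  exact: cid (lin_inverse (cd_isoP (d i))).
have f'b i : bijective (f' i) by have [c1 c2] := f'P i; exists (cd_iso (d i)).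
have dE := @din_dsum k B I (fun i => cd_proj (d i)).
have idb : bijective (idfun : {linear tensor X E -> tensor X E}) by exists idfun.
have inj_dsum := dsum_iso f'b idb (T_dsum X dE).
exists M, (fun i => cd_cover (d i)), (fun i => cd_rest (d i)), (fun i => cd_map (d i)).
exists (fun i => cd_fil (d i)); eexists; split; [|exact: inj_dsum|].
  move=> i; split; [exact: cd_coverP|exact: cd_minimal| |exact: cd_fil1].
  exact: presents_radical (cd_presents (d i)).
move=> j x; rewrite -[x \in _]/(x \in xsub X (radn E j)) (xsub_dsum _ _ dE).
split=> [[y yj ->]|[y yj ->]].
  exists (fun i => cd_iso (d i) (y i)) => [i|]; first by apply/imsubP; exists (y i); first exact: yj.
  by apply: eq_bigr => i _; rewrite /= (proj1 (f'P i)).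
exists (fun i => f' i (y i)) => [i|]; last by apply: eq_bigr.
by have /imsubP[z zj ->] := yj i; rewrite (proj1 (f'P i)).
Qed.
End CoverData.

(** * Projective modules determined by their tops, and the regular module *)

Section ProjectiveTops.
Context {k : fieldType} {B : falgType k}.

Lemma projective_dsum (J : finType) (V : lmodType B) (W : J -> lmodType B)
    (inj : forall j, {linear W j -> V}) :
  is_dsum inj -> (forall j, projective (W j)) -> projective V.
Proof.
move=> [pr [prK pr0 prS]] projW M N p f ps.
have /all_tag[g gE] j : {g : {linear W j -> M} | forall x, p (g x) = f (inj j x)}.
  exact: cid (projW j M N p (f \o inj j) ps).
have gL : linear (fun x => \sum_j g j (pr j x)).
  move=> a x y; rewrite scaler_sumr -big_split; apply: eq_bigr => j _.
  by rewrite !linearP.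
exists (mklin gL) => x; rewrite -[mklin gL x]/(\sum_j _) linear_sum [x in RHS]prS linear_sum.
by apply: eq_bigr => j _; rewrite gE.
Qed.

Lemma projective_top_surj (P P' V : fgmod B) (a : {linear P -> P'}) (t : {linear P -> V})
    (t' : {linear P' -> V}) :
  (forall y, exists x, t x = y) -> (forall x, t' (a x) = t x) ->
  (forall x, t' x = 0 -> x \in radsub (fullsub P')) -> forall y, exists x, a x = y.
Proof.
move=> ts ta t'r y.
have /imsubP[x _ ->] : y \in imsub a (fullsub P); last by exists x.
apply: (nakayama (U := fullsub P')) (fullsubP y) => [x _|x _]; first exact: fullsubP.
have [z zx] := ts (t' x); exists (a z); first exact: imsub_full.
by apply: t'r; rewrite linearB /= ta zx subrr.
Qed.

Lemma projective_top_unique (P P' V : fgmod B) (t : {linear P -> V}) (t' : {linear P' -> V}) :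
  projective P -> projective P' ->
  (forall y, exists x, t x = y) -> (forall y, exists x, t' x = y) ->
  (forall x, t x = 0 -> x \in radsub (fullsub P)) ->
  (forall x, t' x = 0 -> x \in radsub (fullsub P')) ->
  exists f : {linear P -> P'}, bijective f.
Proof.
move=> projP projP' ts t's tr t'r.
have [a aE] := projP P' V t' t t's; have [b bE] := projP' P V t t' ts.
have a_s := projective_top_surj ts aE t'r; have b_s := projective_top_surj t's bE tr.
exists a; apply: surj_inj_bij => // x ax.
apply: (surj_endo_inj (f := b \o a)) => [y|]; last by rewrite /= ax linear0.
by have [z <-] := b_s y; have [w <-] := a_s z; exists w.
Qed.

(** In a decomposition into two summands, one of them maps onto the simple top; by Nakayama it is
    the whole module, and the other is zero. *)
Lemma local_indecomposable (P L : fgmod B) (t : {linear P -> L}) :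
  simple L -> (forall y, exists x, t x = y) ->
  (forall x, t x = 0 -> x \in radsub (fullsub P)) -> indecomposable P.
Proof.
move=> sL ts tr; have [[y0 /eqP y0n] _] := sL; have [x0 x0E] := ts y0.
split=> [|W inj [pr [prK pr0 prS]]].
  by exists x0; apply/eqP => x00; apply: y0n; rewrite -x0E x00 linear0.
have [b [w tw]] : exists b w, t (inj b w) <> 0.
  apply: contrapT => tn; apply: y0n; rewrite -x0E [x0]prS linear_sum big1 // => b _.
  by apply: contrapT => tb; apply: tn; exists b, (pr b x0).
exists (~~ b) => x; rewrite -[x]prK.
have /imsubP[z _ ->] : inj (~~ b) x \in imsub (inj b) (fullsub (W b)).
  apply: (nakayama (U := fullsub P)) (fullsubP _) => [y _|y _]; first exact: fullsubP.
  have ts' : forall y, exists x, (t \o inj b) x = y by apply: simple_surj => //; exists w.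
  have [z zy] := ts' (t y); exists (inj b z); first exact: imsub_full.
  by apply: tr; rewrite linearB /= -zy subrr.
by rewrite pr0 //; case: b {w tw x z}.
Qed.

(** Decompose [B / rad B] into simples [L (c j)]. The sum of the [E (c j)] and [B] are projective
    with the same top, hence isomorphic. Basicness makes [c] injective; it is surjective because
    every simple module is a quotient of [B / rad B]. *)
Lemma basic_regular_dsum (I : finType) (L E : I -> fgmod B) (t : forall i, {linear E i -> L i}) :
  simple_representatives L -> basic B ->
  (forall i, projective (E i)) -> (forall i y, exists x, t i x = y) ->
  (forall i x, t i x = 0 -> x \in radsub (fullsub (E i))) ->
  exists inj : forall i, {linear E i -> (B^o : lmodType B)}, is_dsum inj.
Proof.
move=> repL basicB projE ts tr; have [sL Linj Lall] := repL.
pose W := fquo (radsub (fullsub (regfg (A := B)))).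
have ssW : semisimple W by exact: semisimple_quo.
have [J [c [inj injP]]] := semisimple_dsum repL ssW.
have [pr [prK pr0 prS]] := injP.
pose D := dprodfg (fun j => E (c j)); have dD := @din_dsum k B J (fun j => E (c j)).
have projD : projective D by apply: projective_dsum dD _ => j; apply: projE.
have tL : linear (fun x : D => \sum_j inj j (t (c j) (x j))).
  move=> a x y; rewrite scaler_sumr -big_split; apply: eq_bigr => j _.
  by rewrite -[(a *: x + y) j]/(a *: x j + y j) !linearP.
pose tD : {linear D -> W} := mklin tL.
have prt x j : pr j (tD x) = t (c j) (x j).
  rewrite linear_sum (bigD1 j) //= prK big1 ?addr0 // => i ij; exact: pr0.
have tD_s y : exists x, tD x = y.
  have [x xE] : exists x : D, forall j, t (c j) (x j) = pr j y.
    have /all_tag[x xE] j : {x : E (c j) | t (c j) x = pr j y} by exact: cid (ts _ _).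
    by exists x.
  by exists x; rewrite [RHS]prS; apply: eq_bigr => j _; rewrite xE.
have tD_r x : tD x = 0 -> x \in radsub (fullsub D).
  move=> tx; have [pd [_ _ pdS]] := dD.
  have -> : x = \sum_j din (fun j => E (c j) : lmodType B) j (x j).
    apply: dprodP => j; rewrite -[RHS]/(dpr _ j _) linear_sum (bigD1 j) //= dfwith_in big1 ?addr0 // => i ij.
    by rewrite dfwith_out.
  apply: rpred_sum => j _; apply: (@radn_lin _ _ _ _ _ 1); apply: tr.
  by rewrite -prt tx linear0.
have [f fb] := projective_top_unique projD (@regular_projective _ B) tD_s
  (@cls_surj _ _ (radsub (fullsub (regfg (A := B))))) tD_r (fun x => proj1 (cls0 _ x)).
have idb j : bijective (idfun : {linear E (c j) -> E (c j)}) by exists idfun.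
have dB := dsum_iso idb fb dD.
have cI : injective c.
  move=> j j' cjj'.
  have := basicB _ _ _ _ (dsum_reindex (enum_val_bij J) dB) (enum_rank j) (enum_rank j').
  rewrite !enum_rankK cjj' => /(_ _ _)/enum_rank_inj; apply; last by exists idfun; exists idfun.
  by move=> i; apply: local_indecomposable (sL _) (ts _) (tr _).
have cS i : exists j, c j = i.
  have [[y /eqP y0] _] := sL i.
  have fs : forall z, exists x, orbit_lin y x = z.
    by apply: simple_surj (sL i) _; exists (1 : B); rewrite /= scale1r.
  have [//|x rx|g gE] := factor_surj (p := cls (radsub (fullsub (regfg (A := B))))) (q := orbit_lin y).
  - exact: cls_surj.
  - by apply: semisimple_kill (semisimple_simple (sL i)) _; apply/cls0.
  have [j [x gx]] : exists j x, g (inj j x) <> 0.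
    apply: contrapT => gn; apply: y0.
    have [w ->] : exists w, y = g w.
      by exists (cls (radsub (fullsub (regfg (A := B)))) (1 : B)); rewrite gE /= scale1r.
    rewrite [w]prS linear_sum big1 // => j _.
    by apply: contrapT => gj; apply: gn; exists j, (pr j w).
  exists j; apply: Linj; exists (g \o inj j); apply: schur => //; by exists x.
have [dI dIE] := choice cS.
have dIb : bijective dI by exists c => [i|j]; [exact: dIE|apply: cI; rewrite dIE].
have /all_tag[r rb] i : {r : {linear E i -> E (c (dI i))} | bijective r}.
  by apply: cid; rewrite dIE; exists idfun; exists idfun.
have idB : bijective (idfun : {linear (B^o : lmodType B) -> (B^o : lmodType B)}) by exists idfun.
by eexists; exact: dsum_iso rb idB (dsum_reindex dIb dB).
Qed.
End ProjectiveTops.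

(** * The graded algebra of [B] and graded endomorphisms of the regular module *)

Section GradedAlgebra.
Context {k : fieldType} (B : falgType k).
Local Notation regB := (B^o : lmodType B).

Lemma rmul_linear (x : regB) : linear (fun b : regB => (b : B) * (x : B) : regB).
Proof. by move=> a b c; rewrite mulrDl -mulrA. Qed.
Definition rmul (x : regB) : hom regB regB := mklin (rmul_linear x).

Section Component.
Context (i : nat).

Lemma rmul_radhom (x : subm (radn regB i)) : rmul (val x) \in radhom regB regB i.
Proof. by apply/radhomP => b; apply: (rpredZ (b : B)); apply: valP. Qed.

Definition gralg_to_fun (q : gralg_component B i) : grhom i regB regB :=
  mkgr regB regB i (exist (fun h => h \in _) _ (rmul_radhom (repr (q : subquo (radn regB i) (radn regB i.+1))))).

Lemma gralg_toE (x : subm (radn regB i)) :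
  gralg_to_fun (scl _ _ x) = mkgr regB regB i (exist (fun h => h \in _) _ (rmul_radhom x)).
Proof.
apply/clsP/presubP/radhomP => b.
have /presubP xE := repr_cls (presub (\val : {linear subm (radn regB i) -> regB}) (radn regB i.+1)) x.
set r := repr _ in xE *.
change (((b : B) * (val r : B) - (b : B) * (val x : B) : regB) \in radn regB i.+1).
by rewrite -mulrBr; exact: (rpredZ (b : B)).
Qed.

Lemma gralg_to_linear : linear gralg_to_fun.
Proof.
move=> a q r; have [x <-] := scl_surj q; have [y <-] := scl_surj r.
have -> : a *: (scl _ _ x : gralg_component B i) + (scl _ _ y : gralg_component B i) =
  scl (radn regB i) (radn regB i.+1) ((a%:A : B) *: x + y) by rewrite linearP.
rewrite !gralg_toE -linearP; congr (mkgr _ _ _ _); apply: val_inj; apply/homP => b.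
change ((b : B) * ((a%:A : B) * (val x : B) + (val y : B)) =
  (a%:A : B) * ((b : B) * (val x : B)) + (b : B) * (val y : B)).
by rewrite mulrDr -!scalerAl !mul1r -scalerAr.
Qed.
Definition gralg_to : {linear gralg_component B i -> grhom i regB regB} := mklin gralg_to_linear.

(** The inverse is evaluation at [1], which detects the filtration degree of an endomorphism because
    [radn regB i] is a left ideal. *)
Lemma gralg_to_bij : bijective gralg_to.
Proof.
apply: surj_inj_bij => [g|q].
  have [g' <-] := mkgr_surj g.
  have g1 : (val g' : hom regB regB) (1 : B) \in radn regB i by have /radhomP := valP g'; apply.
  exists (scl _ _ (exist (fun x => x \in _) _ g1)); rewrite [LHS]gralg_toE; congr (mkgr _ _ _ _).
  apply: val_inj; apply/homP => b.
  change ((b : B) *: ((val g' : hom regB regB) (1 : B)) = (val g' : hom regB regB) b).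
  by rewrite -linearZ; congr ((val g' : hom regB regB) _); apply: mulr1.
have [x <-] := scl_surj q; rewrite [LHS]gralg_toE => /mkgr0/radhomP/(_ (1 : B)) x0.
by apply/scl0; rewrite -[val x](mul1r (val x : B)).
Qed.
End Component.

Lemma gralg_to_one : gralg_to 0 (gone (gralg B)) = gid (regfg (A := B) : grmod B).
Proof.
rewrite [LHS]gralg_toE; congr (scl _ _ _); apply: val_inj; apply/homP => b; exact: mulr1.
Qed.

Lemma gralg_to_mul i j (x : gralg B i) (y : gralg B j) :
  gralg_to (i + j) (gmul (gralg B) x y) = grcomp (gralg_to j y) (gralg_to i x).
Proof.
rewrite grcomp_mkgr [LHS]gralg_toE; congr (mkgr _ _ _ _); apply: val_inj; apply/homP => b.
exact: mulrA.
Qed.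
End GradedAlgebra.

Lemma no_proj_retract_simple (k : fieldType) (B : falgType k) (L : fgmod B) :
  no_projective_simple B -> simple L -> no_proj_retract L.
Proof.
move=> npB sL P i p projP pi x; apply: contrapT => x0.
apply: (npB L sL); apply: (projective_retract (i := p) (p := i) _ projP) => y.
have is_ : forall y, exists x, i x = y.
  apply: simple_surj => //; exists x => ix; apply: x0.
  by rewrite -[x]pi ix linear0.
by have [z <-] := is_ y; rewrite pi.
Qed.

Section GoodBimodule.
Context {k : fieldType} {A B : falgType k} (X : bimod A B).

Lemma stable_equivalence_good :
  split_algebra B -> self_injective A -> self_injective B -> no_projective_simple B ->
  induces_stable_equivalence X -> no_projective_summand X -> good_bimodule X.
Proof.
move=> splitB saA saB npB [Xexact [pp [/equivalence_full_faithful[faith full] _]]] npX.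
split=> // [M N f|M N g sg|L sL].
- have [g' g'E] := full M N (scls (f : hom (tensor X M) (tensor X N))); exists (repr (g' : shom M N)).
  have /clsP/mksubP/factors_projE : scls (f : hom (tensor X M) (tensor X N)) =
      scls (tenshom X (repr (g' : shom M N))) by rewrite -g'E.
  exact: stably_zero_ext.
- have : scls (g : hom M N) = scls (0 : hom M N) :> mor (M : stab B) N.
    apply: faith.
    have E (f : hom M N) : fmor (tensor_stab pp) (scls f : mor (M : stab B) N) = scls (tenshom X f).
      exact: tensor_shomE.
    rewrite !E; apply: (proj2 (clsP _ _ _)); apply/mksubP/factors_projE.
    apply: (stably_zero_ext _ sg) => x.
    change (tensor_map X g x = tensor_map X g x - tensor_map X (\0 : {linear M -> N}) x).
    by rewrite T_zero subr0.
  move=> /clsP/mksubP/factors_projE; apply: stably_zero_ext => x.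
  change (g x - 0 = g x); exact: subr0.
- exact: no_proj_retract_tensor_simple.
Qed.
End GoodBimodule.

Section RegularPresentation.
Context {k : fieldType} {A B : falgType k} (X : bimod A B) (I : finType) (L : I -> fgmod B).
Local Notation T f := (@tensor_map k A B X _ _ f).
Context (gX : good_bimodule X) (repL : simple_representatives L).
Let S i := tensfg X (L i).
Let Xexact := good_exact gX.
Local Opaque tensor_map.

(* The filtration makes P (+) Q = X (x) E with E projective over B and X (x) (E / rad E) = X (x) L,
   so that E is a projective cover of L. *)
Lemma summand_presentation (V P Q : fgmod A) (W : fgmod B) (p : {linear P -> tensfg X W})
    (F : nat -> submodClosed (prodfg P Q)) :
  simple W -> summandM S p F ->
  exists (E : fgmod B) (h : {linear tensor X E -> prodfg P Q}) (t : {linear E -> W}),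
    [/\ presents (X := X) F h, projective E, forall y, exists x, t x = y &
        forall x, t x = 0 -> x \in radsub (fullsub E)].
Proof.
move=> sW [[projP ps _] [projQ _ _] radF F1].
have [E [h ph]] := radical_presents gX repL radF; have [hb hF] := ph.
have [h' [hh' h'h]] := lin_inverse hb.
have projXE : projective (tensfg X E).
  exact: (projective_retract (i := h) (p := h') hh' (projective_prod projP projQ)).
have projE : projective E.
  apply: stably_zero_id_projective; apply: (good_faith gX).
  by apply: (stably_zero_from_projective (P := tensfg X E)).
pose r := p \o (fst \o h : {linear tensor X E -> P}).
pose Y := fquo (radsub (fullsub E)).
have r0 y : r y = 0 <-> T (cls (radsub (fullsub E))) y = 0.
  rewrite -(xsub_cls Xexact) -[radsub _]/(radn E 1) hF F1; split=> //.
have r_s y : exists x, r x = y.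
  by have [x <-] := ps y; exists (h' (x, 0)); rewrite /r /= h'h.
have [|x /r0 //|a aE] := factor_surj (p := T (cls (radsub (fullsub E)))) (q := r).
  by apply: (T_surj (N := Y) Xexact); exact: cls_surj.
have ab : bijective a.
  apply: surj_inj_bij => [y|x].
    by have [x <-] := r_s y; exists (T (cls _) x).
  have [y <-] := T_surj (N := Y) Xexact (@cls_surj _ _ (radsub (fullsub E))) x.
  by rewrite aE => /r0.
have [a' [aa' a'a]] := lin_inverse ab.
have [|y|_ [g gb]] := no_proj_retract_reflect Xexact (good_full gX) (good_faith gX) (good_npB gX)
    (F := Y) (R := W) (f := a) (f' := a') (no_proj_retract_simple (good_npB gX) sW).
- by apply: (stably_zero_ext (f := \0)); [move=> x /=; rewrite a'a subrr|exact: stably_zero0].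
- by exists (a y).
exists E, h, (g \o cls (radsub (fullsub E))); split=> // [y|x /= gx].
  have [z <-] := bij_surj gb y; have [x <-] := cls_surj z; by exists x.
exact: (proj1 (cls0 _ x) (inj_lin0 (bij_inj gb) gx)).
Qed.

(** Each summand of [M] is [X (x) E i] with [E i] a projective cover of [L i]. Since [B] is basic it
    is the direct sum of the [E i]; tensoring and radicals commute with direct sums, so the
    filtrations agree too. *)
Lemma objectM_presentation (M : gobj S) : basic B -> objectM M ->
  inhabited (pres X (regfg (A := B)) M).
Proof.
move=> basicB [P [Q [p [F [inj [sum injP Mfil]]]]]]; have [sL _ _] := repL.
pose data i (E : fgmod B) := {h : {linear tensor X E -> prodfg (P i) (Q i)} &
  {t : {linear E -> L i} |
    [/\ presents (X := X) (F i) h, projective E, forall y, exists x, t x = y &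
        forall x, t x = 0 -> x \in radsub (fullsub E)]}}.
have /all_tag[E /all_tag[h /all_tag[t dP]]] i : {E : fgmod B & data i E}.
  apply: inhabited_witness.
  by have [E [h [t tP]]] := summand_presentation (Q i) (sL i) (sum i); split; exists E, h, t.
have [|||io ioP] := basic_regular_dsum (E := E) (t := t) repL basicB.
- by move=> i; case: (dP i).
- by move=> i; case: (dP i).
- by move=> i; case: (dP i).
have hb i : bijective (h i) by case: (dP i) => -[].
have /all_tag[h' h'P] i : {h' : {linear prodfg (P i) (Q i) -> tensor X (E i)} |
    cancel (h i) h' /\ cancel h' (h i)}.
  exact: cid (lin_inverse (hb i)).
have h'b i : bijective (h' i) by have [c1 c2] := h'P i; exists (h i).
have idb : bijective (idfun : {linear tensor X (regfg (A := B)) -> tensor X (regfg (A := B))}).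
  by exists idfun.
have [H Hb HE] := dsum_bij (dsum_iso h'b idb (T_dsum X ioP)) injP.
have HE' i y : H (T (io i) y) = inj i (h i y) by rewrite -HE /= (proj1 (h'P i)).
suff Hp : presents (X := X) (E := regfg (A := B)) (fil M) H by have [q _] := presents_pres Hp.
split=> // j y; rewrite Mfil (xsub_dsum _ _ ioP); split=> -[z zj yE].
  exists (fun i => h i (z i)) => [i|].
    by have [[_ hF] _ _ _] := dP i; apply/hF; apply: zj.
  by rewrite yE linear_sum; apply: eq_bigr => i _; apply: HE'.
exists (fun i => h' i (z i)) => [i|].
  by have [[_ hF] _ _ _] := dP i; apply/hF; rewrite (proj2 (h'P i)); apply: zj.
apply: (bij_inj Hb); rewrite yE linear_sum; apply: eq_bigr => i _.
by rewrite HE' (proj2 (h'P i)).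
Qed.

Lemma gralg_endG (M : gobj S) (p : pres X (regfg (A := B)) M) :
  galg_isomorphic (gralg B) (gend_op (C := catG S) M).
Proof.
exists (fun i => beta gX p p i \o gralg_to B i); split=> [i||i j x y].
- apply: bij_comp; [exact: beta_bij|exact: gralg_to_bij].
- rewrite -[LHS]/(beta gX p p 0 (gralg_to B 0 (gone (gralg B)))) gralg_to_one.
  change (beta gX p p 0 (mkgr (regfg (A := B)) (regfg (A := B)) 0 (radone _)) = idG M).
  exact: (beta_id gX p).
- rewrite -[LHS]/(beta gX p p (i + j) (gralg_to B (i + j) _)) gralg_to_mul.
  exact: (beta_comp gX repL p p p (gralg_to B j y) (gralg_to B i x)).
Qed.

Definition tensor_filmod (E : fgmod B) : filmod A :=
  @FilMod k A (tensfg X E) (fun j => xsub X (radn E j)).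

Definition tensor_pres (E : fgmod B) : pres X E (tensor_filmod E) :=
  @Pres k A B X E (tensor_filmod E) idfun idfun (fun=> erefl) (fun=> erefl)
    (fun j y => iff_refl (y \in xsub X (radn E j))).

Lemma tensor_radical (E : fgmod B) : radical_filtration S (fil (tensor_filmod E)).
Proof.
apply: (presents_radical gX repL (E := E) (h := idfun : {linear tensor X E -> tensfg X E})).
by split=> //; exists idfun.
Qed.

Definition tensor_gobj (E : fgmod B) : gobj S := GObj (tensor_radical E).

Lemma gequivalent_grmod_catG : gequivalent (grmod B) (catG S).
Proof.
have /all_tag[Psi pPsi] (M : gobj S) : {E : fgmod B & pres X E M}.
  by apply: inhabited_witness; have [E [p]] := gobj_pres gX repL M; split; exists E.
apply: (@gequivalent_presentations k (grmod B) (catG S) (@grmod_axioms k B) (catG_axioms gX repL)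
  (fun E M => pres X E M) (fun E E' M N p q i => beta gX p q i)
  _ _ _ tensor_gobj tensor_pres Psi pPsi).
- by move=> E E' M N p q i; apply: beta_bij.
- move=> E M p; change (beta gX p p 0 (mkgr E E 0 (radone E)) = idG M).
  exact: (beta_id gX p).
- by move=> E E' E'' M N O p q r i j f g; exact: (beta_comp gX repL p q r f g).
Qed.
End RegularPresentation.

Theorem theorem4p23 (k : fieldType) (A B : falgType k) (X : bimod A B)
    (I : finType) (L : I -> fgmod B) :
  split_algebra A -> split_algebra B ->
  self_injective A -> self_injective B ->
  no_projective_simple A -> no_projective_simple B ->
  induces_stable_equivalence X -> no_projective_summand X ->
  simple_representatives L ->
  let S : I -> fgmod A := fun i => tensfg X (L i) in
  [/\ gequivalent (grmod B) (catG S),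
      exists M : gobj S, objectM M &
      basic B -> forall M : gobj S, objectM M ->
        galg_isomorphic (gralg B) (gend_op (C := catG S) M)].
Proof.
move=> _ splitB saA saB _ npB Xeq npX repL S.
have gX := stable_equivalence_good splitB saA saB npB Xeq npX; split.
- exact: gequivalent_grmod_catG gX repL.
- exact: objectM_exists gX repL.
- move=> basicB M objM; have [p] := objectM_presentation gX repL basicB objM.
  exact: (gralg_endG gX repL p).
Qed.
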